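(* Let $d\geq1$, $k\geq1$, $\boldsymbol\mu\in\mathbb{S}^d$ known, $\rho\in[-1,1]$, and $\boldsymbol X_1,\dots,\boldsymbol X_n$ iid $\mathrm{C}_k(\boldsymbol\mu,\rho)$. Define $$\hat\rho_{\mathrm{GM}}=\frac{\tau_{k,d}}{n}\sum_{i=1}^nC_k^{(d-1)/2}(\boldsymbol\mu^\top\boldsymbol X_i).$$ Then (i) $\hat\rho_{\mathrm{GM}}$ is unbiased for $\rho$; (ii) $\hat\rho_{\mathrm{GM}}\to\rho$ almost surely; (iii) $\sqrt n(\hat\rho_{\mathrm{GM}}-\rho)\rightsquigarrow\mathcal N(0,\sigma^2_{\mathrm{GM},k}(\rho))$, where $\sigma^2_{\mathrm{GM},k}(\rho)=d_{k,d}+\rho\,\eta_{k,d}1_{\{k\text{ even}\}}-\rho^2$, with $\eta_{k,1}=0$ and, for $d\geq2$, $$\eta_{k,d}=\frac{(2k+d-1)^2}{(3k+d-1)(d-1)}\frac{k!}{((k/2)!)^3}\frac{\Gamma((d+k-1)/2)^3\Gamma(d+3k/2-1)}{\Gamma(d+k-1)\Gamma((d-1)/2)^2\Gamma((d+3k-1)/2)}.$$ Moreover, for $k=1$, $\sigma^2_{\mathrm{GM},1}(\rho)=d+1-\rho^2$, and for $k=2$, $\sigma^2_{\mathrm{GM},2}(\rho)=\frac{d(d+3)}{2}+\frac{2(d-1)(d+3)}{d+5}\rho-\rho^2$.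
   Context: For $d\geq1$, $\mathbb{S}^d$ is the unit sphere of $\mathbb{R}^{d+1}$ with surface area measure $\sigma_d$ and total area $\omega_d=2\pi^{(d+1)/2}/\Gamma((d+1)/2)$. For $d\geq2$, $C_k^{(d-1)/2}$ is the standard Gegenbauer polynomial of degree $k$ and index $(d-1)/2$ (generating function $(1-2xt+t^2)^{-(d-1)/2}$); for $d=1$, $C_k^0:=T_k$, $T_k(x)=\cos(k\cos^{-1}x)$. $\tilde C_k^{(d-1)/2}=C_k^{(d-1)/2}/C_k^{(d-1)/2}(1)$. $\tau_{k,d}=1+2k/(d-1)$ for $d\geq2$ and $\tau_{k,1}=2-\delta_{k,0}$. $d_{k,d}=(1+2k/(d-1))\Gamma(d-1+k)/(\Gamma(d-1)k!)$ for $d\geq2$, $d_{k,1}=2-\delta_{k,0}$. $\mathrm{C}_k(\boldsymbol\mu,\rho)$ is the distribution on $\mathbb{S}^d$ with density $\omega_d^{-1}\{1+\rho\,\tilde C_k^{(d-1)/2}(\boldsymbol x^\top\boldsymbol\mu)\}$ w.r.t. $\sigma_d$. *)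

(* Defs.v *)
From mathcomp Require Import all_boot all_order all_algebra.
From mathcomp Require Import all_classical all_reals all_analysis.
Set Implicit Arguments. Unset Strict Implicit. Unset Printing Implicit Defensive.
Import Order.TTheory GRing.Theory Num.Theory.
Import numFieldTopology.Exports numFieldNormedType.Exports.
Local Open Scope classical_set_scope.
Local Open Scope ring_scope.

Section defs.
Context {R : realType}.

Definition Gamma (x : R) : R :=
  fine (\int[lebesgue_measure]_(t in (`]0%R, +oo[ : set R))
          ((t `^ (x - 1)) * expR (- t))%:E)%E.

Definition dotv (n : nat) (u v : 'rV[R]_n) : R := \sum_(j < n) u ord0 j * v ord0 j.
Definition enorm (n : nat) (x : 'rV[R]_n) : R := Num.sqrt (dotv x x).

Definition sphere (d : nat) : set 'rV[R]_(d.+1) := [set x | dotv x x = 1].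


Definition borel_rV (n : nat) (A : set 'rV[R]_n) : Prop :=
  <<s [set U : set 'rV[R]_n | open U] >> A.

(** Iterated one-dimensional Lebesgue integrals: the Lebesgue integral on R^n
    (of non-negative measurable functions, by Tonelli). *)
Fixpoint iint (n : nat) : ((nat -> R) -> \bar R) -> \bar R :=
  match n with
  | 0 => fun F => F (fun _ => 0)
  | m.+1 => fun F => (\int[lebesgue_measure]_(t in [set: R])
                       iint m (fun x => F (fun j => if j == m then t else x j)))%E
  end.

Definition lebesgue_int_rV (n : nat) (f : 'rV[R]_n -> \bar R) : \bar R :=
  iint n (fun x => f (\row_(j < n) x j)).

(** Integral against the surface area measure sigma_d on S^d (non-negative f),
    via the cone construction:
    int_{S^d} f dsigma_d = (d+1) * int_{0 < |x| <= 1} f(x/|x|) dx. *)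
Definition sphere_int (d : nat) (f : 'rV[R]_(d.+1) -> \bar R) : \bar R :=
  ((d.+1)%:R%:E * lebesgue_int_rV
     (fun x : 'rV[R]_(d.+1) =>
        if ((0 < enorm x) && (enorm x <= 1))%R then f ((enorm x)^-1 *: x)%R else 0%E))%E.

Definition omega (d : nat) : R :=
  2 * pi `^ ((d.+1)%:R / 2) / Gamma ((d.+1)%:R / 2).

(** Gegenbauer polynomial C_k^{(d-1)/2}(x): for d >= 2 the k-th Taylor
    coefficient at t = 0 of the generating function (1 - 2xt + t^2)^{-(d-1)/2};
    for d = 1, C_k^0 := T_k (Chebyshev). *)
Definition gegen_gf (lam x : R) (t : R) : R := (1 - 2 * x * t + t ^+ 2) `^ (- lam).

Definition gegen (d k : nat) (x : R) : R :=
  if d == 1%N then cos (k%:R * acos x)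
  else (derive1n k (gegen_gf ((d%:R - 1) / 2) x) 0) / (k`!)%:R.

Definition gegen_tilde (d k : nat) (x : R) : R := gegen d k x / gegen d k 1.

Definition tau (k d : nat) : R :=
  if d == 1%N then (if k == 0%N then 1 else 2) else 1 + 2 * k%:R / (d%:R - 1).

Definition dkd (k d : nat) : R :=
  if d == 1%N then (if k == 0%N then 1 else 2)
  else (1 + 2 * k%:R / (d%:R - 1)) * Gamma (d%:R - 1 + k%:R)
       / (Gamma (d%:R - 1) * (k`!)%:R).

Definition Ck_density (d k : nat) (mu : 'rV[R]_(d.+1)) (rho : R)
    (x : 'rV[R]_(d.+1)) : R :=
  (omega d)^-1 * (1 + rho * gegen_tilde d k (dotv x mu)).

Definition eta (k d : nat) : R :=
  if d == 1%N then 0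
  else let dR := d%:R in let kR := k%:R in
    (2 * kR + dR - 1) ^+ 2 / ((3 * kR + dR - 1) * (dR - 1))
    * ((k`!)%:R / ((k./2)`!)%:R ^+ 3)
    * (Gamma ((dR + kR - 1) / 2) ^+ 3 * Gamma (dR + 3 * kR / 2 - 1)
       / (Gamma (dR + kR - 1) * Gamma ((dR - 1) / 2) ^+ 2
          * Gamma ((dR + 3 * kR - 1) / 2))).

Definition sigma2_GM (d k : nat) (rho : R) : R :=
  dkd k d + rho * eta k d * (~~ odd k)%:R - rho ^+ 2.

End defs.

Arguments sphere {R} d.

Definition rho_hat_GM {R : realType} {T : Type} (d k : nat) (mu : 'rV[R]_(d.+1))
    (X : nat -> T -> 'rV[R]_(d.+1)) (n : nat) (w : T) : R :=
  tau k d / n%:R * \sum_(i < n) gegen d k (dotv mu (X i w)).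

Definition iid_Ck {R : realType} {dT : measure_display} {T : measurableType dT}
    (P : probability T R) (d k : nat) (mu : 'rV[R]_(d.+1)) (rho : R)
    (X : nat -> T -> 'rV[R]_(d.+1)) : Prop :=
  [/\ (forall i (A : set 'rV[R]_(d.+1)), borel_rV A -> measurable (X i @^-1` A)),
      (forall (s : seq nat) (A : nat -> set 'rV[R]_(d.+1)),
          uniq s -> (forall i, borel_rV (A i)) ->
          P (\big[setI/setT]_(i <- s) (X i @^-1` A i))
          = (\prod_(i <- s) P (X i @^-1` A i))%E) &
      (forall i (A : set 'rV[R]_(d.+1)), borel_rV A ->
          P (X i @^-1` A)
          = sphere_int (fun x => ((\1_A x) * Ck_density k mu rho x)%:E))].

Definition cvg_dist_normal {R : realType} {dT : measure_display} {T : measurableType dT}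
    (P : probability T R) (Z : nat -> T -> R) (v : R) : Prop :=
  forall h : R -> R, continuous h -> (exists M : R, forall x, `|h x| <= M) ->
    ('E_P[h \o Z n] @[n --> \oo] -->
       (\int[normal_prob 0 (Num.sqrt v)]_x (h x)%:E)%E)%E.

(* Main.v *)
(** All three limit statements concern Y_i = <mu, X_i>, which are iid.  The law of
    <mu, U> for U uniform on the sphere only enters through its moments: rotation
    invariance of Lebesgue measure (plane rotations are products of shears) shows
    that E <u, U>^N is proportional to |u|^N, which forces the recurrence
    (n + d + 1) m_(n+2) = (n + 1) m_n.  On polynomials this determines a linear
    functional L, for which integration by parts and the three-term recurrence give
    the first three moments of the normalised Gegenbauer polynomial p, and these
    are all that the mean and variance of the score dkd * p(Y_i) - rho involve.
    The variance is positive by Cauchy-Schwarz against the polynomial of degree 2k.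
    The score is bounded almost surely, so the strong law follows from fourth
    moments, and the central limit theorem from Trotter's comparison of the
    averaging operators f |-> E f(. + xi / sqrt n) and their Gaussian counterparts on
    C^3 test functions, any bounded continuous function being approximated by its
    iterated moving averages. *)
From HB Require Import structures.
Require Import Defs.
From mathcomp Require Import all_boot all_order all_algebra.
From mathcomp Require Import all_classical all_reals all_analysis.
From mathcomp Require Import measurable_realfun.
From mathcomp Require Import ring lra zify.
Set Implicit Arguments. Unset Strict Implicit. Unset Printing Implicit Defensive.
Import Order.TTheory GRing.Theory Num.Theory.
Import numFieldTopology.Exports numFieldNormedType.Exports.
Local Open Scope classical_set_scope.
Local Open Scope ring_scope.

(** * Normalised Gegenbauer polynomials *)

(** Dividing by [C_k(1)] gives one recurrence for every index [lam >= 0], the case [d = 1] being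
    [lam = 0]; only the norms and triple products, whose recurrences degenerate there, need separate
    Chebyshev arguments. No density on [-1, 1] and no beta integral occurs: the moment recurrence
    stands for the weight [(1 - x^2)^(lam - 1/2)]. Nor is the area of the sphere evaluated: since P
    has mass 1, the mass of the uniform law must be [omega d]. The third moment is the hard one. Its
    recurrence does not close on equal degrees, so Dougall's triple product formula is proved for
    three arbitrary degrees by induction on one of them and then specialised. Its instance k, k, 2k
    supplies, for [d >= 2], the non-zero component behind the positivity of the variance; positivity
    in turn allows Gaussian steps of positive deviation in the limit theorem, also at [rho = 1] and
    [rho = -1]. *)

Section normalized_gegenbauer.
Variables (F : realFieldType) (lam : F).
Hypothesis lam_ge0 : 0 <= lam.

(** Two consecutive terms are carried to make the three-term recurrence structural; [ngeg k] is
    [C_k(x) / C_k(1)] of index [lam], hence [T_k] when [lam = 0]. *)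
Fixpoint ngeg_pair (k : nat) : {poly F} * {poly F} :=
  if k is j.+1 then
    let: (a, b) := ngeg_pair j in
    (b, (j.+1%:R + 2 * lam)^-1%:P *
        ((2 * (j.+1%:R + lam))%:P * ('X * b) - j.+1%:R%:P * a))
  else (1, 'X).

Definition ngeg k := (ngeg_pair k).1.

Lemma ngeg0 : ngeg 0 = 1. Proof. by []. Qed.
Lemma ngeg1 : ngeg 1 = 'X. Proof. by []. Qed.

Lemma ngegSS k : ngeg k.+2 = (k.+1%:R + 2 * lam)^-1%:P *
        ((2 * (k.+1%:R + lam))%:P * ('X * ngeg k.+1) - k.+1%:R%:P * ngeg k).
Proof. by rewrite /ngeg /=; case: (ngeg_pair k). Qed.

Lemma polyCVf (a : F) : a != 0 -> a%:P * a^-1%:P = 1.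
Proof. by move=> a0; rewrite -polyCM mulfV. Qed.

Lemma ngeg_rec k : (k%:R + 2 * lam)%:P * ngeg k.+1 =
  (2 * (k%:R + lam))%:P * ('X * ngeg k) - k%:R%:P * ngeg k.-1.
Proof.
case: k => [|k]; first by rewrite ngeg0 ngeg1 !add0r mulr1 mul0r subr0.
rewrite ngegSS [LHS]mulrA polyCVf ?mul1r// gt_eqF//.
by rewrite ltr_wpDr ?mulr_ge0// ltr0Sn.
Qed.

Lemma horner_ngeg1 k : (ngeg k).[1] = 1.
Proof.
suff: (ngeg k).[1] = 1 /\ (ngeg k.+1).[1] = 1 by case.
elim: k => [|k [IH1 IH2]]; first by rewrite ngeg0 ngeg1 hornerC hornerX.
split=> //; rewrite ngegSS !(hornerM, hornerC, hornerX, hornerD, hornerN) IH1 IH2.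
have : k.+1%:R + 2 * lam != 0 by rewrite gt_eqF// ltr_wpDr ?mulr_ge0// ltr0Sn.
by move=> h; field; rewrite nat1r.
Qed.

Lemma deriv_ngeg k : (1 - 'X ^+ 2) * (ngeg k)^`() =
  k%:R%:P * (ngeg k.-1 - 'X * ngeg k).
Proof.
suff: (1 - 'X ^+ 2) * (ngeg k)^`() = k%:R%:P * (ngeg k.-1 - 'X * ngeg k) /\
  (1 - 'X ^+ 2) * (ngeg k.+1)^`() = k.+1%:R%:P * (ngeg k - 'X * ngeg k.+1) by case.
elim: k => [|k [IH1 IH2]].
  by rewrite ngeg0 ngeg1 derivC derivX !(mulr0,mul0r,mul1r,mulr1); split.
split=> //.
have c0 : (k.+1%:R + 2 * lam)%:P != 0 :> {poly F}.
  by rewrite polyC_eq0 gt_eqF// ltr_wpDr ?mulr_ge0// ltr0Sn.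
apply: (mulfI c0).
have R1 := ngeg_rec k.+1; have R0 := ngeg_rec k.
have := congr1 (fun p => p^`()) R1; rewrite /= !(derivE, derivCE) => D1.
rewrite mulrCA D1.
move: IH1 IH2 R0 R1 {D1}; rewrite /=.
move: (ngeg k.-1) (ngeg k) (ngeg k.+1) (ngeg k.+2) => a b c e.
set b' := b^`(); set c' := c^`() => IH1 IH2 R0 R1.
apply/eqP; rewrite -subr_eq0; apply/eqP.
(* The difference of the two sides is a combination of the two induction hypotheses and of two
   instances of the recurrence, each written as a vanishing bracket. *)
transitivity ((2 * (k.+1%:R + lam))%:P * 'X *
    ((1 - 'X^2) * c' - k.+1%:R%:P * (b - 'X * c))
  - k.+1%:R%:P * ((1 - 'X^2) * b' - k%:R%:P * (a - 'X * b))
  + k.+2%:R%:P * 'X * ((k.+1%:R + 2 * lam)%:P * e -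
      ((2 * (k.+1%:R + lam))%:P * ('X * c) - k.+1%:R%:P * b))
  - k.+1%:R%:P * ((k%:R + 2 * lam)%:P * c -
      ((2 * (k%:R + lam))%:P * ('X * b) - k%:R%:P * a))).
  ring.
by rewrite IH1 IH2 R0 R1 !subrr !mulr0 !subr0 addr0.
Qed.

(** * Functionals determined by the moment recurrence *)

Section moment_functional.
Variable L : {poly F} -> F.
Hypothesis LD : forall p q, L (p + q) = L p + L q.
Hypothesis LZ : forall c p, L (c%:P * p) = c * L p.
Hypothesis L1 : L 1 = 1.
Hypothesis LX : L 'X = 0.
Hypothesis LXn : forall n,
  (n%:R + 2 + 2 * lam) * L 'X^(n.+2) = n.+1%:R * L 'X^n.

Lemma L0 : L 0 = 0.
Proof. by rewrite -(mul0r 0) -polyC0 LZ mul0r. Qed.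

Lemma LN p : L (- p) = - L p.
Proof. by apply/eqP; rewrite -addr_eq0 addrC -LD subrr L0. Qed.

Lemma LB p q : L (p - q) = L p - L q. Proof. by rewrite LD LN. Qed.

(** Integration by parts against [(1 - x^2)^(lam - 1/2)] without a weight: on the monomial
    ['X^(n.+1)] it is the moment recurrence [LXn], on a constant it is [LX], and linearity does the
    rest. *)
Lemma L_by_parts p : L ((1 - 'X^2) * p^`()) = (2 * lam + 1) * L ('X * p).
Proof.
rewrite -(coefK p) poly_def.
elim/big_ind: _ => [|u v Hu Hv|i _]; first by rewrite derivC !mulr0 L0 mulr0.
  by rewrite derivD !mulrDr !LD Hu Hv mulrDr.
rewrite -mul_polyC derivM derivC mul0r add0r derivXn.
case: (i : nat) => [|j].
  by rewrite mulr0n !mulr0 L0 expr0 mulr1 ['X * _]mulrC LZ LX !mulr0.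
have -> : (1 - 'X^2) * ((p`_j.+1)%:P * ('X^j *+ j.+1)) =
    (p`_j.+1 * j.+1%:R)%:P * ('X^j - 'X^(j.+2)) :> {poly F}.
  by rewrite (exprS _ j.+1) (exprS _ j) -[in LHS]mulr_natr; ring.
have -> : 'X * ((p`_j.+1)%:P * 'X^(j.+1)) = (p`_j.+1)%:P * 'X^(j.+2) :> {poly F}.
  by rewrite (exprS _ j.+1); ring.
rewrite !LZ LB; have := LXn j.
move: (L 'X^j) (L 'X^(j.+2)) => u v E.
by transitivity (p`_j.+1 * (j.+1%:R * u - j.+1%:R * v)); [|rewrite -E]; ring.
Qed.

Let pos k : k.+1%:R + 2 * lam != 0.
Proof. by rewrite gt_eqF// ltr_wpDr ?mulr_ge0// ltr0Sn. Qed.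

(** Apply [L] to the derivative rule and to the recurrence and eliminate [L ('X * ngeg j)]: this
    links [L (ngeg j.+1)] to [L (ngeg j.-1)] with the factor [j * (j - 1)]. Odd degrees start from
    [LX], even ones from the zero of that factor at [j = 1]. *)
Lemma L_ngeg k : L (ngeg k.+1) = 0.
Proof.
suff: L (ngeg k.+1) = 0 /\ L (ngeg k.+2) = 0 by case.
have rel j : (j%:R + 2 * lam + 1) * (j%:R + 2 * lam) * L (ngeg j.+1) =
    j%:R * (j%:R - 1) * L (ngeg j.-1).
  have := L_by_parts (ngeg j); rewrite deriv_ngeg LZ LB => E1.
  have := congr1 L (ngeg_rec j); rewrite LB !LZ => E2.
  rewrite -mulrA E2; move: (L (ngeg j.-1)) (L ('X * ngeg j)) E1 => u v E1.
  have Ev : (j%:R + 2 * lam + 1) * v = j%:R * u by lra.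
  transitivity (2 * (j%:R + lam) * ((j%:R + 2 * lam + 1) * v)
    - j%:R * (j%:R + 2 * lam + 1) * u); first by ring.
  by rewrite Ev; ring.
elim: k => [|k [IH1 IH2]].
  split; first by rewrite ngeg1.
  have := rel 1%N; rewrite subrr mulr0 mul0r => /eqP.
  rewrite mulf_eq0 => /orP[|/eqP//].
  have h0 : 0 < 1%:R + 2 * lam + 1 by have := lam_ge0; lra.
  have h1 : 1%:R + 2 * lam + 1 != 0 by rewrite gt_eqF.
  by rewrite mulf_eq0 (negPf h1) (negPf (pos 0)).
split=> //.
have := rel k.+2; rewrite IH1 mulr0 => /eqP.
rewrite mulf_eq0 => /orP[|/eqP//].
have h0 : 0 < k.+2%:R + 2 * lam + 1 by have := lam_ge0; have := ltr0Sn F k.+1; lra.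
have h1 : k.+2%:R + 2 * lam + 1 != 0 by rewrite gt_eqF.
by rewrite mulf_eq0 (negPf h1) (negPf (pos k.+1)).
Qed.

(** Both sides are [L (w * 'X * ngeg m * ngeg n)] times [2 (m + lam) (n + lam)], with ['X] absorbed
    by the recurrence in m or in n. The free weight serves orthogonality ([w = 1]) and triple
    products ([w = ngeg l]). *)
Lemma L_ngeg_swap w m n :
  (n%:R + lam) * ((m%:R + 2 * lam) * L (w * ngeg m.+1 * ngeg n) +
                  m%:R * L (w * ngeg m.-1 * ngeg n)) =
  (m%:R + lam) * ((n%:R + 2 * lam) * L (w * ngeg m * ngeg n.+1) +
                  n%:R * L (w * ngeg m * ngeg n.-1)).
Proof.
rewrite -!(LZ, LD); congr L.
have Rm := ngeg_rec m; have Rn := ngeg_rec n.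
transitivity ((n%:R + lam)%:P * (w * ngeg n *
   ((m%:R + 2 * lam)%:P * ngeg m.+1 + m%:R%:P * ngeg m.-1))); first by ring.
transitivity ((m%:R + lam)%:P * (w * ngeg m *
   ((n%:R + 2 * lam)%:P * ngeg n.+1 + n%:R%:P * ngeg n.-1))); last by ring.
by rewrite Rm Rn; ring.
Qed.

Section positive_index.
Hypothesis lam_gt0 : 0 < lam.

(** The ratio forced on [L (ngeg k ^+ 2)] by [L_ngeg_swap] with [w = 1] and [n = m + 1]. Its
    denominator at [j = 0] contains [2 * lam], which is why [lam = 0] is treated apart. *)
Fixpoint ngeg_norm (k : nat) : F :=
  if k is j.+1 then
    j.+1%:R * (j%:R + lam) / ((j.+1%:R + lam) * (j%:R + 2 * lam)) * ngeg_norm j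
  else 1.

Let plam k : k%:R + lam != 0.
Proof. by rewrite gt_eqF// ltr_wpDl. Qed.

Let p2lam k : k%:R + 2 * lam != 0.
Proof. by rewrite gt_eqF// ltr_wpDl// mulr_gt0. Qed.

Lemma ngeg_normS k : (k.+1%:R + lam) * (k%:R + 2 * lam) * ngeg_norm k.+1 =
  k.+1%:R * (k%:R + lam) * ngeg_norm k.
Proof. by rewrite /= mulrA mulrCA mulfV ?mulr1// mulf_neq0. Qed.

Lemma L_ngeg_orthogonal m n :
  L (ngeg m * ngeg n) = if m == n then ngeg_norm m else 0.
Proof.
suff: (forall n, L (ngeg m * ngeg n) = if m == n then ngeg_norm m else 0) /\
  (forall n, L (ngeg m.+1 * ngeg n) = if m.+1 == n then ngeg_norm m.+1 else 0).
  by case.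
(* Row [i + 1] of the Gram matrix from rows [i] and [i - 1]; row 0 is [L_ngeg]. *)
have rel i j : (j%:R + lam) * (i%:R + 2 * lam) * L (ngeg i.+1 * ngeg j) =
    (i%:R + lam) * ((j%:R + 2 * lam) * L (ngeg i * ngeg j.+1)
       + j%:R * L (ngeg i * ngeg j.-1))
    - (j%:R + lam) * i%:R * L (ngeg i.-1 * ngeg j).
  have := L_ngeg_swap 1 i j; rewrite !mul1r => <-; ring.
have base j : L (ngeg 0 * ngeg j) = if 0%N == j then 1 else 0.
  by rewrite ngeg0 mul1r; case: j => [|j]; rewrite ?L_ngeg// ngeg0.
have step i j (h : (j%:R + lam) * (i%:R + 2 * lam) * L (ngeg i.+1 * ngeg j) =
     if i.+1 == j then i.+1%:R * (i%:R + lam) * ngeg_norm i else 0) :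
    L (ngeg i.+1 * ngeg j) = if i.+1 == j then ngeg_norm i.+1 else 0.
  apply: (mulfI (mulf_neq0 (plam j) (p2lam i))); rewrite h.
  by case: eqP => [<-|_]; rewrite ?mulr0// ngeg_normS.
elim: m {n} => [|m [IH1 IH2]].
  split=> // j; apply: step; rewrite rel !base.
  case: j => [|[|j]] /=; ring.
split=> // j; apply: step; rewrite rel [m.+1.-1]/= !IH1 !IH2.
have [e|/eqP n1] := eqVneq m.+2 j.
  subst j; rewrite [m.+2.-1]/= eqxx !ifN_eq; [ring|lia..].
have [e|/eqP n2] := eqVneq m j.
  subst j; rewrite eqxx (_ : (m.+1 == m.-1) = false); last by apply/eqP; lia.
  have := ngeg_normS m; set x := ngeg_norm m.+1; set y := ngeg_norm m => E.
  transitivity ((m.+1%:R + lam) * (m%:R + 2 * lam) * x - (m%:R + lam) * m.+1%:R * y).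
    ring.
  by rewrite E; ring.
rewrite (_ : (m.+1 == j.+1) = false); last by apply/eqP; lia.
case: j n1 n2 => [|j] n1 n2; first by ring.
rewrite [j.+1.-1]/= (_ : (m.+1 == j) = false); last by apply/eqP; lia.
ring.
Qed.

Definition poch (a : F) n := \prod_(i < n) (a + i%:R).

Lemma poch0 a : poch a 0 = 1. Proof. by rewrite /poch big_ord0. Qed.

Lemma pochS a n : poch a n.+1 = poch a n * (a + n%:R).
Proof. by rewrite /poch big_ord_recr. Qed.

Lemma poch_gt0 a n : 0 < a -> 0 < poch a n.
Proof. by move=> a0; apply: prodr_gt0 => i _; rewrite ltr_wpDr. Qed.

Lemma poch_shift n : lam * poch (lam + 1) n = poch lam n * (lam + n%:R).
Proof.
elim: n => [|n IH]; first by rewrite !poch0 addr0 mulr1 mul1r.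
by rewrite !pochS mulrA IH -nat1r; ring.
Qed.

(* The value at 1 of the standard Gegenbauer polynomial of index lam. *)
Definition geg1 k : F := poch (2 * lam) k / k`!%:R.

(** Taylor coefficients of [(1 - z)^(-lam)]. *)
Definition tri_coef j : F := poch lam j / j`!%:R.

Definition tri_sum s : F := poch (2 * lam) s / poch (lam + 1) s.

(** With [s] half the perimeter of a triangle of sides l, m, n, [s < l] means that [l <= m + n]
    fails; the value 0 encodes that a product of degrees m and n has no component of degree l. *)
Definition tri_side s l : F := if (l <= s)%N then tri_coef (s - l) else 0.

(** Dougall's linearisation formula: the mean of [C_l C_m C_n] in the standard normalisation. *)
Definition tri l m n : F :=
  if odd (l + m + n) then 0 else
  let s := (l + m + n)./2 in
  tri_side s l * tri_side s m * tri_side s n * tri_sum s.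

Lemma geg1_gt0 k : 0 < geg1 k.
Proof. by rewrite divr_gt0 ?poch_gt0 ?mulr_gt0// ltr0n fact_gt0. Qed.

Lemma geg1S k : k.+1%:R * geg1 k.+1 = (k%:R + 2 * lam) * geg1 k.
Proof.
rewrite /geg1 pochS factS natrM.
have f0 : k`!%:R != 0 :> F by rewrite pnatr_eq0 -lt0n fact_gt0.
field.
by rewrite f0 nat1r pnatr_eq0.
Qed.

Lemma tri_coefS j : j.+1%:R * tri_coef j.+1 = (lam + j%:R) * tri_coef j.
Proof.
rewrite /tri_coef pochS factS natrM.
have f0 : j`!%:R != 0 :> F by rewrite pnatr_eq0 -lt0n fact_gt0.
field.
by rewrite f0 nat1r pnatr_eq0.
Qed.

Lemma tri_sumS s :
  (lam + s.+1%:R) * tri_sum s.+1 = (2 * lam + s%:R) * tri_sum s.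
Proof.
rewrite /tri_sum !pochS.
have q0 : poch (lam + 1) s != 0 by rewrite gt_eqF// poch_gt0// addr_gt0.
have q1 : lam + 1 + s%:R != 0 by rewrite -addrA nat1r addrC.
field.
by rewrite q0 q1.
Qed.

(** Both factors obey first-order recurrences, and the product of the two ratios is
    [(k + lam) / (k + 1 + lam)], which telescopes. *)
Lemma geg1_ngeg_norm k : geg1 k * ngeg_norm k = lam / (k%:R + lam).
Proof.
elim: k => [|k IH].
  by rewrite /geg1 poch0 fact0 mulr1n divr1 mul1r /= add0r divff// gt_eqF.
have := ngeg_normS k; have := geg1S k.
have k0 : k.+1%:R != 0 :> F by rewrite pnatr_eq0.
move: (geg1 k.+1) (ngeg_norm k.+1) (geg1 k) (ngeg_norm k) IH => a b a' b' IH E1 E2.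
apply: (mulfI (mulf_neq0 k0 (mulf_neq0 (plam k.+1) (p2lam k)))).
transitivity ((k.+1%:R * a) * ((k.+1%:R + lam) * (k%:R + 2 * lam) * b)); first by ring.
rewrite E1 E2.
transitivity ((k%:R + 2 * lam) * k.+1%:R * (k%:R + lam) * (a' * b')); first by ring.
rewrite IH; field.
by rewrite (plam k) nat1r (plam k.+1).
Qed.

Let K l m n := geg1 l * geg1 m * geg1 n * L (ngeg l * ngeg m * ngeg n).
(** Coefficient of the lower term in the recurrence of the standard [C_k]. The value 0 at [k = 0]
    removes the spurious term of index [0.-1]. *)
Let b k : F := if k is j.+1 then j%:R + 2 * lam else 0.

Let b_geg1 k : b k * geg1 k.-1 = k%:R * geg1 k.
Proof. by case: k => [|k]; rewrite /= ?mul0r// geg1S. Qed.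

Let K_swap l m n :
  (n%:R + lam) * (m.+1%:R * K l m.+1 n + b m * K l m.-1 n) =
  (m%:R + lam) * (n.+1%:R * K l m n.+1 + b n * K l m n.-1).
Proof.
rewrite /K; have := L_ngeg_swap (ngeg l) m n.
have := geg1S m; have := geg1S n; have := b_geg1 m; have := b_geg1 n.
move=> Bn Bm Cn Cm E.
transitivity (geg1 l * geg1 n * ((n%:R + lam) *
    ((m.+1%:R * geg1 m.+1) * L (ngeg l * ngeg m.+1 * ngeg n) +
     (b m * geg1 m.-1) * L (ngeg l * ngeg m.-1 * ngeg n)))); first by ring.
rewrite Bm Cm.
transitivity (geg1 l * geg1 m * ((m%:R + lam) *
    ((n.+1%:R * geg1 n.+1) * L (ngeg l * ngeg m * ngeg n.+1) +
     (b n * geg1 n.-1) * L (ngeg l * ngeg m * ngeg n.-1)))); last by ring.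
rewrite Bn Cn.
by move: E => /(congr1 (fun x => geg1 l * geg1 m * geg1 n * x)) E; lra.
Qed.

Let triE s l m n : (l + m + n = s.*2)%N ->
  tri l m n = tri_side s l * tri_side s m * tri_side s n * tri_sum s.
Proof. by move=> e; rewrite /tri e odd_double doubleK. Qed.

Let side0 s l : (s < l)%N -> tri_side s l = 0.
Proof. by rewrite /tri_side; case: leqP. Qed.

Let sideE s l a : (s = l + a)%N -> tri_side s l = tri_coef a.
Proof. by move=> ->; rewrite /tri_side leq_addr addKn. Qed.

Let tri_odd l m n : odd (l + m + n) -> tri l m n = 0.
Proof. by rewrite /tri => ->. Qed.

(* With a = s - l, b = s - m - 1, c = s - n the recurrence becomes an identity
   between ratios of consecutive values of [tri_coef] and [tri_sum]. *)
Let tri_swap l m n :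
  (n%:R + lam) * (m.+1%:R * tri l m.+1 n + b m * tri l m.-1 n) =
  (m%:R + lam) * (n.+1%:R * tri l m n.+1 + b n * tri l m n.-1).
Proof.
have [od|ev] := boolP (odd (l + m + n).+1).
  have odd1 : tri l m.+1 n = 0 by apply: tri_odd; lia.
  have odd2 : tri l m n.+1 = 0 by apply: tri_odd; lia.
  have odd3 : b m * tri l m.-1 n = 0.
    by case: (m) od => [|m'] od; rewrite ?mul0r// tri_odd ?mulr0//; lia.
  have odd4 : b n * tri l m n.-1 = 0.
    by case: (n) od => [|n'] od; rewrite ?mul0r// tri_odd ?mulr0//; lia.
  by rewrite odd1 odd2 odd3 odd4; ring.
(* Raising an index gives half perimeter [s + 1], lowering one gives [s]. The cases below separate
   the degenerate triangles, in which some of the four terms vanish. *)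
have [s es] : exists s, (l + m + n).+1 = (s.+1).*2.
  by exists ((l + m + n).+1./2.-1); lia.
rewrite (triE (s := s.+1) (l := l) (m := m.+1)); last by lia.
rewrite (triE (s := s.+1) (l := l) (n := n.+1)); last by lia.
have -> : b m * tri l m.-1 n = b m *
    (tri_side s l * tri_side s m.-1 * tri_side s n * tri_sum s).
  by case: (m) es => [|m'] es; [rewrite !mul0r | rewrite (triE (s := s))//; lia].
have -> : b n * tri l m n.-1 = b n *
    (tri_side s l * tri_side s m * tri_side s n.-1 * tri_sum s).
  by case: (n) es => [|n'] es; [rewrite !mul0r | rewrite (triE (s := s))//; lia].
have [ls|ls] := leqP l s.+1; last first.
  by rewrite !(side0 ls) !(side0 (ltnW ls)); ring.
have [ns|ns] := leqP n s.+1; last first.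
  rewrite (side0 ns) (side0 (ltnW ns)) (side0 (s := s.+1) (l := n.+1)) ?(side0 (s := s) (l := n.-1)); [ring|lia..].
have [ms|ms] := leqP m s.+1; last first.
  rewrite (side0 ms) (side0 (ltnW ms)) (side0 (s := s.+1) (l := m.+1)) ?(side0 (s := s) (l := m.-1)); [ring|lia..].
have S0 t : tri_sum t.+1 = (2 * lam + t%:R) / (lam + t.+1%:R) * tri_sum t.
  apply: (mulfI (_ : lam + t.+1%:R != 0)); first by rewrite addrC.
  by rewrite tri_sumS; field; rewrite nat1r addrC.
have C0 j : tri_coef j.+1 = (lam + j%:R) / j.+1%:R * tri_coef j.
  have j0 : j.+1%:R != 0 :> F by rewrite pnatr_eq0.
  by apply: (mulfI j0); rewrite tri_coefS; field; rewrite nat1r.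
have [em|ms'] := eqVneq m s.+1.
  have el : s = (l + n)%N by lia.
  rewrite (side0 (s := s.+1) (l := m.+1)) ?(side0 (s := s) (l := m)); [|lia..].
  rewrite !(sideE (s := s) (l := l) (a := n))//.
  rewrite (sideE (s := s) (l := m.-1) (a := 0)); last by rewrite em addn0.
  rewrite (sideE (s := s) (l := n) (a := l)); last by rewrite addnC.
  rewrite (sideE (s := s.+1) (l := l) (a := n.+1)); last by lia.
  rewrite (sideE (s := s.+1) (l := m) (a := 0)); last by lia.
  rewrite (sideE (s := s.+1) (l := n.+1) (a := l)); last by lia.
  rewrite S0 C0 em /b; field.
  have := plam s.+1; rewrite -nat1r addrC addrA nat1r => ->.
  by rewrite pnatr_eq0.
have [k ek] : exists k, s = (m + k)%N by exists (s - m)%N; lia.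
have [a ea] : exists a, s.+1 = (l + a)%N by exists (s.+1 - l)%N; lia.
have [c ec] : exists c, s.+1 = (n + c)%N by exists (s.+1 - n)%N; lia.
rewrite (sideE ea) (sideE ec) (sideE ek).
rewrite (sideE (s := s.+1) (l := m.+1) (a := k)); last by lia.
rewrite (sideE (s := s.+1) (l := m) (a := k.+1)); last by lia.
case: a ea => [|a] ea; case: c ec => [|c] ec; first by lia.
- have [em en] : m = c /\ n = k by lia.
  rewrite (side0 (s := s) (l := l)); last by lia.
  rewrite (sideE (s := s.+1) (l := n.+1) (a := c)); last by lia.
  rewrite em en !C0; field.
  by rewrite !nat1r !pnatr_eq0.
- have [em en] : m = a /\ n = (a + k).+1 by lia.
  rewrite (side0 (s := s) (l := n)); last by lia.
  rewrite (side0 (s := s.+1) (l := n.+1)); last by lia.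
  rewrite (sideE (s := s) (l := l) (a := a)); last by lia.
  rewrite (sideE (s := s) (l := n.-1) (a := 0)); last by rewrite en; lia.
  have es' : s = (a + k)%N by lia.
  rewrite S0 C0 em en es' /b /=; field.
  rewrite nat1r pnatr_eq0 /=.
  have := plam (a + k).+1; rewrite -nat1r natrD.
  by rewrite andbT; apply: contra_neq => <-; ring.
- have [em en] : m = (a + c).+1 /\ n = (a + k).+1 by lia.
  have es' : s = (a + k + c).+1 by lia.
  rewrite (sideE (s := s) (l := l) (a := a)); last by lia.
  rewrite (sideE (s := s) (l := n) (a := c)); last by lia.
  rewrite (sideE (s := s.+1) (l := n.+1) (a := c)); last by lia.
  rewrite (sideE (s := s) (l := n.-1) (a := c.+1)); last by rewrite en; lia.
  rewrite (sideE (s := s) (l := m.-1) (a := k.+1)); last by rewrite em; lia.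
  rewrite (S0 s) !C0 em en es' /b /=; field.
  rewrite !nat1r !pnatr_eq0 /=.
  have := plam (a + k + c).+2; rewrite -!nat1r !natrD.
  by rewrite andbT; apply: contra_neq => <-; ring.
Qed.

(** The integral and the closed form obey the same relation ([K_swap], [tri_swap]), which computes
    row [m + 1] from rows [m] and [m - 1]; at [m = 0] they agree by orthogonality. *)
Lemma L_ngeg_triple l m n :
  geg1 l * geg1 m * geg1 n * L (ngeg l * ngeg m * ngeg n) = tri l m n.
Proof.
rewrite -/(K l m n).
suff: (forall n, K l m n = tri l m n) /\ (forall n, K l m.+1 n = tri l m.+1 n) by case.
have step i : (forall n, K l i n = tri l i n) ->
    (forall n, b i * K l i.-1 n = b i * tri l i.-1 n) ->
    forall n, K l i.+1 n = tri l i.+1 n.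
  move=> H1 H2 j.
  have i0 : i.+1%:R != 0 :> F by rewrite pnatr_eq0.
  apply: (mulfI (mulf_neq0 (plam j) i0)); rewrite -!mulrA.
  apply: (addIr ((j%:R + lam) * (b i * tri l i.-1 j))).
  by rewrite -!mulrDr tri_swap -H2 K_swap !H1.
elim: m {n} => [|m [IH1 IH2]].
  have base j : K l 0 j = tri l 0 j.
    have g0 : geg1 0 = 1 by rewrite /geg1 poch0 fact0 divr1.
    rewrite /K ngeg0 g0 !mulr1 L_ngeg_orthogonal.
    case: eqP => [<-|lj].
      rewrite (triE (s := l)); last by lia.
      rewrite (sideE (s := l) (l := l) (a := 0)) ?addn0// (sideE (s := l) (l := 0) (a := l))//.
      rewrite -mulrA geg1_ngeg_norm /tri_coef poch0 fact0 divr1 !mul1r mulr1.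
      rewrite /geg1 /tri_sum.
      have := poch_shift l; have := lt0r_neq0 (poch_gt0 l lam_gt0).
      have q1 : poch (lam + 1) l != 0 by rewrite gt_eqF// poch_gt0// addr_gt0.
      move: (poch lam l) (poch (lam + 1) l) q1 => u v v0 u0 E.
      have lam0 := lt0r_neq0 lam_gt0.
      have -> : v = u * (lam + l%:R) / lam by rewrite -E; field.
      have f0 : l`!%:R != 0 :> F by rewrite pnatr_eq0 -lt0n fact_gt0.
      have := plam l; rewrite addrC => pl.
      by field; rewrite u0 f0 lam0 pl.
    rewrite mulr0; have [od|ev] := boolP (odd (l + 0 + j)); first by rewrite tri_odd.
    rewrite (triE (s := (l + 0 + j)./2)); last by lia.
    have [h|h] := leqP l j.
      by rewrite (side0 (l := j)) ?mulr0 ?mul0r//; lia.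
    by rewrite (side0 (l := l)) ?mulr0 ?mul0r//; lia.
  split=> // j; apply: step => // j'; by rewrite !mul0r.
by split=> // j; apply: step => // j'; rewrite IH1.
Qed.

Lemma L_ngeg_cube_even m : geg1 m.*2 ^+ 3 * L (ngeg m.*2 ^+ 3) =
  tri_coef m ^+ 3 * tri_sum (m + m + m).
Proof.
transitivity (tri m.*2 m.*2 m.*2).
  by rewrite -L_ngeg_triple !exprS !expr0 !mulr1 !mulrA.
rewrite (triE (s := (m + m + m)%N)); last by lia.
rewrite (sideE (a := m)); last by lia.
by rewrite !exprS expr0; ring.
Qed.

Lemma L_ngeg_cube_odd k : odd k -> L (ngeg k ^+ 3) = 0.
Proof.
move=> ok.
have g0 : geg1 k * geg1 k * geg1 k != 0 by have g := lt0r_neq0 (geg1_gt0 k); exact: (mulf_neq0 (mulf_neq0 g g) g).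
apply: (mulfI g0); rewrite mulr0 !exprS expr0 mulr1 mulrA L_ngeg_triple tri_odd//.
by lia.
Qed.

(** The triangle k, k, 2k is degenerate but admissible, so each factor of [tri] is positive. *)
Lemma L_ngeg_double k : L (ngeg k ^+ 2 * ngeg k.*2) != 0.
Proof.
have := L_ngeg_triple k k k.*2.
rewrite (triE (s := k.*2)); last by lia.
rewrite (sideE (l := k) (a := k)) ?addnn// (sideE (l := k.*2) (a := 0)) ?addn0//.
rewrite -expr2 => E; apply/eqP => L0; move: E; rewrite L0 mulr0 => /esym/eqP.
have p1 : 0 < lam + 1 by rewrite addr_gt0.
have p2 : 0 < 2 * lam by rewrite mulr_gt0.
have C0 j : 0 < tri_coef j by rewrite divr_gt0 ?poch_gt0// ltr0n fact_gt0.
have X0 : 0 < tri_sum k.*2 by rewrite divr_gt0// poch_gt0.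
by rewrite gt_eqF//; do 3![apply: mulr_gt0 => //].
Qed.

End positive_index.

(** * Index zero: Chebyshev polynomials *)

Section chebyshev.
Hypothesis lam0 : lam = 0.

Lemma ngeg_cheb k : ngeg k.+2 = 2%:P * 'X * ngeg k.+1 - ngeg k.
Proof.
have := ngeg_rec k.+1; rewrite lam0 mulr0 !addr0 /= => E.
have k0 : k.+1%:R%:P != 0 :> {poly F} by rewrite polyC_eq0 pnatr_eq0.
by apply: (mulfI k0); rewrite E; ring.
Qed.

(** The rule [2 cos a cos b = cos (a + b) + cos (a - b)], derived from the recurrence alone; it
    replaces orthogonality and the triple product formula when [lam = 0]. *)
Lemma ngeg_cheb_mul m j :
  2%:P * (ngeg m * ngeg (m + j)) = ngeg (m + m + j) + ngeg j.
Proof.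
suff: (forall j, 2%:P * (ngeg m * ngeg (m + j)) = ngeg (m + m + j) + ngeg j) /\
  (forall j, 2%:P * (ngeg m.+1 * ngeg (m.+1 + j)) =
     ngeg (m.+1 + m.+1 + j) + ngeg j) by case.
elim: m {j} => [|m [IH1 IH2]].
  split=> j; first by rewrite ngeg0 !add0n; ring.
  by rewrite !addSn !add0n ngeg_cheb ngeg1; ring.
split=> // j.
have E1 := ngeg_cheb m.
have E2 := ngeg_cheb (m.+1 + j); have E3 := IH2 j.+2; have E4 := IH2 j.
have E5 := IH1 j.+2.
rewrite !(addSn, addnS) in E1 E2 E3 E4 E5 *.
rewrite E1.
transitivity (2%:P * (ngeg m.+1 * (2%:P * 'X * ngeg (m + j).+2))
  - 2%:P * (ngeg m * ngeg (m + j).+2)); first by ring.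
rewrite E5.
have -> : 2%:P * 'X * ngeg (m + j).+2 = ngeg (m + j).+3 + ngeg (m + j).+1.
  by rewrite E2; ring.
rewrite mulrDr mulrDr E3 E4; ring.
Qed.

Lemma L_cheb_sqr k : L (ngeg k.+1 ^+ 2) = 2^-1.
Proof.
have := congr1 L (ngeg_cheb_mul k.+1 0); rewrite !addn0 -expr2 LZ LD ngeg0 L1.
by rewrite addSn L_ngeg => E; lra.
Qed.

Lemma L_cheb_cube k : L (ngeg k.+1 ^+ 3) = 0.
Proof.
have := ngeg_cheb_mul k.+1 0; have := ngeg_cheb_mul k.+1 k.+1.
rewrite !addn0 ngeg0 => E1 E2.
have : 4%:P * (ngeg k.+1 ^+ 3) = ngeg (k.+1 + k.+1 + k.+1) + 3%:P * ngeg k.+1.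
  transitivity (2%:P * (ngeg k.+1 * (2%:P * (ngeg k.+1 * ngeg k.+1)))); first by ring.
  rewrite E2 mulrDr mulrDr E1; ring.
move/(congr1 L); rewrite LD !LZ addSn !L_ngeg => E; lra.
Qed.

Lemma L_cheb_double k : L (ngeg k.+1 ^+ 2 * ngeg (k.+1).*2) = 4^-1.
Proof.
have := ngeg_cheb_mul k.+1 0; rewrite !addn0 ngeg0 addnn => E2.
have E4 := L_cheb_sqr (k.*2.+1).
have := congr1 (fun p => L (p * ngeg (k.+1).*2)) E2.
rewrite mulrDl mul1r LD -mulrA LZ doubleS L_ngeg -expr2 -expr2 E4 addr0 => E; lra.
Qed.

End chebyshev.

End moment_functional.

(** * Expansion of Gegenbauer polynomials in cosines *)

Section cosine_form.
Hypothesis lam_gt0 : 0 < lam.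
Variables (x : F) (c : nat -> nat -> F).
Hypothesis c00 : c 0 0 = 1.
Hypothesis cSS : forall i j, c i.+1 j.+1 = c i j.
Hypothesis cS : forall i j, c i.+1 j + c i j.+1 = 2 * x * c i j.

Let A := tri_coef.
Let S k := \sum_(i < k.+1) A i * A (k - i) * c i (k - i).

(** The factor [k + 1] is split into [i] and [k + 1 - i], each absorbed by [tri_coefS] into one of
    the two coefficients. *)
Let SS k : k.+1%:R * S k.+1 = \sum_(i < k.+1) A i * A (k - i) *
  ((lam + i%:R) * c i.+1 (k - i) + (lam + (k - i)%:R) * c i (k - i).+1).
Proof.
under eq_bigr => i _ do rewrite mulrDr.
rewrite big_split /= /S mulr_sumr.
have -> : \sum_(i < k.+2) k.+1%:R * (A i * A (k.+1 - i) * c i (k.+1 - i)) =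
    \sum_(i < k.+2) i%:R * (A i * A (k.+1 - i) * c i (k.+1 - i)) +
    \sum_(i < k.+2) (k.+1 - i)%:R * (A i * A (k.+1 - i) * c i (k.+1 - i)).
  rewrite -big_split /=; apply: eq_bigr => i _.
  by rewrite -mulrDl -natrD subnKC// -ltnS.
rewrite big_ord_recl mul0r add0r; congr (_ + _).
  apply: eq_bigr => i _; rewrite lift0 subSS.
  transitivity (i.+1%:R * A i.+1 * A (k - i)%N * c i.+1 (k - i)%N); first by ring.
  by rewrite /A tri_coefS; ring.
rewrite big_ord_recr /= subnn mul0r addr0; apply: eq_bigr => i _.
rewrite subSn; last by rewrite -ltnS.
transitivity (A i * ((k - i).+1%:R * A (k - i).+1) * c i (k - i).+1); first by ring.
by rewrite /A tri_coefS; ring.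
Qed.

Let S_rec k : k.+2%:R * S k.+2 = 2 * (k.+1%:R + lam) * x * S k.+1
  - (k%:R + 2 * lam) * S k.
Proof.
(* [cSS] lifts both indices, which writes this sum over the same index pairs as the other two
   terms. *)
have -> : (k%:R + 2 * lam) * S k = \sum_(i < k.+2) A i * A (k.+1 - i) *
   ((k.+1 - i)%:R * c i.+1 (k.+1 - i) + i%:R * c i (k.+1 - i).+1).
  under [RHS]eq_bigr => i _ do rewrite mulrDr.
  rewrite big_split /=.
  rewrite big_ord_recr /= subnn mul0r mulr0 addr0.
  rewrite [X in _ = _ + X]big_ord_recl /= mul0r mulr0 add0r -big_split /= /S mulr_sumr.
  apply: eq_bigr => i _.
  have ik : (i <= k)%N by rewrite -ltnS.
  rewrite /bump ?add1n subSS subSn// !cSS.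
  transitivity ((A i * ((k - i).+1%:R * A (k - i).+1) +
     (i.+1%:R * A i.+1) * A (k - i)%N) * c i (k - i)%N); last by ring.
  rewrite /A !tri_coefS.
  have -> : k%:R = i%:R + (k - i)%:R :> F by rewrite -natrD subnKC.
  ring.
rewrite SS /S mulr_sumr -sumrB; apply: eq_bigr => i _.
have ik : (i <= k.+1)%N by rewrite -ltnS.
have -> : k.+1%:R = i%:R + (k.+1 - i)%:R :> F by rewrite -natrD subnKC.
transitivity ((i%:R + (k.+1 - i)%:R + lam) * (A i * A (k.+1 - i)%N) *
   (2 * x * c i (k.+1 - i)%N) - A i * A (k.+1 - i)%N *
     ((k.+1 - i)%:R * c i.+1 (k.+1 - i)%N + i%:R * c i (k.+1 - i).+1)); last by ring.
rewrite -cS; ring.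
Qed.

(** Cauchy product of [(1 - z e^(it))^(-lam)] and its conjugate, with [c i j] in the role of
    [cos ((i - j) t)] and [x = cos t]. Keeping [c] abstract also allows [c = 1], [x = 1], where
    [geg1 k] appears as the sum of the coefficients. *)
Lemma geg1_ngeg_cosE k : geg1 k * (ngeg k).[x] =
  \sum_(i < k.+1) tri_coef i * tri_coef (k - i) * c i (k - i).
Proof.
rewrite -/(S k).
suff: geg1 k * (ngeg k).[x] = S k /\ geg1 k.+1 * (ngeg k.+1).[x] = S k.+1 by case.
have S0 : S 0 = 1.
  by rewrite /S big_ord1 /= /A /tri_coef poch0 fact0 divr1 c00 !mulr1.
have A0 : A 0 = 1 by rewrite /A /tri_coef poch0 fact0 divr1.
have g0 : geg1 0 = 1 by rewrite /geg1 poch0 fact0 divr1.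
elim: k => [|k [IH1 IH2]].
  split; first by rewrite ngeg0 hornerC g0 S0 mulr1.
  have := SS 0; rewrite big_ord1 /= subn0 A0 mul1r !addr0 !mulr1n -mulrDr cS c00 => E.
  have := geg1S 0; rewrite g0 add0r mulr1 !mulr1n mul1r => ->.
  by rewrite ngeg1 hornerX; move: E; rewrite mul1r => ->; ring.
split=> //.
have k0 : k.+2%:R != 0 :> F by rewrite pnatr_eq0.
apply: (mulfI k0); rewrite S_rec -IH1 -IH2 [LHS]mulrA geg1S.
have := congr1 (fun p => p.[x]) (ngeg_rec k.+1).
rewrite !(hornerM, hornerC, hornerX, hornerD, hornerN) /= => E.
transitivity (geg1 k.+1 * ((k.+1%:R + 2 * lam) * (ngeg k.+2).[x])); first by ring.
rewrite E mulrBr; congr (_ - _); first by ring.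
transitivity ((k.+1%:R * geg1 k.+1) * (ngeg k).[x]); first by ring.
by rewrite geg1S; ring.
Qed.

End cosine_form.
End normalized_gegenbauer.

(** * Expectations of bounded measurable functions *)

Section bounded_measurable.
Context d (T : measurableType d) (R : realType).
Implicit Types f g : T -> R.

(** Such functions are integrable for every probability and stable under the operations used below,
    so expectations stay real and linear without further conditions. *)
Definition bmeas f := measurable_fun setT f /\ exists C, forall x, `|f x| <= C.

Lemma bmeas_cst c : bmeas (fun=> c).
Proof. by split; [exact: measurable_cst | exists `|c|]. Qed.

Lemma bmeasD f g : bmeas f -> bmeas g -> bmeas (fun x => f x + g x).
Proof.
move=> [mf [C fC]] [mg [D gD]]; split; first exact: measurable_funD.
by exists (C + D) => x; rewrite (le_trans (ler_normD _ _))// lerD.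
Qed.

Lemma bmeasM f g : bmeas f -> bmeas g -> bmeas (fun x => f x * g x).
Proof.
move=> [mf [C fC]] [mg [D gD]]; split; first exact: measurable_funM.
by exists (C * D) => x; rewrite normrM ler_pM.
Qed.

Lemma bmeasZ c f : bmeas f -> bmeas (fun x => c * f x).
Proof. by apply: bmeasM; exact: bmeas_cst. Qed.

Lemma bmeasN f : bmeas f -> bmeas (fun x => - f x).
Proof.
move=> bf; rewrite (_ : (fun x => _) = fun x => -1 * f x); first exact: bmeasZ.
by apply/funext => x; rewrite mulN1r.
Qed.

Lemma bmeasB f g : bmeas f -> bmeas g -> bmeas (fun x => f x - g x).
Proof. by move=> bf bg; apply: bmeasD => //; exact: bmeasN. Qed.

Lemma bmeasX f n : bmeas f -> bmeas (fun x => f x ^+ n).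
Proof.
move=> bf; elim: n => [|n IH]; first exact: bmeas_cst.
under [X in bmeas X]eq_fun do rewrite exprS.
exact: bmeasM.
Qed.

Lemma bmeas_sum (I : Type) (r : seq I) (F : I -> T -> R) :
  (forall i, bmeas (F i)) -> bmeas (fun x => \sum_(i <- r) F i x).
Proof.
move=> bF; elim: r => [|i r IH].
  under [X in bmeas X]eq_fun do rewrite big_nil.
  exact: bmeas_cst.
under [X in bmeas X]eq_fun do rewrite big_cons.
exact: bmeasD.
Qed.

Lemma bmeas_horner (p : {poly R}) f : bmeas f -> bmeas (fun x => p.[f x]).
Proof.
move=> bf; under [X in bmeas X]eq_fun do rewrite horner_coef.
by apply: bmeas_sum => i; apply: bmeasZ; exact: bmeasX.
Qed.

End bounded_measurable.

Lemma bmeas_comp d d' (T : measurableType d) (U : measurableType d') (R : realType)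
  (f : U -> R) (h : T -> U) : bmeas f -> measurable_fun setT h ->
  bmeas (fun x => f (h x)).
Proof.
move=> [mf [C fC]] mh; split; first exact: measurableT_comp.
by exists C => x.
Qed.

Section expectation_of_bounded.
Context d (T : measurableType d) (R : realType) (P : probability T R).
Implicit Types f g : T -> R.

Definition Ex f : R := (\int[P]_x f x)%R.

Lemma bmeas_integrable f : bmeas f -> P.-integrable setT (EFin \o f).
Proof.
move=> [mf [C fC]]; apply: measurable_bounded_integrable => //.
  by rewrite -ge0_fin_numE// fin_num_measure.
rewrite /bounded_near; near=> M => x _; apply: (le_trans (fC x)).
by near: M; apply: nbhs_pinfty_ge; exact: num_real.
Unshelve. all: by end_near. Qed.

Lemma EFin_Ex f : bmeas f -> (\int[P]_x (f x)%:E = (Ex f)%:E)%E.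
Proof.
move=> bf; rewrite /Ex /Rintegral fineK//.
by apply: (integrable_fin_num measurableT); exact: bmeas_integrable.
Qed.

Lemma eq_Ex f g : f =1 g -> Ex f = Ex g.
Proof. by move=> fg; congr Ex; apply/funext. Qed.

Lemma ExD f g : bmeas f -> bmeas g -> Ex (fun x => f x + g x) = Ex f + Ex g.
Proof. by move=> bf bg; rewrite /Ex RintegralD//; exact: bmeas_integrable. Qed.

Lemma ExZ c f : bmeas f -> Ex (fun x => c * f x) = c * Ex f.
Proof. by move=> bf; rewrite /Ex RintegralZl//; exact: bmeas_integrable. Qed.

Lemma ExB f g : bmeas f -> bmeas g -> Ex (fun x => f x - g x) = Ex f - Ex g.
Proof. by move=> bf bg; rewrite /Ex RintegralB//; exact: bmeas_integrable. Qed.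

Lemma Ex_cst c : Ex (fun=> c) = c.
Proof. by rewrite /Ex Rintegral_cst// [X in fine X](probability_setT P) /= mulr1. Qed.

Lemma Ex_sum (I : Type) (r : seq I) (F : I -> T -> R) :
  (forall i, bmeas (F i)) ->
  Ex (fun x => \sum_(i <- r) F i x) = \sum_(i <- r) Ex (F i).
Proof.
move=> bF; elim: r => [|i r IH].
  by rewrite big_nil -[RHS](Ex_cst 0); apply: eq_Ex => x; rewrite big_nil.
rewrite big_cons -IH -ExD//; last exact: bmeas_sum.
by apply: eq_Ex => x; rewrite big_cons.
Qed.

Lemma le_Ex f g : bmeas f -> bmeas g -> (forall x, f x <= g x) -> Ex f <= Ex g.
Proof. by move=> bf bg fg; apply: le_Rintegral => //; exact: bmeas_integrable. Qed.

Lemma Ex_ge0 f : (forall x, 0 <= f x) -> 0 <= Ex f.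
Proof. by move=> f0; apply: Rintegral_ge0 => x _. Qed.

Lemma normr_Ex_le f C : bmeas f -> (forall x, `|f x| <= C) -> `|Ex f| <= C.
Proof.
move=> bf fC; rewrite ler_norml; apply/andP; split.
  rewrite -(Ex_cst (- C)); apply: le_Ex => //; first exact: bmeas_cst.
  by move=> x; have := fC x; rewrite ler_norml => /andP[].
rewrite -(Ex_cst C); apply: le_Ex => //; first exact: bmeas_cst.
by move=> x; have := fC x; rewrite ler_norml => /andP[].
Qed.

End expectation_of_bounded.

(** * Integration against an image measure with a density *)

Section change_of_density.
Context d (T : measurableType d) (R : realType) (kappa : {measure set T -> \bar R}).
Context d' (U : measurableType d') (nu : {measure set U -> \bar R}).
Variables (W : T -> R) (Z : T -> U).
Hypotheses (mW : measurable_fun setT W) (W0 : forall x, 0 <= W x).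
Hypothesis mZ : measurable_fun setT Z.
Hypothesis nuE : forall A, measurable A ->
  nu A = (\int[kappa]_x (W x * \1_A (Z x))%:E)%E.
Import HBNNSimple.

(** The hypothesis [nuE] says that [nu] is the image under [Z] of the measure of density [W]. It
    gives the equality on indicators, hence on simple functions, and monotone convergence
    concludes. *)
Lemma integral_change_of_density (f : U -> \bar R) :
  measurable_fun setT f -> (forall y, 0 <= f y)%E ->
  (\int[nu]_y f y = \int[kappa]_x ((W x)%:E * f (Z x)))%E.
Proof.
move=> mf f0; pose f_ := nnsfun_approx measurableT mf.
transitivity (limn (fun n => \int[nu]_y (f_ n y)%:E))%E.
  rewrite -monotone_convergence//.
  - apply: eq_integral => y _; apply/esym/cvg_lim => //.
    exact: cvg_nnsfun_approx.
  - by move=> n; exact/measurable_EFinP.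
  - by move=> n y _; rewrite lee_fin.
  - by move=> y _ m n mn; rewrite lee_fin; exact/lefP/nd_nnsfun_approx.
have mWf n : measurable_fun setT (fun x => ((W x)%:E * (f_ n (Z x))%:E)%E).
  apply: emeasurable_funM; first exact/measurable_EFinP.
  by apply/measurable_EFinP; exact: measurableT_comp.
rewrite [X in limn X](_ : _ =
    fun n => \int[kappa]_x ((W x)%:E * (f_ n (Z x))%:E))%E.
  rewrite -monotone_convergence//.
  - apply: eq_integral => x _; apply/cvg_lim => //.
    apply: cvgeZl => //; apply: cvg_nnsfun_approx => //.
  - by move=> n x _; rewrite mule_ge0// lee_fin.
  - move=> x _ m n mn; rewrite lee_wpmul2l ?lee_fin//.
    exact/lefP/nd_nnsfun_approx.
apply/funext => n.
transitivity (\sum_(k \in range (f_ n)) \int[nu]_y (k * \1_(f_ n @^-1` [set k]) y)%:E)%E.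
  under eq_integral do rewrite fimfunE -fsumEFin//.
  rewrite ge0_integral_fsum//.
    by move=> k; apply/measurable_EFinP; exact: measurable_funM.
  by move=> k y _; rewrite nnfun_muleindic_ge0.
transitivity (\sum_(k \in range (f_ n))
   \int[kappa]_x ((W x)%:E * (k * \1_(f_ n @^-1` [set k]) (Z x))%:E))%E.
  apply: eq_fsbigr => k; rewrite inE => -[y0 _ fk].
  have k0 : 0 <= k by rewrite -fk.
  rewrite integralZl_indic_nnsfun// integral_indic// setIT nuE//.
  rewrite -ge0_integralZl//; last 2 first.
  - apply/measurable_EFinP; apply: measurable_funM => //.
    by apply: measurableT_comp => //; exact: measurable_indic.
  - by move=> x _; rewrite lee_fin mulr_ge0.
  by apply: eq_integral => x _; rewrite -!EFinM; congr (_%:E); ring.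
rewrite -ge0_integral_fsum//.
- apply: eq_integral => x _.
  rewrite -ge0_mule_fsumr; last by move=> k; rewrite nnfun_muleindic_ge0.
  by congr (_ * _)%E; rewrite fsumEFin// -fimfunE.
- move=> k; apply: emeasurable_funM; first exact/measurable_EFinP.
  apply/measurable_EFinP; apply: measurable_funM => //.
  by apply: measurableT_comp => //; exact: measurable_indic.
- by move=> k x _; rewrite mule_ge0 ?lee_fin ?W0//; exact: nnfun_muleindic_ge0.
Qed.

End change_of_density.

(** * Iterated integrals, rotations and zonal functions *)

Section lebesgue_plane.
Variable R : realType.
Notation mu := (@lebesgue_measure R).

Lemma lebesgue_measure_translation (a : R) (A : set R) : measurable A ->
  pushforward mu ((fun x => x + a) : R -> measurableTypeR R) A = mu A.
Proof.
have ma : measurable_fun setT ((fun x => x + a) : R -> measurableTypeR R).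
  exact: measurable_funD.
move=> mA; apply/esym/lebesgue_measure_unique => //= _ [[u v]] _ <-.
rewrite /pushforward.
have -> : (fun x => x + a) @^-1` `]u, v]%classic = `]u - a, v - a]%classic.
  by apply/seteqP; split => x /=; rewrite !in_itv /= ltrBlDr lerBrDr.
rewrite !lebesgue_measure_itv/= !lte_fin ltrD2r.
by case: ifP => // _; rewrite -!EFinD; congr (_%:E); ring.
Qed.

Lemma ge0_integral_translation (a : R) (f : R -> \bar R) :
  measurable_fun setT f -> (forall x, 0 <= f x)%E ->
  (\int[mu]_x f (x + a)%R = \int[mu]_x f x)%E.
Proof.
move=> mf f0.
have ma : measurable_fun setT ((fun x => x + a) : R -> measurableTypeR R).
  exact: measurable_funD.
rewrite [RHS](eq_measure_integral (pushforward mu ((fun x => x + a) : R -> measurableTypeR R))).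
  by rewrite ge0_integral_pushforward.
by move=> A mA _; apply: esym; exact: (lebesgue_measure_translation a mA).
Qed.

Lemma integral_shear_inner (a : R) (K : R * R -> \bar R) :
  measurable_fun setT K -> (forall x, 0 <= K x)%E ->
  (\int[mu]_t \int[mu]_s K (s + a * t, t)%R = \int[mu]_t \int[mu]_s K (s, t))%E.
Proof.
move=> mK K0; apply: eq_integral => t _.
rewrite (ge0_integral_translation (a * t) (f := fun s => K (s, t)))//.
exact/measurableT_comp.
Qed.

Lemma integral_swap (K : R * R -> \bar R) :
  measurable_fun setT K -> (forall x, 0 <= K x)%E ->
  (\int[mu]_t \int[mu]_s K (s, t) = \int[mu]_s \int[mu]_t K (s, t))%E.
Proof. by move=> mK K0; exact/esym/(fubini_tonelli (m1 := mu) (m2 := mu) K mK K0). Qed.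

Lemma integral_shear_outer (a : R) (K : R * R -> \bar R) :
  measurable_fun setT K -> (forall x, 0 <= K x)%E ->
  (\int[mu]_t \int[mu]_s K (s, t + a * s)%R = \int[mu]_t \int[mu]_s K (s, t))%E.
Proof.
move=> mK K0.
have m1 : measurable_fun setT (fun x : R * R => K (x.1, x.2 + a * x.1)).
  apply: (measurableT_comp mK); apply/measurable_fun_pair => //=.
  by apply: measurable_funD => //; exact: measurable_funM.
apply: (eq_trans (integral_swap m1 (fun x => K0 _))).
apply: (eq_trans _ (esym (integral_swap mK K0))); apply: eq_integral => s _ /=.
apply: (ge0_integral_translation (a * s) (f := fun t => K (s, t))) => //.
exact/measurableT_comp.
Qed.

(* For s <> 0 a plane rotation is a product of three shears. *)
Lemma integral_rotation (c s : R) (K : R * R -> \bar R) : c ^+ 2 + s ^+ 2 = 1 ->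
  measurable_fun setT K -> (forall x, 0 <= K x)%E ->
  (\int[mu]_y \int[mu]_x K (c * x + s * y, - s * x + c * y)%R =
   \int[mu]_y \int[mu]_x K (x, y))%E.
Proof.
have main (c' s' : R) (K' : R * R -> \bar R) : s' != 0 -> c' ^+ 2 + s' ^+ 2 = 1 ->
    measurable_fun setT K' -> (forall x, 0 <= K' x)%E ->
    (\int[mu]_y \int[mu]_x K' (c' * x + s' * y, - s' * x + c' * y)%R =
     \int[mu]_y \int[mu]_x K' (x, y))%E.
  (* [a] is the tangent of the half angle: shears by [a], [- s'] and [a] compose to the rotation. *)
  move=> s0 cs mK K0; set a := (1 - c') / s'.
  have as' : a * s' = 1 - c' by rewrite /a divfK.
  have ac : a * (1 + c') = s'.
    by apply: (mulIf s0); rewrite mulrAC as'; move: cs; lra.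
  pose K1 x : \bar R := K' (x.1 + a * x.2, x.2).
  have mK1 : measurable_fun setT K1.
    apply: (measurableT_comp mK); apply/measurable_fun_pair => //=.
    by apply: measurable_funD => //; exact: measurable_funM.
  pose K2 x : \bar R := K1 (x.1, x.2 + (- s') * x.1).
  have mK2 : measurable_fun setT K2.
    apply: (measurableT_comp mK1); apply/measurable_fun_pair => //=.
    by apply: measurable_funD => //; exact: measurable_funM.
  have K20 x : (0 <= K2 x)%E by exact: K0.
  have K10 x : (0 <= K1 x)%E by exact: K0.
  apply: (eq_trans _ (integral_shear_inner a mK K0)).
  apply: (eq_trans _ (integral_shear_outer (- s') mK1 K10)).
  apply: (eq_trans _ (integral_shear_inner a mK2 K20)).
  apply: eq_integral => y _; apply: eq_integral => x _.
  rewrite /K2 /K1 /=; congr (K' (_, _)).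
    transitivity ((1 - a * s') * x + (a + a * (1 - a * s')) * y); last by ring.
    by rewrite as' -ac; ring.
  transitivity (- s' * x + (1 - a * s') * y); last by ring.
  by rewrite as'; ring.
move=> cs mK K0; have [s0|s0] := eqVneq s 0; last exact: main.
move: cs; rewrite s0 expr0n addr0 => /eqP; rewrite sqrf_eq1 => /orP[]/eqP ->.
  apply: eq_integral => y _; apply: eq_integral => x _; congr (K (_, _)); ring.
(* The half turn [c = -1] is the square of the quarter turn, whose sine is not zero. *)
have h01 : 0 ^+ 2 + 1 ^+ 2 = 1 :> R by rewrite expr0n expr1n add0r.
pose K1 x : \bar R := K (0 * x.1 + 1 * x.2, - 1 * x.1 + 0 * x.2).
have mK1 : measurable_fun setT K1.
  apply: (measurableT_comp mK); apply/measurable_fun_pair => //=.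
    by apply: measurable_funD => //; exact: measurable_funM.
  by apply: measurable_funD => //; exact: measurable_funM.
have K10 x : (0 <= K1 x)%E by exact: K0.
apply: (eq_trans _ (main 0 1 K (oner_neq0 _) h01 mK K0)).
apply: (eq_trans _ (main 0 1 K1 (oner_neq0 _) h01 mK1 K10)).
apply: eq_integral => y _; apply: eq_integral => x _.
rewrite /K1 /=; congr (K (_, _)); ring.
Qed.

End lebesgue_plane.

Section iterated_integral.
Variable R : realType.
Notation mu := (@lebesgue_measure R).

(* Measurability for the product sigma-algebra on [nat -> R], tested on all
   families of measurable coordinates. *)
Definition seq_measurable (G : (nat -> R) -> \bar R) :=
  forall d (W : measurableType d) (b : nat -> W -> R),
    (forall j, measurable_fun setT (b j)) ->
    measurable_fun setT (fun w => G (fun j => b j w)).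

Definition param_seq_measurable d (V : measurableType d)
    (G : V -> (nat -> R) -> \bar R) :=
  forall d' (W : measurableType d') (a : W -> V) (b : nat -> W -> R),
    measurable_fun setT a -> (forall j, measurable_fun setT (b j)) ->
    measurable_fun setT (fun w => G (a w) (fun j => b j w)).

Lemma iint_ge0 m (G : (nat -> R) -> \bar R) :
  (forall x, 0 <= G x)%E -> (0 <= iint m G)%E.
Proof.
elim: m G => [|m IH] G G0 //=.
by apply: integral_ge0 => t _; exact: IH.
Qed.

(** The parameter space is quantified so that the induction can move the variable of the outermost
    integral into the parameter. *)
Lemma measurable_iint m d (V : measurableType d) (G : V -> (nat -> R) -> \bar R) :
  param_seq_measurable G -> (forall v x, 0 <= G v x)%E ->
  measurable_fun setT (fun v => iint m (G v)).
Proof.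
elim: m d V G => [|m IH] d V G mG G0 /=; first exact: mG.
pose G' (v : V * R) (x : nat -> R) := G v.1 (fun j => if j == m then v.2 else x j).
apply: (measurable_fun_fubini_tonelli_F (m2 := mu) (fun v : V * R => iint m (G' v))).
  apply: IH; last by move=> *; exact: G0.
  move=> d' W a b ma mb; apply: mG.
    exact: measurableT_comp.
  by move=> j; case: (j == m) => //; exact: measurableT_comp.
by move=> v; apply: iint_ge0 => x; exact: G0.
Qed.

Lemma seq_measurable_update (G : (nat -> R) -> \bar R) m t :
  seq_measurable G ->
  seq_measurable (fun x => G (fun j => if j == m then t else x j)).
Proof. by move=> mG d W b mb; apply: mG => j; case: (j == m). Qed.

Lemma iint_update_measurable m (G : (nat -> R) -> \bar R) :
  seq_measurable G -> (forall y, 0 <= G y)%E ->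
  measurable_fun setT
    (fun t => iint m (fun x => G (fun j => if j == m then t else x j))).
Proof.
move=> mG G0.
apply: (@measurable_iint m _ R
  (fun t x => G (fun j => if j == m then t else x j))) => //.
by move=> d W a b ma mb; apply: mG => j; case: (j == m).
Qed.

Lemma iint_eq0 m (G : (nat -> R) -> \bar R) :
  (forall x, G x = 0%E) -> iint m G = 0%E.
Proof.
elim: m G => [|m IH] G G0 //=.
by rewrite integral0_eq// => t _; rewrite IH.
Qed.

Let lt_N11 : -1 < 1 :> R. Proof. lra. Qed.

Definition cube_supported m (G : (nat -> R) -> \bar R) :=
  forall y j, (j < m)%N -> 1 < `|y j| -> G y = 0%E.

(* The integrands of interest vanish outside the cube [-1, 1]^m, so that a
   product of uniform distributions can be used in place of Lebesgue measure. *)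
Lemma iint_cube_probability m : exists d (T : measurableType d)
    (kappa : probability T R) (x : nat -> T -> R),
  (forall j, measurable_fun setT (x j)) /\
  forall G, seq_measurable G -> (forall y, 0 <= G y)%E -> cube_supported m G ->
    iint m G = ((2 ^+ m)%:E * \int[kappa]_w G (fun j => x j w))%E.
Proof.
elim: m => [|m [d [T [kappa [x [mx IH]]]]]].
  exists _, unit, \d_tt, (fun _ _ => 0); split=> // G mG G0 _.
  by rewrite integral_dirac//= diracT expr0 !mul1e.
exists _, (measurableTypeR R * T)%type, (uniform_prob lt_N11 \x kappa)%E,
  (fun j w => if j == m then w.1 else x j w.2); split.
  by move=> j; case: (j == m) => //; exact: measurableT_comp.
move=> G mG G0 sG /=.
pose F t := iint m (fun x => G (fun j => if j == m then t else x j)).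
have F0 t : (0 <= F t)%E by apply: iint_ge0.
have mF : measurable_fun setT F by exact: iint_update_measurable.
have -> : (\int[mu]_t F t = 2%:E * \int[uniform_prob lt_N11]_t F t)%E.
  rewrite integral_uniform// muleA -EFinM opprK mulfV ?mul1e; last first.
    by rewrite gt_eqF//; lra.
  rewrite [RHS]integral_mkcond; apply: eq_integral => t _; rewrite patchE.
  case: ifPn => //; rewrite notin_setE /= in_itv /= => /negP t1.
  apply: iint_eq0 => y; apply: (sG _ m) => //; rewrite eqxx.
  by rewrite ltNge ler_norml.
rewrite exprS EFinM -muleA; congr (_ * _)%E.
have mG2 : measurable_fun setT
    (fun w : measurableTypeR R * T => G (fun j => if j == m then w.1 else x j w.2)).
  by apply: mG => j; case: (j == m) => //; exact: measurableT_comp.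
rewrite (fubini_tonelli1 _ mG2)// -ge0_integralZl//; first last.
- by move=> t _; exact: integral_ge0.
- exact: (measurable_fun_fubini_tonelli_F (m2 := kappa) _ mG2 (fun w => G0 _)).
apply: eq_integral => t _; rewrite /F IH//; first exact: seq_measurable_update.
move=> y j jm yj; apply: (sG _ j); first exact: ltnW.
by rewrite (ltn_eqF jm).
Qed.

Definition plane_rot (i : nat) (c s : R) (x : nat -> R) (j : nat) : R :=
  if j == i then c * x i + s * x i.+1
  else if j == i.+1 then - s * x i + c * x i.+1 else x j.

(** Coordinates [i] and [i + 1] are integrated consecutively, so below the outer integrals the
    rotation acts on a plane integral and [integral_rotation] applies. *)
Lemma iint_plane_rot m i c s (G : (nat -> R) -> \bar R) : c ^+ 2 + s ^+ 2 = 1 ->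
  (i.+1 < m)%N -> seq_measurable G -> (forall x, 0 <= G x)%E ->
  iint m (G \o plane_rot i c s) = iint m G.
Proof.
move=> cs; elim: m G => [//|m IH] G; rewrite ltnS leq_eqVlt => /orP[/eqP <-|im] mG G0.
  rewrite /=.
  pose K (y : R * R) := iint i (fun x => G (fun j =>
     if j == i.+1 then y.2 else if j == i then y.1 else x j)).
  have mK : measurable_fun setT K.
    apply: measurable_iint; last by move=> *; exact: G0.
    move=> d W a b ma mb; apply: mG => j.
    by case: (j == i.+1); [|case: (j == i)]; rewrite //; exact: measurableT_comp.
  have K0 y : (0 <= K y)%E by apply: iint_ge0 => x; exact: G0.
  rewrite -[RHS](integral_rotation cs mK K0).
  apply: eq_integral => t _; apply: eq_integral => u _.
  rewrite /K /=; congr iint; apply/funext => x; congr G; apply/funext => j.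
  rewrite /plane_rot !eqxx.
  have -> : (i == i.+1) = false by lia.
  case: (eqVneq j i) => [->|ji].
    by have -> : (i == i.+1) = false by lia.
  by case: eqP.
apply: eq_integral => t _.
apply: (eq_trans _ (IH (fun x => G (fun j => if j == m then t else x j)) im
  (seq_measurable_update m t mG) (fun x => G0 _))).
congr iint; apply/funext => x /=; congr G; apply/funext => j.
rewrite /plane_rot.
have -> : (i == m) = false by lia.
have -> : (i.+1 == m) = false by lia.
case: (eqVneq j m) => [->|//].
have -> : (m == i) = false by lia.
by have -> : (m == i.+1) = false by lia.
Qed.

End iterated_integral.

(** * Integrals of zonal functions *)

Section zonal_integral.
Variable R : realType.
Implicit Types (v y : nat -> R) (H : R -> \bar R).

Definition sqn D y : R := \sum_(j < D) y j ^+ 2.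
Definition dotn D y v : R := \sum_(j < D) y j * v j.
Definition nrm D y : R := Num.sqrt (sqn D y).
Definition in_ball D y : bool := (0 < nrm D y) && (nrm D y <= 1).

(** The integrand by which the cone construction of [sphere_int] integrates [x |-> H (dotv x v)], on
    sequences of coordinates. *)
Definition zonal D v H y : \bar R :=
  if in_ball D y then H (dotn D y v / nrm D y) else 0%E.

Lemma sqn_ge0 D y : 0 <= sqn D y.
Proof. by apply: sumr_ge0 => j _; exact: sqr_ge0. Qed.

Lemma zonal_ge0 D v H : (forall z, 0 <= H z)%E -> forall y, (0 <= zonal D v H y)%E.
Proof. by move=> H0 y; rewrite /zonal; case: ifP. Qed.

Section coordinates.
Context d (W : measurableType d) (b : nat -> W -> R).
Hypothesis mb : forall j, measurable_fun setT (b j).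

Lemma measurable_nrm D : measurable_fun setT (fun w => nrm D (fun j => b j w)).
Proof.
apply: measurableT_comp; first exact: (continuous_measurable_fun (@sqrt_continuous R)).
by apply: measurable_sum => j; exact: measurable_funX.
Qed.

Lemma measurable_in_ball D :
  measurable_fun setT (fun w => in_ball D (fun j => b j w)).
Proof.
apply: measurable_and.
  by apply: measurable_fun_ltr => //; exact: measurable_nrm.
by apply: measurable_fun_ler => //; exact: measurable_nrm.
Qed.

Lemma measurable_dotn D v :
  measurable_fun setT (fun w => dotn D (fun j => b j w) v).
Proof. by apply: measurable_sum => j; exact: measurable_funM. Qed.

Lemma measurable_invnrm D :
  measurable_fun setT (fun w => (nrm D (fun j => b j w))^-1).
Proof.
rewrite (_ : (fun w => _) = fun w => nrm D (fun j => b j w) `^ (-1)).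
  exact: measurableT_comp (measurable_powR _) (measurable_nrm D).
by apply/funext => w; rewrite powR_inv1// sqrtr_ge0.
Qed.

End coordinates.

Lemma zonal_measurable D v H : measurable_fun setT H ->
  seq_measurable (zonal D v H).
Proof.
move=> mH d W b mb; rewrite /zonal; apply: measurable_fun_ifT => //.
  exact: measurable_in_ball.
apply: measurableT_comp => //; apply: measurable_funM; first exact: measurable_dotn.
exact: measurable_invnrm.
Qed.

Lemma zonal_cube D v H : cube_supported D (zonal D v H).
Proof.
move=> y j jD yj; rewrite /zonal /in_ball.
suff -> : (nrm D y <= 1) = false by rewrite andbF.
apply/negbTE; rewrite -ltNge; apply: (lt_le_trans yj).
rewrite -sqrtr_sqr ler_sqrt ?sqn_ge0//.
rewrite /sqn (bigD1 (Ordinal jD))//= lerDl.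
by apply: sumr_ge0 => i _; exact: sqr_ge0.
Qed.

Lemma big_rot D i c s (F : nat -> R -> R) y : (i.+1 < D)%N ->
  \sum_(j < D) F j (plane_rot i c s y j) =
  F i (c * y i + s * y i.+1) + F i.+1 (- s * y i + c * y i.+1) +
  \sum_(j < D | (val j != i) && (val j != i.+1)) F j (y j).
Proof.
move=> iD; have iD' : (i < D)%N by exact: ltnW.
rewrite (bigD1 (Ordinal iD'))//= (bigD1 (Ordinal iD))/=; last first.
  by rewrite -val_eqE /=; lia.
rewrite addrA; congr (_ + _ + _).
- by rewrite /plane_rot eqxx.
- by rewrite /plane_rot eqxx; have -> : (i.+1 == i) = false by lia.
- apply: eq_big => [j|j /andP[]]; rewrite -!val_eqE //= => h1 h2.
  by rewrite /plane_rot (negPf h1) (negPf h2).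
Qed.

Lemma big_rot_id D i (F : nat -> R -> R) y : (i.+1 < D)%N ->
  \sum_(j < D) F j (y j) = F i (y i) + F i.+1 (y i.+1) +
  \sum_(j < D | (val j != i) && (val j != i.+1)) F j (y j).
Proof.
move=> iD; have := big_rot 1 0 F y iD.
rewrite mul1r mul0r addr0 oppr0 !mul0r add0r mul1r => <-.
apply: eq_bigr => j _; rewrite /plane_rot; congr (F _ _).
by case: eqP => [->|_]; [ring|case: eqP => [->|//]; ring].
Qed.

Lemma sqn_rot D i c s y : c ^+ 2 + s ^+ 2 = 1 -> (i.+1 < D)%N ->
  sqn D (plane_rot i c s y) = sqn D y.
Proof.
move=> cs iD; rewrite /sqn (big_rot c s (fun _ x => x ^+ 2) y iD).
rewrite (big_rot_id (fun _ x => x ^+ 2) y iD); congr (_ + _).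
transitivity ((c ^+ 2 + s ^+ 2) * (y i ^+ 2 + y i.+1 ^+ 2)); first by ring.
by rewrite cs mul1r.
Qed.

Lemma dotn_rot D i c s y v : (i.+1 < D)%N ->
  dotn D (plane_rot i c s y) v = dotn D y (plane_rot i c (- s) v).
Proof.
move=> iD; rewrite /dotn (big_rot c s (fun j x => x * v j) y iD).
rewrite (big_rot c (- s) (fun j x => y j * x) v iD); congr (_ + _); ring.
Qed.

Lemma zonal_rot D i c s v H : c ^+ 2 + s ^+ 2 = 1 -> (i.+1 < D)%N ->
  measurable_fun setT H -> (forall z, 0 <= H z)%E ->
  iint D (zonal D (plane_rot i c s v) H) = iint D (zonal D v H).
Proof.
move=> cs iD mH H0.
have cs' : c ^+ 2 + (- s) ^+ 2 = 1 by rewrite sqrrN.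
apply: (eq_trans _ (iint_plane_rot cs' iD (zonal_measurable D v mH) (zonal_ge0 D v H0))).
congr iint; apply/funext => y.
rewrite /zonal /= /in_ball /nrm sqn_rot// dotn_rot//.
by rewrite opprK.
Qed.

Lemma eq_zonal D v w H : (forall j, (j < D)%N -> v j = w j) ->
  zonal D v H = zonal D w H.
Proof.
move=> vw; apply/funext => y; rewrite /zonal; case: ifP => // _.
by congr (H (_ / _)); apply: eq_bigr => j _; rewrite vw.
Qed.

(* Successive plane rotations move a vector onto the last coordinate axis. *)
Lemma zonal_normal_form D v H : (1 < D)%N ->
  measurable_fun setT H -> (forall z, 0 <= H z)%E ->
  iint D (zonal D v H) =
  iint D (zonal D (fun j => if j == D.-1 then nrm D v else 0) H).
Proof.
move=> D1 mH H0.
suff: forall i, (i < D)%N -> exists w, [/\ iint D (zonal D v H) = iint D (zonal D w H),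
    sqn D w = sqn D v & forall j, (j < i)%N -> w j = 0].
  move=> /(_ D.-1)[|w [-> sw w0]]; first by lia.
  have sw2 : w D.-1 ^+ 2 = sqn D v.
    rewrite -sw /sqn; case: D D1 w0 {sw} => // m m1 w0 /=.
    rewrite big_ord_recr /= big1 ?add0r// => i _.
    by rewrite w0 ?expr0n//=; lia.
  have [w1|w1] := leP 0 (w D.-1).
    congr iint; apply: eq_zonal => j jD; case: eqP => [->|jn]; last by rewrite w0//; lia.
    by rewrite /nrm -sw2 sqrtr_sqr ger0_norm.
  (* A negative last coordinate is corrected by the half turn in the last coordinate plane, whose
     other coordinate is already 0. *)
  have cs : (-1) ^+ 2 + 0 ^+ 2 = 1 :> R by rewrite sqrrN expr1n expr0n addr0.
  have iD : (D.-2.+1 < D)%N by lia.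
  rewrite -(zonal_rot w cs iD mH H0); congr iint; apply: eq_zonal => j jD.
  rewrite /plane_rot.
  have e1 : D.-2.+1 = D.-1 by lia.
  case: (eqVneq j D.-2) => [->|h1].
    by rewrite w0 ?mulr0 ?mul0r ?addr0; [case: eqP => //; lia|lia].
  rewrite e1; case: (eqVneq j D.-1) => h2; last by rewrite w0//; lia.
  rewrite oppr0 mul0r add0r mulN1r /nrm -sw2 sqrtr_sqr ltr0_norm//.
elim=> [|i IH] iD; first by exists v.
have [w [E sw w0]] := IH (ltnW iD).
set r := Num.sqrt (w i ^+ 2 + w i.+1 ^+ 2).
have r2 : r ^+ 2 = w i ^+ 2 + w i.+1 ^+ 2.
  by rewrite sqr_sqrtr// addr_ge0// sqr_ge0.
have [r0|r0] := eqVneq r 0.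
  exists w; split=> // j; rewrite ltnS leq_eqVlt => /orP[/eqP ->|]; last exact: w0.
  move: r2; rewrite r0 expr0n /= => /esym/eqP; rewrite paddr_eq0 ?sqr_ge0//.
  by rewrite !sqrf_eq0 => /andP[/eqP].
(* This rotation takes [(w i, w i.+1)] to [(0, r)]. *)
have cs : (w i.+1 / r) ^+ 2 + (- w i / r) ^+ 2 = 1.
  transitivity ((w i ^+ 2 + w i.+1 ^+ 2) / r ^+ 2); first by field.
  by rewrite -r2 divff// expf_eq0.
exists (plane_rot i (w i.+1 / r) (- w i / r) w); split.
- by rewrite zonal_rot.
- by rewrite sqn_rot.
move=> j; rewrite ltnS leq_eqVlt => /orP[/eqP ->|ji].
  by rewrite /plane_rot eqxx; field.
rewrite /plane_rot.
have -> : (j == i) = false by lia.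
have -> : (j == i.+1) = false by lia.
exact: w0.
Qed.

Lemma zonal_norm D v w H : (1 < D)%N -> sqn D v = sqn D w ->
  measurable_fun setT H -> (forall z, 0 <= H z)%E ->
  iint D (zonal D v H) = iint D (zonal D w H).
Proof.
move=> D1 vw mH H0; rewrite zonal_normal_form// [RHS]zonal_normal_form//.
by rewrite /nrm vw.
Qed.

Lemma sphere_int_zonal d (mu : 'rV[R]_(d.+1)) H :
  sphere_int (fun x => H (dotv x mu)) =
  (d.+1%:R%:E * iint d.+1 (zonal d.+1 (fun j => mu ord0 (inord j)) H))%E.
Proof.
rewrite /sphere_int /lebesgue_int_rV; congr (_ * iint _ _)%E.
apply/funext => y.
have e1 : enorm (\row_(j < d.+1) y j) = nrm d.+1 y.
  rewrite /enorm /nrm /dotv /sqn; congr Num.sqrt.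
  by apply: eq_bigr => j _; rewrite mxE expr2.
rewrite e1 /zonal /in_ball; case: ifP => // _; congr H.
rewrite /dotv /dotn mulr_suml; apply: eq_bigr => j _.
by rewrite !mxE inord_val; ring.
Qed.

End zonal_integral.

Lemma poly_eq_horner (F : numFieldType) (p q : {poly F}) :
  (forall x, p.[x] = q.[x]) -> p = q.
Proof.
move=> pq; apply/eqP; rewrite -subr_eq0; apply/eqP.
set r := p - q; apply: (@roots_geq_poly_eq0 _ r [seq i%:R | i <- iota 0 (size r)]).
- by apply/allP => x _; rewrite /root /r hornerD hornerN pq subrr.
- rewrite map_inj_uniq ?iota_uniq// => i j /eqP.
  by rewrite eqr_nat => /eqP.
- by rewrite size_map size_iota.
Qed.

(** * Moments of the uniform law on the sphere *)

Section sphere_moments.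
Variables (R : realType) (d : nat).
Hypothesis d_gt0 : (0 < d)%N.
Context d' (T : measurableType d') (kappa : probability T R) (x : nat -> T -> R).
Hypothesis mx : forall j, measurable_fun setT (x j).
Hypothesis iintE : forall G, seq_measurable G -> (forall y, 0 <= G y)%E ->
  cube_supported d.+1 G ->
  iint d.+1 G = ((2 ^+ d.+1)%:E * \int[kappa]_w G (fun j => x j w))%E.
Let D := d.+1.
Let y w j := x j w.
Let E := @Ex _ _ R kappa.

Definition ball_indic w : R := (in_ball D (y w))%:R.
Definition dir j w : R := if in_ball D (y w) then x j w / nrm D (y w) else 0.
Definition proj (v : nat -> R) w : R := \sum_(j < D) v j * dir j w.
Let b := ball_indic.

Lemma sum_dir_sqr w : \sum_(j < D) dir j w ^+ 2 = b w.
Proof.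
rewrite /b /ball_indic /dir; case: (boolP (in_ball D (y w))) => [/andP[n0 _]|_]; last first.
  by rewrite big1// => j _; rewrite expr0n.
rewrite (eq_bigr (fun j : 'I_D => x j w ^+ 2 / nrm D (y w) ^+ 2)); last first.
  by move=> j _; rewrite expr_div_n.
rewrite -mulr_suml -/(sqn D (y w)) /nrm sqr_sqrtr ?sqn_ge0// divff//.
by move: n0; rewrite sqrtr_gt0 => /lt0r_neq0.
Qed.

Lemma ball_indic_ge0 w : 0 <= b w. Proof. exact: ler0n. Qed.

Lemma ball_indic_le1 w : b w <= 1. Proof. by rewrite /b /ball_indic lern1; case: in_ball. Qed.

Lemma bmeas_ball_indic : bmeas b.
Proof.
split; last by exists 1 => w; rewrite ger0_norm ?ball_indic_le1// ball_indic_ge0.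
rewrite /b /ball_indic (_ : (fun w => _) = fun w => if in_ball D (y w) then 1 else 0).
  by apply: measurable_fun_ifT => //; exact: measurable_in_ball.
by apply/funext => w; case: (in_ball _ _).
Qed.

Lemma normr_dir_le1 j w : (j < D)%N -> `|dir j w| <= 1.
Proof.
move=> jD; rewrite -(@ler_pXn2r _ 2)// ?nnegrE// real_normK ?num_real// expr1n.
apply: le_trans (ball_indic_le1 w); rewrite -sum_dir_sqr.
rewrite (bigD1 (Ordinal jD))//= lerDl.
by apply: sumr_ge0 => i _; exact: sqr_ge0.
Qed.

Lemma bmeas_dir j : (j < D)%N -> bmeas (dir j).
Proof.
move=> jD; split; last by exists 1 => w; exact: normr_dir_le1.
rewrite /dir; apply: measurable_fun_ifT => //; first exact: measurable_in_ball.
by apply: measurable_funM => //; exact: measurable_invnrm.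
Qed.

Lemma bmeas_proj v : bmeas (proj v).
Proof. by apply: bmeas_sum => j; apply: bmeasZ; exact: bmeas_dir. Qed.

Lemma normr_proj_le1 v w : sqn D v = 1 -> `|proj v w| <= 1.
Proof.
move=> v1; rewrite -(@ler_pM2l _ 2)//.
have : 2 * `|proj v w| <= \sum_(j < D) (v j ^+ 2 + dir j w ^+ 2).
  rewrite /proj (le_trans (ler_wpM2l _ (ler_norm_sum _ _ _)))// mulr_sumr.
  apply: ler_sum => j _; rewrite normrM -(real_normK (num_real (v j))).
  rewrite -(real_normK (num_real (dir j w))).
  have := sqr_ge0 (`|v j| - `|dir j w|); lra.
rewrite big_split /= -/(sqn D v) v1 sum_dir_sqr.
have := ball_indic_le1 w; rewrite -/b; lra.
Qed.

Lemma int_zonal v H : measurable_fun setT H -> (forall z, 0 <= H z)%E ->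
  iint D (zonal D v H) = ((2 ^+ D)%:E * \int[kappa]_w ((b w)%:E * H (proj v w)))%E.
Proof.
move=> mH H0; rewrite iintE//; last 3 first.
- exact: zonal_measurable.
- exact: zonal_ge0.
- exact: zonal_cube.
congr (_ * _)%E; apply: eq_integral => w _.
rewrite /zonal /b /ball_indic /proj /dir -/(y w); case: (in_ball D (y w)); last by rewrite mul0e.
rewrite mul1e; congr H; rewrite /dotn mulr_suml; apply: eq_bigr => j _.
by rewrite /y /=; ring.
Qed.

Lemma Ex_proj_norm v v' g : bmeas g -> sqn D v = sqn D v' ->
  E (fun w => b w * g (proj v w)) = E (fun w => b w * g (proj v' w)).
Proof.
move=> [mg [C gC]] vv'.
(* Rotation invariance is available for non-negative integrands; the shift by the bound [C] cancels
   afterwards, as it contributes [C * E b] for either vector. *)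
pose H z : \bar R := (g z + C)%:E.
have mH : measurable_fun setT H by apply/measurable_EFinP; exact: measurable_funD.
have H0 z : (0 <= H z)%E.
  by rewrite lee_fin; have := gC z; rewrite ler_norml => /andP[]; lra.
have bgC u : bmeas (fun w => b w * (g (proj u w) + C)).
  apply: bmeasM; first exact: bmeas_ball_indic.
  apply: bmeasD; last exact: bmeas_cst.
  by apply: bmeas_comp; [split=> //; exists C | have [] := bmeas_proj u].
have bg u : bmeas (fun w => b w * g (proj u w)).
  apply: bmeasM; first exact: bmeas_ball_indic.
  by apply: bmeas_comp; [split=> //; exists C | have [] := bmeas_proj u].
have EH u : (iint D (zonal D u H) =
    (2 ^+ D * (E (fun w => b w * g (proj u w)) + C * E b))%:E)%E.
  rewrite int_zonal// EFinM; congr (_ * _)%E.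
  under eq_integral => w _ do rewrite /H -EFinM.
  rewrite EFin_Ex// -ExZ; last exact: bmeas_ball_indic.
  rewrite -ExD//; last by apply: bmeasZ; exact: bmeas_ball_indic.
  by congr (_%:E); apply: eq_Ex => w; ring.
have D1 : (1 < D)%N by rewrite ltnS.
have := zonal_norm D1 vv' mH H0; rewrite !EH => -[].
by move/(mulfI (lt0r_neq0 (exprn_gt0 D (ltr0Sn R 1))))/addIr.
Qed.

Lemma Ex_projX_norm v v' n : sqn D v = sqn D v' ->
  E (fun w => b w * proj v w ^+ n) = E (fun w => b w * proj v' w ^+ n).
Proof.
move=> vv'; have [_ [C vC]] := bmeas_proj v; have [_ [C' vC']] := bmeas_proj v'.
pose K := Num.max C C'.
(* A power is not bounded on the line, so it is cut off beyond the range of both projections. *)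
pose g z : R := if `|z| <= K then z ^+ n else 0.
have bg : bmeas g.
  split.
    apply: measurable_fun_ifT => //; try exact: measurable_funX.
    by apply: measurable_fun_ler => //; exact: measurableT_comp.
  have K0 : 0 <= Num.max 0 K by rewrite le_max lexx.
  exists (Num.max 0 K ^+ n) => z; rewrite /g; case: ifP => zK; last first.
    by rewrite normr0 exprn_ge0.
  have zK' : `|z| <= Num.max 0 K by rewrite le_max zK orbT.
  by rewrite normrX lerXn2r.
have eqE u : (forall w, `|proj u w| <= K) ->
    E (fun w => b w * g (proj u w)) = E (fun w => b w * proj u w ^+ n).
  by move=> uK; apply: eq_Ex => w; rewrite /g uK.
by rewrite -!eqE => [|w|w]; rewrite ?le_max ?vC ?vC' ?orbT//; exact: Ex_proj_norm.
Qed.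

Definition mom n := E (fun w => b w * dir 0 w ^+ n).

Let e0 (j : nat) : R := (j == 0%N)%:R.

Let proj_e0 w : proj e0 w = dir 0 w.
Proof.
rewrite /proj big_ord_recl /e0 mul1r big1 ?addr0// => j _.
by rewrite mul0r.
Qed.

Let sqn_e0 : sqn D e0 = 1.
Proof.
by rewrite /sqn big_ord_recl /e0 expr1n big1 ?addr0// => j _; rewrite expr0n.
Qed.

Lemma Ex_proj_mom v n : sqn D v = 1 -> E (fun w => b w * proj v w ^+ n) = mom n.
Proof.
move=> v1; rewrite (Ex_projX_norm n (v' := e0)); last by rewrite sqn_e0.
by apply: eq_Ex => w; rewrite proj_e0.
Qed.

Lemma mom_odd n : odd n -> mom n = 0.
Proof.
move=> on.
have b0 : bmeas (fun w => b w * dir 0 w ^+ n).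
  by apply: bmeasM; [exact: bmeas_ball_indic|apply: bmeasX; exact: bmeas_dir].
have : mom n = - mom n.
  rewrite -{1}(Ex_proj_mom n (v := fun j => - e0 j)); last first.
    by rewrite -[RHS]sqn_e0; apply: eq_bigr => j _; rewrite sqrrN.
  rewrite -mulN1r /mom -ExZ//; apply: eq_Ex => w.
  have -> : proj (fun j => - e0 j) w = - dir 0 w.
    by rewrite -proj_e0 /proj -sumrN; apply: eq_bigr => j _; rewrite mulNr.
  by rewrite exprNn -signr_odd on; ring.
by move=> h; lra.
Qed.

(* Compare the coefficients of t^2 in
   E (dir 0 + t dir j)^(2m+2) = (1 + t^2)^(m+1) E (dir 0)^(2m+2). *)
Lemma mom_cross m j : (0 < j < D)%N ->
  (m.*2.+1)%:R * E (fun w => b w * (dir 0 w ^+ m.*2 * dir j w ^+ 2)) = mom m.*2.+2.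
Proof.
move=> /andP[j0 jD].
pose c i := E (fun w => b w * (dir 0 w ^+ (m.*2.+2 - i) * dir j w ^+ i)).
have bc i : bmeas (fun w => b w * (dir 0 w ^+ (m.*2.+2 - i) * dir j w ^+ i)).
  apply: bmeasM; first exact: bmeas_ball_indic.
  by apply: bmeasM; apply: bmeasX; exact: bmeas_dir.
pose p : {poly R} := \poly_(i < m.*2.+3) ('C(m.*2.+2, i)%:R * c i).
pose q : {poly R} := mom m.*2.+2 *: (1 + 'X^2) ^+ m.+1.
have pq : p = q.
  apply: poly_eq_horner => t.
  (* [v] is [e_0 + t e_j], of squared length [1 + t^2]. *)
  pose v (i : nat) : R := (i == 0%N)%:R + t * (i == j)%:R.
  have vE w : proj v w = dir 0 w + t * dir j w.
    rewrite /proj; under eq_bigr => i _ do rewrite mulrDl.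
    rewrite big_split /= -/(proj e0 w) proj_e0; congr (_ + _).
    rewrite (bigD1 (Ordinal jD))//= eqxx mulr1 big1 ?addr0// => i.
    by rewrite -val_eqE /= => /negPf ->; rewrite mulr0 mul0r.
  have sv : sqn D v = 1 + t ^+ 2.
    rewrite /sqn /v big_ord_recl /= (_ : (0%N == j) = false) ?mulr0 ?addr0 ?expr1n; last by lia.
    congr (_ + _); case: j j0 jD {c bc p q v vE} => // j _ jD.
    rewrite (bigD1 (Ordinal (jD : (j < d)%N)))//= add0r /bump /= eqxx mulr1.
    rewrite big1 ?addr0// => i; rewrite -val_eqE /= /bump eqSS => /negPf ->.
    by rewrite mulr0 addr0 expr0n.
  have s0 : 0 < 1 + t ^+ 2 by rewrite ltr_wpDr// sqr_ge0.
  pose r := Num.sqrt (1 + t ^+ 2).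
  have r2 : r ^+ 2 = 1 + t ^+ 2 by rewrite sqr_sqrtr// ltW.
  have -> : q.[t] = r ^+ m.*2.+2 * mom m.*2.+2.
    rewrite /q hornerZ horner_exp !(hornerD, hornerXn, hornerC) mulrC; congr (_ * _).
    by rewrite -r2 -exprM; congr (_ ^+ _); lia.
  transitivity (E (fun w => b w * proj v w ^+ m.*2.+2)).
    rewrite horner_poly /E -[RHS](eq_Ex _ (f := fun w => \sum_(i < m.*2.+3)
      ('C(m.*2.+2, i)%:R * t ^+ i) * (b w * (dir 0 w ^+ (m.*2.+2 - i) * dir j w ^+ i)))).
      rewrite /E Ex_sum; last by move=> i; exact: bmeasZ.
      by apply: eq_bigr => i _; rewrite ExZ// mulrAC.
    move=> w; rewrite vE exprDn mulr_sumr; apply: eq_bigr => i _.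
    by rewrite -mulr_natl exprMn; ring.
  rewrite (Ex_projX_norm _ (v' := fun i => r * e0 i)); last first.
    rewrite sv -r2 -[LHS]mulr1 -sqn_e0 /sqn mulr_sumr.
    by apply: eq_bigr => i _; rewrite exprMn.
  rewrite /mom -ExZ; last by apply: bmeasM; [exact: bmeas_ball_indic|apply: bmeasX; exact: bmeas_dir].
  apply: eq_Ex => w.
  have -> : proj (fun i => r * e0 i) w = r * dir 0 w.
    by rewrite -proj_e0 /proj mulr_sumr; apply: eq_bigr => i _; rewrite mulrA.
  by rewrite exprMn; ring.
have := congr1 (fun p : {poly R} => p`_2) pq.
rewrite /p coef_poly /= /q coefZ.
have -> : ((1 + 'X^2) ^+ m.+1 : {poly R})`_2 = m.+1%:R.
  rewrite exprDn coef_sum (bigD1 (Ordinal (isT : (1 < m.+2)%N)))//= big1 ?addr0.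
    by rewrite expr1n mul1r expr1 bin1 coefMn coefXn eqxx.
  move=> i; rewrite -val_eqE /= => i1.
  rewrite expr1n mul1r -exprM coefMn coefXn.
  have -> : (2 == 2 * i)%N = false by lia.
  by rewrite mulr0n mul0rn.
have bin : 'C(m.*2.+2, 2) = (m.+1 * m.*2.+1)%N.
  by rewrite bin2 [_.-1]/= -doubleS -doubleMl doubleK.
rewrite /c subSS subSS subn0 bin => h.
have m0 : m.+1%:R != 0 :> R by rewrite pnatr_eq0.
by apply: (mulfI m0); rewrite [RHS]mulrC -h mulrA -natrM.
Qed.

(** For even n insert [\sum_j dir j ^+ 2 = b]: the term [j = 0] is [mom n.+2], and each of the d
    others is [mom n.+2 / (n + 1)] by [mom_cross]. Odd moments vanish by reflection. *)
Lemma mom_rec n : (n%:R + d%:R + 1) * mom n.+2 = n.+1%:R * mom n.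
Proof.
have [on|en] := boolP (odd n); first by rewrite !mom_odd ?mulr0//= on.
rewrite -(odd_double_half n) (negPf en) add0n; set m := n./2.
have bj (j : 'I_D) : bmeas (fun w => b w * (dir 0 w ^+ m.*2 * dir j w ^+ 2)).
  apply: bmeasM; first exact: bmeas_ball_indic.
  by apply: bmeasM; apply: bmeasX; exact: bmeas_dir.
have : mom m.*2 = \sum_(j < D) E (fun w => b w * (dir 0 w ^+ m.*2 * dir j w ^+ 2)).
  rewrite /E -Ex_sum//; apply: eq_Ex => w.
  rewrite -!mulr_sumr sum_dir_sqr /b /ball_indic.
  by case: in_ball; rewrite ?mulr1 ?mul0r.
rewrite big_ord_recl => ->.
rewrite mulrDr mulr_sumr (eq_bigr (fun=> mom m.*2.+2)); last first.
  by move=> j _; rewrite mom_cross//= /bump /= ltnS ltn_ord.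
rewrite sumr_const card_ord.
have -> : E (fun w => b w * (dir 0 w ^+ m.*2 * dir ord0 w ^+ 2)) = mom m.*2.+2.
  by rewrite /mom /E => *; apply: eq_Ex => w; rewrite /= -exprD addn2.
rewrite -mulr_natr -[m.*2.+1%:R]natr1; ring.
Qed.

End sphere_moments.

(* Under the weight b, Z has the law of <X, mu> for X uniform on the sphere, up
   to normalisation; the last clause is the recurrence of its moments. *)
Lemma zonal_law (R : realType) (d : nat) (mu : 'rV[R]_(d.+1)) :
  (0 < d)%N -> sphere d mu ->
  exists d' (T : measurableType d') (kappa : probability T R) (b Z : T -> R),
  [/\ bmeas b /\ bmeas Z, (forall w, 0 <= b w), (forall w, `|Z w| <= 1),
   (forall H, measurable_fun setT H -> (forall z, 0 <= H z)%E ->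
     sphere_int (fun x => H (dotv x mu)) =
     (\int[kappa]_w ((b w)%:E * H (Z w)))%E) &
   Ex kappa (fun w => b w * Z w) = 0 /\
   forall n, (n%:R + d%:R + 1) * Ex kappa (fun w => b w * Z w ^+ n.+2) =
     n.+1%:R * Ex kappa (fun w => b w * Z w ^+ n)].
Proof.
move=> d0 mu1.
have [d' [T [kappa [x [mx iE]]]]] := iint_cube_probability R d.+1.
pose v j := mu ord0 (inord j : 'I_d.+1).
have v1 : sqn d.+1 v = 1.
  rewrite -[RHS]mu1 /sqn /dotv; apply: eq_bigr => j _.
  by rewrite /v inord_val expr2.
(* The cone factor [d + 1] times the volume of the cube [[-1, 1]^(d+1)]. *)
pose c : R := d.+1%:R * 2 ^+ d.+1.
have c0 : 0 <= c by rewrite mulr_ge0// exprn_ge0.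
have bb := bmeas_ball_indic d mx.
exists d', T, kappa, (fun w => c * ball_indic d x w), (proj d x v); split.
- split; first exact: bmeasZ.
  exact: bmeas_proj.
- by move=> w; rewrite mulr_ge0// ball_indic_ge0.
- by move=> w; exact: normr_proj_le1.
- move=> H mH H0; rewrite sphere_int_zonal (int_zonal iE)// muleA -EFinM -/c.
  rewrite -ge0_integralZl//.
  + by apply: eq_integral => w _; rewrite EFinM muleA.
  + apply: emeasurable_funM; first by apply/measurable_EFinP; case: bb.
    by apply: measurableT_comp => //; case: (bmeas_proj d mx v).
  + by move=> w _; rewrite mule_ge0// lee_fin ball_indic_ge0.
have mE n : Ex kappa (fun w => c * ball_indic d x w * proj d x v w ^+ n) =
    c * mom d kappa x n.
  rewrite -(Ex_proj_mom d0 mx iE n v1) -ExZ; last first.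
    by apply: bmeasM => //; apply: bmeasX; exact: bmeas_proj.
  by apply: eq_Ex => w; rewrite mulrA.
split.
  by have := mE 1%N; rewrite (mom_odd d0 mx iE)// mulr0.
by move=> n; rewrite !mE mulrCA (mom_rec d0 mx iE) mulrCA.
Qed.

(** * The Gamma function and normal distributions *)

Section by_parts.
Variable R : realType.
Notation mu := (@lebesgue_measure R).

(* Integration by parts as Tonelli's theorem on the region 0 < s <= t. *)
Lemma ge0_tonelli_by_parts (f g F G : R -> R) :
  measurable_fun setT f -> measurable_fun setT g ->
  (forall s, 0 < s -> 0 <= f s) -> (forall t, 0 < t -> 0 <= g t) ->
  (forall t, 0 < t -> (\int[mu]_(s in `]0%R, t]) (f s)%:E = (F t)%:E)%E) ->
  (forall s, 0 < s -> (\int[mu]_(t in `[s, +oo[) (g t)%:E = (G s)%:E)%E) ->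
  (\int[mu]_(t in `]0%R, +oo[) (F t * g t)%:E =
   \int[mu]_(s in `]0%R, +oo[) (f s * G s)%:E)%E.
Proof.
move=> mf mg f0 g0 fF gG.
pose k (x : R * R) : R := if (0 < x.1) && (x.1 <= x.2) then f x.1 * g x.2 else 0.
have k0 x : 0 <= k x.
  rewrite /k; case: ifP => // /andP[h1 h2].
  by rewrite mulr_ge0 ?f0 ?g0// (lt_le_trans h1).
have mk : measurable_fun setT k.
  apply: measurable_fun_ifT => //.
    apply: measurable_and; first exact: measurable_fun_ltr.
    exact: measurable_fun_ler.
  by apply: measurable_funM; exact: measurableT_comp.
have mK : measurable_fun setT (EFin \o k) by exact/measurable_EFinP.
have K0 x : (0 <= (EFin \o k) x)%E by rewrite lee_fin.
transitivity (\int[mu]_t \int[mu]_s (EFin \o k) (s, t))%E.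
  rewrite integral_mkcond; apply: eq_integral => t _; rewrite patchE.
  case: ifPn; rewrite (inE, notin_setE) /= in_itv /= andbT => t0; last first.
    rewrite integral0_eq// => s _; rewrite /k /=; case: ifP => // /andP[h1 h2].
    by case: t0; exact: lt_le_trans h2.
  rewrite mulrC EFinM -fF// -ge0_integralZl//; last 3 first.
  - by apply/measurable_EFinP; exact: measurable_funTS.
  - by move=> s /=; rewrite in_itv /= => /andP[s0 _]; rewrite lee_fin f0.
  - by rewrite lee_fin g0.
  rewrite integral_mkcond; apply: eq_integral => s _; rewrite patchE.
  case: ifPn; rewrite (inE, notin_setE) /= in_itv /= /k /=.
    by move=> ->; rewrite mulrC.
  by move=> /negP/negPf ->.
apply: (eq_trans (esym (fubini_tonelli (m1 := mu) (m2 := mu) (EFin \o k) mK K0))).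
rewrite [RHS]integral_mkcond; apply: eq_integral => s _; rewrite patchE.
case: ifPn; rewrite (inE, notin_setE) /= in_itv /= andbT => s0; last first.
  rewrite integral0_eq// => t _; rewrite /k /=; case: ifP => // /andP[h1 h2].
  by case: s0.
rewrite EFinM -gG// -ge0_integralZl//; last 3 first.
- by apply/measurable_EFinP; exact: measurable_funTS.
- move=> t /=; rewrite in_itv /= andbT => st; rewrite lee_fin g0//.
  exact: lt_le_trans st.
- by rewrite lee_fin f0.
rewrite [RHS]integral_mkcond; apply: eq_integral => t _; rewrite patchE.
case: ifPn; rewrite (inE, notin_setE) /= in_itv /= andbT /k /= s0 /=.
  by move=> ->.
by move=> /negP/negPf ->.
Qed.

Lemma derivable_continuous_pt (f : R -> R) (x : R) : derivable f x 1 ->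
  f y @[y --> x] --> f x.
Proof. by move=> /derivable1_diffP/differentiable_continuous. Qed.

Lemma integral_expRN (s : R) :
  (\int[mu]_(t in `[s, +oo[) (expR (- t))%:E = (expR (- s))%:E)%E.
Proof.
have dF (x : R) : is_derive x 1 (fun t => - expR (- t)) (expR (- x)).
  by apply: is_derive_eq; rewrite mulrN1 opprK.
rewrite (@ge0_continuous_FTC2y R (fun t => expR (- t)) (fun t => - expR (- t)) s 0).
- by rewrite -EFinB sub0r opprK.
- by move=> x _; exact: expR_ge0.
- apply: continuous_subspaceT => x.
  by apply: continuous_comp; [exact: opp_continuous|exact: continuous_expR].
- by rewrite -oppr0; apply: cvgN; exact: cvgr_expR.
- by move=> x _; case: (dF x).
- apply: cvg_at_right_filter.
  by apply: derivable_continuous_pt; case: (dF s).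
- by move=> x _; rewrite derive1E; case: (dF x).
Qed.

Lemma continuous_powR_pt (x a : R) : 0 < a -> {for a, continuous (fun t : R => t `^ x)}.
Proof.
move=> a0; apply: derivable_continuous_pt.
by apply: derivable_powR; rewrite in_itv /= a0.
Qed.

Lemma integral_powR (x t : R) : 0 < x -> 0 < t ->
  (\int[mu]_(s in `]0%R, t]) (x * s `^ (x - 1))%:E = (t `^ x)%:E)%E.
Proof.
move=> x0 t0.
(* The integrand may be singular at 0, so the interval is exhausted by compact ones; [n + 2] keeps
   the left end strictly below t. *)
pose A (n : nat) := `[n.+2%:R^-1 * t, t]%classic.
have t1 n : 0 < n.+2%:R^-1 * t by rewrite mulr_gt0// invr_gt0 ltr0n.
have t2 n : n.+2%:R^-1 * t < t.
  by rewrite -[ltRHS]mul1r ltr_pM2r// invf_lt1 ?ltr0n// ltr1n.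
have AE n : (\int[mu]_(s in A n) (x * s `^ (x - 1))%:E =
    (t `^ x - (n.+2%:R^-1 * t) `^ x)%:E)%E.
  rewrite /A (@continuous_FTC2 _ _ (fun s => s `^ x) _ _ (t2 n))//.
  - apply: continuous_in_subspaceT => s; rewrite inE /= in_itv /= => /andP[s1 _].
    apply: cvgM; first exact: cvg_cst.
    by apply: continuous_powR_pt; exact: lt_le_trans s1.
  - split.
    + move=> s; rewrite in_itv /= => /andP[s1 _].
      by apply: derivable_powR; rewrite in_itv /= andbT (lt_trans (t1 n)).
    + by apply: cvg_at_right_filter; exact: continuous_powR_pt.
    + by apply: cvg_at_left_filter; exact: continuous_powR_pt.
  - move=> s; rewrite in_itv /= => /andP[s1 _].
    by rewrite powR_derive1// in_itv /= andbT (lt_trans (t1 n)).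
have UA : `]0, t]%classic = \bigcup_n A n.
  apply/seteqP; split => s /=; last first.
    move=> [n _]; rewrite /A /= !in_itv /= => /andP[s1 ->].
    by rewrite (lt_le_trans (t1 n)).
  rewrite in_itv /= => /andP[s0 st].
  have ts0 : 0 < t / s by rewrite divr_gt0.
  exists (Num.truncn (t / s)) => //; rewrite /A /= in_itv /= st andbT.
  rewrite ler_pdivrMl ?ltr0n// -ler_pdivrMr//.
  have := ltW (truncnS_gt (t / s)); move=> /le_trans; apply.
  by rewrite ler_nat.
have cv : (\int[mu]_(s in A n) (x * s `^ (x - 1))%:E)%E @[n --> \oo]
    --> (\int[mu]_(s in `]0%R, t]) (x * s `^ (x - 1))%:E)%E.
  rewrite UA; apply: ge0_nondecreasing_set_cvg_integral => //.
  - move=> m n mn; rewrite subsetEset /A => s /=; rewrite !in_itv /= => /andP[h ->].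
    rewrite andbT (le_trans _ h)// ler_pM2r// lef_pV2 ?posrE ?ltr0n// ler_nat.
    by rewrite !ltnS.
  - by move=> n; exact: measurable_itv.
  - move=> n; apply/measurable_EFinP/measurable_funTS/measurable_funM => //.
  - by move=> n s _; rewrite lee_fin mulr_ge0 ?powR_ge0// ltW.
rewrite (funext AE) in cv.
apply/esym; apply: (cvg_unique _ _ cv) => //.
apply: cvg_EFin; first by near=> n.
rewrite -[X in _ --> X]subr0; apply: cvgB; first exact: cvg_cst.
have -> : (fun n : nat => (n.+2%:R^-1 * t) `^ x) =
    (fun n : nat => (n.+2%:R^-1) `^ x * t `^ x).
  by apply/funext => n; rewrite powRM ?invr_ge0// ltW.
rewrite -[X in _ --> X](mul0r (t `^ x)); apply: cvgM; last exact: cvg_cst.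
have /cvg_at_rightP := powR_cvg0 x0; apply.
split=> [n|]; first by rewrite invr_gt0 ltr0n.
by have := @cvg_harmonic R; rewrite -cvg_shiftS.
Unshelve. all: by end_near. Qed.

Let GI (x : R) : \bar R :=
  (\int[mu]_(t in `]0%R, +oo[) ((t `^ (x - 1)) * expR (- t))%:E)%E.

Let mexp : measurable_fun setT (fun t : R => expR (- t)).
Proof. exact: measurableT_comp. Qed.

Let mGI x : measurable_fun setT (fun t : R => t `^ x * expR (- t)).
Proof. by apply: measurable_funM => //; exact: measurable_powR. Qed.

Let mGIE x (D : set R) : measurable_fun D (fun t : R => (t `^ x * expR (- t))%:E).
Proof. by apply/measurable_EFinP; apply: measurable_funTS; exact: mGI. Qed.

Let GI_ge0 x : (0 <= GI x)%E.
Proof. by apply: integral_ge0 => t _; rewrite lee_fin mulr_ge0 ?powR_ge0 ?expR_ge0. Qed.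

(** Stated in the extended reals, so that finiteness can be deduced from it. *)
Let GI_rec x : 0 < x -> GI (x + 1) = (x%:E * GI x)%E.
Proof.
move=> x0; rewrite /GI.
under eq_integral => t _ do rewrite addrK.
rewrite (ge0_tonelli_by_parts (f := fun s => x * s `^ (x - 1))
   (F := fun s => s `^ x) (g := fun t => expR (- t)) (G := fun t => expR (- t))) //.
- rewrite -ge0_integralZl//.
  + by apply: eq_integral => t _; rewrite -EFinM mulrA.
  + exact: mGIE.
  + by move=> t _; rewrite lee_fin mulr_ge0 ?powR_ge0 ?expR_ge0.
  + by rewrite lee_fin ltW.
- by apply: measurable_funM => //; exact: measurable_powR.
- by move=> s s0; rewrite mulr_ge0 ?powR_ge0// ltW.
- by move=> t t0; exact: integral_powR.
- by move=> s _; exact: integral_expRN.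
Qed.

Let GI1 : GI 1 = 1%E.
Proof.
rewrite /GI.
under eq_integral => t _ do rewrite subrr powRr0 mul1r.
rewrite integral_itv_obnd_cbnd; last exact/measurable_EFinP/measurable_funTS.
by rewrite integral_expRN oppr0 expR0.
Qed.

(** Positive integers come from the recurrence, reals [y >= 1] from [t^(y-1) <= 1 + t^(n+1)] with n
    the integer part of y, and the remaining [x > 0] from the value at [x + 1]. *)
Let GI_fin x : 0 < x -> GI x \is a fin_num.
Proof.
have GIn n : GI n.+1%:R \is a fin_num.
  elim: n => [|n IH]; first by rewrite GI1.
  by rewrite -natr1 GI_rec ?ltr0n// fin_numM.
have G1 y : 1 <= y -> GI y \is a fin_num.
  move=> y1; rewrite ge0_fin_numE ?GI_ge0//.
  set n := Num.truncn y.
  apply: (@le_lt_trans _ _ (GI 1 + GI n.+2%:R)%E); last first.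
    by rewrite lte_add_pinfty// ltey_eq ?GI1// GIn.
  rewrite /GI -ge0_integralD//; last 4 first.
  - by move=> t _; rewrite lee_fin mulr_ge0 ?powR_ge0 ?expR_ge0.
  - exact: mGIE.
  - by move=> t _; rewrite lee_fin mulr_ge0 ?powR_ge0 ?expR_ge0.
  - exact: mGIE.
  apply: ge0_le_integral => //.
  - by move=> t _; rewrite lee_fin mulr_ge0 ?powR_ge0 ?expR_ge0.
  - exact: mGIE.
  - apply/measurable_funTS; apply: emeasurable_funD; exact: mGIE.
  move=> t; rewrite /= in_itv /= andbT => t0.
  rewrite -EFinD lee_fin -mulrDl ler_wpM2r ?expR_ge0// subrr powRr0.
  have [t1|t1] := leP t 1.
    rewrite ler_wpDr ?powR_ge0// -[leRHS](powRr0 t).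
    by apply: ger_powR; rewrite ?t0 ?t1// subr_ge0.
  rewrite ler_wpDl//; apply: ler_powR; first exact: ltW.
  by rewrite -(natr1 n.+1) addrK; have := truncnS_gt y; lra.
move=> x0; have := G1 (x + 1); rewrite GI_rec//.
have -> // : 1 <= x + 1 by lra.
move=> /(_ isT); have := GI_ge0 x; case: (GI x) => [r _ _||]//= _.
by rewrite gt0_muley ?lte_fin.
Qed.

Let GI_gt0 x : 0 < x -> (0 < GI x)%E.
Proof.
move=> x0.
(* On [1, 2], of length 1, [t^(x-1) >= 1/t >= 1/2] and [exp(-t) >= exp(-2)]. *)
have h : (0 < (2^-1 * expR (- 2))%:E :> \bar R)%E.
  by rewrite lte_fin mulr_gt0 ?expR_gt0.
apply: (lt_le_trans h).
apply: (@le_trans _ _ (\int[mu]_(t in `[1%R, 2%R]) ((t `^ (x - 1)) * expR (- t))%:E)%E).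
  rewrite -[leLHS]mule1.
  have <- : mu `[1%R, 2%R]%classic = 1%E.
    by rewrite lebesgue_measure_itv/= lte_fin ltr1n -EFinD; congr (_%:E); ring.
  rewrite -integral_cst//.
  apply: ge0_le_integral => //.
  - by move=> t _; rewrite lee_fin mulr_ge0 ?expR_ge0.
  - exact: mGIE.
  move=> t; rewrite /= in_itv /= => /andP[t1 t2].
  have t0 : 0 < t by lra.
  rewrite lee_fin ler_pM ?expR_ge0//.
    apply: (@le_trans _ _ (t `^ (-1))); last by apply: ler_powR => //; lra.
    by rewrite powR_inv1 ?lef_pV2 ?posrE// ltW.
  by rewrite ler_expR lerN2.
apply: ge0_subset_integral => //.
- exact: mGIE.
- by move=> t _; rewrite lee_fin mulr_ge0 ?powR_ge0 ?expR_ge0.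
- by move=> t; rewrite /= !in_itv /= andbT => /andP[t1 _]; rewrite (lt_le_trans _ t1).
Qed.

Lemma GammaS (x : R) : 0 < x -> Gamma (x + 1) = x * Gamma x.
Proof. by move=> x0; rewrite /Gamma -/(GI _) GI_rec// fineM// GI_fin. Qed.

Lemma Gamma_gt0 (x : R) : 0 < x -> 0 < Gamma x.
Proof.
move=> x0; rewrite /Gamma -/(GI x); apply: fine_gt0.
by rewrite GI_gt0// ltey_eq GI_fin.
Qed.

End by_parts.

(** * Moments and convolution of normal laws *)

Section normal_moments.
Variable R : realType.
Notation mu := (@lebesgue_measure R).
Notation pdf := (@normal_pdf R 0).

Lemma integral_normal_prob (m s : R) (f : R -> \bar R) :
  measurable_fun setT f -> (forall x, 0 <= f x)%E ->
  (\int[normal_prob m s]_x f x = \int[mu]_x ((normal_pdf m s x)%:E * f x))%E.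
Proof.
move=> mf f0.
apply: (integral_change_of_density (kappa := mu) (nu := normal_prob m s) (Z := id)) => //.
- exact: measurable_normal_pdf.
- exact: normal_pdf_ge0.
move=> A mA; rewrite /normal_prob [LHS]integral_mkcond; apply: eq_integral => x _.
by rewrite patchE indicE; case: ifPn => _; rewrite ?mulr1 ?mulr0.
Qed.

Lemma normal_pdf0E (s x : R) : s != 0 ->
  pdf s x = normal_peak s * expR (- (x ^+ 2 / (s ^+ 2 *+ 2))).
Proof. by move=> s0; rewrite normal_pdfE// /normal_fun subr0 mulNr. Qed.

Lemma normal_pdfN (s x : R) : s != 0 -> pdf s (- x) = pdf s x.
Proof. by move=> s0; rewrite !normal_pdf0E// sqrrN. Qed.

Lemma ge0_integral_oppr (f : R -> \bar R) :
  measurable_fun setT f -> (forall x, 0 <= f x)%E ->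
  (\int[mu]_x f (- x)%R = \int[mu]_x f x)%E.
Proof.
move=> mf f0.
rewrite [RHS](eq_measure_integral (pushforward mu (-%R : R -> measurableTypeR R))).
  by rewrite ge0_integral_pushforward.
by move=> A mA _; apply: esym; exact: lebesgue_measureN.
Qed.

Section fixed_variance.
Variable s : R.
Hypothesis s_gt0 : 0 < s.
Notation N := (normal_prob 0 s).

Let s0 : s != 0. Proof. exact: lt0r_neq0. Qed.

Let mpdf : measurable_fun setT (pdf s). Proof. exact: measurable_normal_pdf. Qed.

Lemma integral_normal_sym (f : R -> \bar R) :
  measurable_fun setT f -> (forall x, 0 <= f x)%E ->
  (\int[N]_x f (- x)%R = \int[N]_x f x)%E.
Proof.
move=> mf f0; rewrite !integral_normal_prob//; last exact: measurableT_comp.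
have mg : measurable_fun setT (fun x => ((pdf s x)%:E * f x)%E).
  by apply: emeasurable_funM => //; exact/measurable_EFinP.
have g0 x : (0 <= (pdf s x)%:E * f x)%E by rewrite mule_ge0// lee_fin normal_pdf_ge0.
apply: (eq_trans _ (ge0_integral_oppr mg g0)).
by apply: eq_integral => x _; rewrite normal_pdfN.
Qed.

Lemma is_derive_normal_pdf (x : R) : is_derive x 1 (pdf s) (- (x / s ^+ 2) * pdf s x).
Proof.
have -> : pdf s = fun x => normal_peak s * expR (- (x ^+ 2 / (s ^+ 2 *+ 2))).
  by apply/funext => y; rewrite normal_pdf0E.
apply: is_derive_eq.
rewrite /GRing.scale /=.
by field.
Qed.

Lemma normal_pdf_cvg0 : pdf s x @[x --> +oo] --> (0 : R).
Proof.
apply: (squeeze_cvgr (f := fun=> 0) (h := fun x => normal_peak s * expR (- x))).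
- near=> x.
  have x1 : s ^+ 2 *+ 2 <= x by near: x; apply: nbhs_pinfty_ge; exact: num_real.
  rewrite normal_pdf0E// mulr_ge0 ?normal_peak_ge0 ?expR_ge0//=.
  rewrite ler_wpM2l ?normal_peak_ge0// ler_expR lerN2.
  have s2 : 0 < s ^+ 2 *+ 2 by rewrite pmulrn_lgt0// exprn_gt0.
  have x0 : 0 <= x by apply: le_trans x1; exact: ltW.
  by rewrite ler_pdivlMr// expr2 ler_wpM2l.
- exact: cvg_cst.
- rewrite -[X in _ --> X](mulr0 (normal_peak s)); apply: cvgM; first exact: cvg_cst.
  exact: cvgr_expR.
Unshelve. all: by end_near. Qed.

Lemma integral_tail_normal (a : R) : 0 <= a ->
  (\int[mu]_(x in `[a, +oo[) (x * pdf s x)%:E = (s ^+ 2 * pdf s a)%:E)%E.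
Proof.
move=> a0.
have dF (x : R) : is_derive x 1 (fun x => - (s ^+ 2 * pdf s x)) (x * pdf s x).
  have := is_derive_normal_pdf x => dp.
  apply: is_derive_eq; rewrite /GRing.scale /=; field.
  by [].
rewrite (@ge0_continuous_FTC2y R (fun x => x * pdf s x) (fun x => - (s ^+ 2 * pdf s x)) a 0).
- by rewrite -EFinB sub0r opprK.
- by move=> x ax; rewrite mulr_ge0 ?normal_pdf_ge0// (le_trans a0).
- apply: continuous_subspaceT => x; apply: cvgM; first exact: cvg_id.
  exact: continuous_normal_pdf.
- rewrite [X in _ --> X](_ : 0 = - (s ^+ 2 * 0)); last by rewrite mulr0 oppr0.
  apply: cvgN; apply: cvgM; first exact: cvg_cst.
  exact: normal_pdf_cvg0.
- by move=> x _; case: (dF x).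
- apply: cvg_at_right_filter.
  by apply: derivable_continuous_pt; case: (dF a).
- by move=> x _; rewrite derive1E; case: (dF x).
Qed.

Let int_half_id (t : R) : 0 < t -> (\int[mu]_(x in `]0%R, t]) 1%:E = t%:E)%E.
Proof.
move=> t0; rewrite integral_cst//= lebesgue_measure_itv/= lte_fin t0.
by rewrite oppr0 adde0 mul1e.
Qed.

Let int_half_sqr (t : R) : 0 < t -> (\int[mu]_(x in `]0%R, t]) (2 * x)%:E = (t ^+ 2)%:E)%E.
Proof.
move=> t0; rewrite -(powR_mulrn 2 (ltW t0)) -(integral_powR (x := 2) (t := t))//.
apply: eq_integral => x; rewrite inE /= in_itv /= => /andP[x0 _].
have -> : (2 : R) - 1 = 1 by ring.
by rewrite powRr1// ltW.
Qed.

Let half_line (f : R -> R) : (forall x, 0 <= f x) -> continuous f -> f =1 f \o -%R ->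
  (\int[N]_x (f x)%:E = 2%:E * \int[mu]_(x in `]0%R, +oo[) (f x * pdf s x)%:E)%E.
Proof.
move=> f0 cf ef; rewrite integral_normal_prob//; last first.
  by apply/measurable_EFinP; exact: continuous_measurable_fun.
transitivity (\int[mu]_x (f x * pdf s x)%:E)%E.
  by apply: eq_integral => x _; rewrite mulrC.
have cfp : continuous (fun x => f x * pdf s x).
  by move=> x; apply: cvgM; [exact: cf|exact: continuous_normal_pdf].
rewrite (@ge0_symfun_integralT R (fun x => f x * pdf s x))//; last 2 first.
- by move=> x; rewrite mulr_ge0 ?normal_pdf_ge0.
- by move=> x; rewrite /= normal_pdfN// {1}ef.
rewrite -set_itvcy -integral_itv_obnd_cbnd//.
by apply/measurable_EFinP/measurable_funTS; exact: continuous_measurable_fun.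
Qed.

Let mxpdf : measurable_fun setT (fun x : R => x * pdf s x).
Proof. exact: measurable_funM. Qed.

(** Integrate by parts, with [x] as the primitive of 1 and [s^2 * pdf] as the tail integral of
    [x * pdf]: what remains is [s^2] times the total mass. *)
Lemma normal_second_moment : (\int[N]_x (x ^+ 2)%:E = (s ^+ 2)%:E)%E.
Proof.
have P1 : (\int[N]_x 1%:E = 1)%E by rewrite integral_cst// mul1e [LHS](probability_setT (normal_prob 0 s)).
rewrite half_line; [|by move=> x; exact: sqr_ge0|exact: sqr_continuous|by move=> x; rewrite /= sqrrN].
under eq_integral => x _ do rewrite expr2 -mulrA.
have -> : (\int[mu]_(x in `]0%R, +oo[) (x * (x * pdf s x))%:E =
    \int[mu]_(x in `]0%R, +oo[) (1 * (s ^+ 2 * pdf s x))%:E)%E.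
  apply: (ge0_tonelli_by_parts (f := fun=> 1) (F := id)
    (g := fun x => x * pdf s x)) => [||x x0|x x0|t t0|x x0] //.
  - by rewrite mulr_ge0 ?normal_pdf_ge0// ltW.
  - exact: int_half_id.
  - by rewrite integral_tail_normal// ltW.
under eq_integral => x _ do rewrite mul1r EFinM.
rewrite ge0_integralZl//; last 3 first.
- exact/measurable_EFinP/measurable_funTS.
- by move=> x _; rewrite lee_fin normal_pdf_ge0.
- by rewrite lee_fin sqr_ge0.
rewrite muleCA -[RHS]mule1 -P1 (half_line (f := fun=> 1))//; last first.
  by move=> x; exact: cvg_cst.
by congr (_ * (_ * _))%E; apply: eq_integral => x _; rewrite mul1r.
Qed.

(** The exact value is [4 s^3 / sqrt (2 pi)], obtained by parts; the root is then bounded below by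
    1. *)
Lemma normal_third_moment : (\int[N]_x (`|x| ^+ 3)%:E <= (4 * s ^+ 3)%:E)%E.
Proof.
rewrite half_line; last 3 first.
- by move=> x; rewrite exprn_ge0.
- move=> x; apply: (continuous_comp (f := fun x : R => `|x|) (g := fun x => x ^+ 3)).
    exact: norm_continuous.
  exact: exprn_continuous.
- by move=> x; rewrite /= normrN.
have -> : (\int[mu]_(x in `]0%R, +oo[) (`|x| ^+ 3 * pdf s x)%:E =
    \int[mu]_(x in `]0%R, +oo[) (x ^+ 2 * (x * pdf s x))%:E)%E.
  apply: eq_integral => x; rewrite inE /= in_itv /= andbT => x0.
  by rewrite gtr0_norm//; congr (_%:E); ring.
have -> : (\int[mu]_(x in `]0%R, +oo[) (x ^+ 2 * (x * pdf s x))%:E =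
    \int[mu]_(x in `]0%R, +oo[) (2 * x * (s ^+ 2 * pdf s x))%:E)%E.
  apply: (ge0_tonelli_by_parts (f := fun x => 2 * x) (F := fun x => x ^+ 2)
    (g := fun x => x * pdf s x)) => [||x x0|x x0|t t0|x x0] //.
  - exact: measurable_funM.
  - by rewrite mulr_ge0// ltW.
  - by rewrite mulr_ge0 ?normal_pdf_ge0// ltW.
  - by rewrite int_half_sqr.
  - by rewrite integral_tail_normal// ltW.
have -> : (\int[mu]_(x in `]0%R, +oo[) (2 * x * (s ^+ 2 * pdf s x))%:E =
    \int[mu]_(x in `]0%R, +oo[) ((2 * s ^+ 2)%:E * (x * pdf s x)%:E))%E.
  by apply: eq_integral => x _; rewrite -EFinM; congr (_%:E); ring.
rewrite ge0_integralZl//; last 3 first.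
- exact/measurable_EFinP/measurable_funTS.
- move=> x /=; rewrite in_itv /= andbT => x0.
  by rewrite lee_fin mulr_ge0 ?normal_pdf_ge0// ltW.
- by rewrite lee_fin mulr_ge0// sqr_ge0.
rewrite integral_itv_obnd_cbnd; last exact/measurable_EFinP/measurable_funTS.
rewrite integral_tail_normal// -!EFinM lee_fin.
rewrite normal_pdf0E// expr0n /= mul0r oppr0 expR0 mulr1.
have -> : 4 * s ^+ 3 = 2 * (2 * s ^+ 2 * (s ^+ 2 * s^-1)) by field.
apply: ler_wpM2l => //; apply: ler_wpM2l; first by rewrite mulr_ge0// sqr_ge0.
apply: ler_wpM2l; first exact: sqr_ge0.
rewrite /normal_peak lef_pV2 ?posrE// ?sqrtr_gt0; last first.
  by rewrite pmulrn_lgt0// mulr_gt0 ?pi_gt0// exprn_gt0.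
rewrite -{1}(gtr0_norm s_gt0) -sqrtr_sqr ler_wsqrtr//.
rewrite -mulrnAr ler_peMr ?sqr_ge0//.
by have := pi_ge2 R; rewrite mulr2n; lra.
Qed.

Lemma normal_integrable n : (n <= 3)%N -> N.-integrable setT (fun x => (x ^+ n)%:E).
Proof.
move=> n3.
have mXn k : measurable_fun setT (fun x : R => x ^+ k) by exact: measurable_funX.
have i3 : N.-integrable setT (fun x => (`|x| ^+ 3)%:E).
  apply/integrableP; split.
    by apply/measurable_EFinP; apply: measurable_funX; exact: normr_measurable.
  apply: (@le_lt_trans _ _ (\int[N]_x (`|x| ^+ 3)%:E)%E).
    rewrite le_eqVlt; apply/orP; left; apply/eqP; apply: eq_integral => x _.
    by rewrite /= ger0_norm// exprn_ge0.
  by apply: (le_lt_trans normal_third_moment); rewrite ltry.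
have i1 : N.-integrable setT (fun=> 1%:E).
  exact: (@bmeas_integrable _ _ R (normal_prob 0 s) (fun=> 1) (bmeas_cst _ _)).
apply: (le_integrable measurableT _ _ (integrableD measurableT i1 i3)).
  exact/measurable_EFinP.
move=> x _; rewrite /= lee_fin normrX.
rewrite [leRHS]ger0_norm; last by rewrite addr_ge0// exprn_ge0.
have [x1|x1] := leP `|x| 1.
  by rewrite ler_wpDr ?exprn_ge0// exprn_ile1.
by rewrite ler_wpDl// ler_weXn2l// ltW.
Qed.

Lemma normal_mean : (\int[N]_x x = 0)%R.
Proof.
have i1 : N.-integrable setT (EFin \o id) by exact: (normal_integrable (n := 1)).
rewrite /Rintegral integralE.
have mp : measurable_fun setT ((EFin \o (@id R))^\+)%E.
  by apply: measurable_funepos; exact/measurable_EFinP.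
have p0 x : (0 <= ((EFin \o (@id R))^\+ x))%E by exact: funepos_ge0.
have -> : (\int[N]_x (fun x => (x)%:E)^\- x = \int[N]_x (EFin \o (@id R))^\+ x)%E.
  apply: (eq_trans _ (integral_normal_sym mp p0)).
  by apply: eq_integral => x _; rewrite funenegE funeposE.
apply: (congr1 fine (subee _)).
exact: (integrable_fin_num measurableT (integrable_funepos measurableT i1)).
Qed.

End fixed_variance.

Lemma gauss_exponent (S T y z : R) : S != 0 -> T != 0 -> S + T != 0 ->
  - (y ^+ 2 / (S *+ 2)) + - ((z - y) ^+ 2 / (T *+ 2)) =
  - (z ^+ 2 / ((S + T) *+ 2)) +
  - (y - S * z / (S + T)) ^+ 2 / ((S * T / (S + T)) *+ 2).
Proof. by move=> S0 T0 ST0; field; rewrite S0 T0 ST0. Qed.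

(* The product of the densities of N(0,s^2) at y and N(0,t^2) at z - y, with
   r^2 = s^2 + t^2, by completing the square in y. *)
Lemma normal_pdf_mul (s t r y z : R) : 0 < s -> 0 < t -> 0 < r ->
  r ^+ 2 = s ^+ 2 + t ^+ 2 ->
  pdf s y * pdf t (z - y) =
  pdf r z * normal_pdf (s ^+ 2 * z / r ^+ 2) (s * t / r) y.
Proof.
move=> s0 t0 r0 rE.
have sn := lt0r_neq0 s0; have tn := lt0r_neq0 t0; have rn := lt0r_neq0 r0.
have wn : s * t / r != 0 by rewrite !mulf_neq0// invr_eq0.
rewrite !normal_pdf0E// normal_pdfE// /normal_fun.
rewrite mulrACA [RHS]mulrACA; congr (_ * _).
  have pge (a : R) : 0 <= a ^+ 2 * pi *+ 2.
    by rewrite mulrn_wge0// mulr_ge0 ?sqr_ge0 ?pi_ge0.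
  rewrite /normal_peak -[LHS]invfM -[RHS]invfM -(sqrtrM _ (pge s)) -(sqrtrM _ (pge r)).
  congr (_^-1); congr Num.sqrt.
  by move: (pi : R) => p; field.
rewrite -!expRD; congr expR.
have -> : (s * t / r) ^+ 2 = s ^+ 2 * t ^+ 2 / (s ^+ 2 + t ^+ 2).
  by rewrite -rE !exprMn exprVn.
rewrite rE; apply: gauss_exponent; rewrite ?gt_eqF ?exprn_gt0//.
by rewrite addr_gt0// exprn_gt0.
Qed.

(** After a translation and Tonelli, [normal_pdf_mul] makes the integral in y that of a normal
    density, equal to 1. *)
Lemma normal_convolution (s t r : R) (h : R -> \bar R) : 0 < s -> 0 < t -> 0 < r ->
  r ^+ 2 = s ^+ 2 + t ^+ 2 ->
  measurable_fun setT h -> (forall x, 0 <= h x)%E ->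
  (\int[normal_prob 0 s]_y \int[normal_prob 0 t]_z h (y + z)%R =
   \int[normal_prob 0 r]_z h z)%E.
Proof.
move=> s0 t0 r0 rE mh h0.
pose K (x : R * R) : \bar R := ((pdf s x.1 * pdf t (x.2 - x.1))%:E * h x.2)%E.
have mK : measurable_fun setT K.
  apply: emeasurable_funM; last exact: measurableT_comp.
  apply/measurable_EFinP; apply: measurable_funM.
    by apply: measurableT_comp; [exact: measurable_normal_pdf|].
  apply: measurableT_comp; first exact: measurable_normal_pdf.
  exact: measurable_funB.
have K0 x : (0 <= K x)%E.
  by rewrite mule_ge0// lee_fin mulr_ge0// normal_pdf_ge0.
have mhy (y : R) : measurable_fun setT (fun z : R => h (y + z)).
  by apply: measurableT_comp => //; exact: measurable_funD.
have E1 (y : R) : (\int[normal_prob 0 t]_z h (y + z)%R =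
    \int[mu]_z ((pdf t (z - y))%:E * h z))%E.
  apply: (eq_trans (integral_normal_prob 0 t (mhy y) (fun z => h0 (y + z)))).
  have mg : measurable_fun setT (fun z : R => ((pdf t (z - y))%:E * h z)%E).
    apply: emeasurable_funM => //; apply/measurable_EFinP.
    by apply: measurableT_comp; [exact: measurable_normal_pdf|exact: measurable_funB].
  have g0 z : (0 <= (pdf t (z - y))%:E * h z)%E.
    by rewrite mule_ge0// lee_fin normal_pdf_ge0.
  apply: (eq_trans _ (ge0_integral_translation y mg g0)).
  by apply: eq_integral => z _; rewrite addrK addrC.
have mzy (y : R) : measurable_fun setT (fun z : R => ((pdf t (z - y))%:E * h z)%E).
  apply: emeasurable_funM => //; apply/measurable_EFinP.
  by apply: measurableT_comp; [exact: measurable_normal_pdf|exact: measurable_funB].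
rewrite integral_normal_prob; last 2 first.
- under eq_fun do rewrite E1.
  pose K2 (x : R * R) : \bar R := ((pdf t (x.2 - x.1))%:E * h x.2)%E.
  apply: (measurable_fun_fubini_tonelli_F (m2 := mu) K2).
    apply: emeasurable_funM; last exact: measurableT_comp.
    apply/measurable_EFinP; apply: measurableT_comp; first exact: measurable_normal_pdf.
    exact: measurable_funB.
  by move=> x; rewrite mule_ge0// lee_fin normal_pdf_ge0.
- by move=> y; apply: integral_ge0.
transitivity (\int[mu]_y \int[mu]_z K (y, z))%E.
  apply: eq_integral => y _; rewrite E1.
  have g0 z : (0 <= (pdf t (z - y))%:E * h z)%E.
    by rewrite mule_ge0// lee_fin normal_pdf_ge0.
  have p0 : (0 <= (pdf s y)%:E)%E by rewrite lee_fin normal_pdf_ge0.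
  rewrite -ge0_integralZl//; last exact: mzy.
  by apply: eq_integral => z _; rewrite /K /= muleA -EFinM.
apply: (eq_trans (fubini_tonelli (m1 := mu) (m2 := mu) K mK K0)).
rewrite integral_normal_prob//; apply: eq_integral => z _.
transitivity (\int[mu]_y ((pdf r z)%:E * h z *
   (normal_pdf (s ^+ 2 * z / r ^+ 2) (s * t / r) y)%:E))%E.
  apply: eq_integral => y _; rewrite /K /= (normal_pdf_mul _ _ s0 t0 r0 rE) EFinM.
  by rewrite -muleA [(_%:E * h z)%E]muleC muleA.
rewrite ge0_integralZl//.
- by rewrite integral_normal_pdf mule1.
- by apply/measurable_EFinP; exact: measurable_normal_pdf.
- by move=> y _; rewrite lee_fin normal_pdf_ge0.
- by rewrite mule_ge0// lee_fin normal_pdf_ge0.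
Qed.

End normal_moments.

(** * Generating function and variance *)

Section generating_function.
Variables (R : realType) (lam x : R).
Let q (t : R) : R := 1 - 2 * x * t + t ^+ 2.
Let g n : R -> R := derive1n n (gegen_gf lam x).

Let dq (t : R) : is_derive t 1 q (- (2 * (x - t))).
Proof. by apply: is_derive_eq; rewrite /GRing.scale /=; ring. Qed.

Let near_q t : 0 < q t -> \forall u \near t, 0 < q u.
Proof.
move=> qt; have : q u @[u --> t] --> q t by apply: derivable_continuous_pt; case: (dq t).
by move=> /cvgr_gt; apply.
Qed.

Let gS n t : derivable (g n) t 1 -> is_derive t 1 (g n) (g n.+1 t).
Proof. by move=> dg; split; [exact: dg|rewrite /g derive1nS derive1E]. Qed.

Let is_derive_near (f h : R -> R) t (df : R) : (\forall u \near t, f u = h u) ->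
  is_derive t 1 h df -> is_derive t 1 f df.
Proof.
move=> fh [dh hE]; split.
  by apply: near_eq_derivable dh; near=> u; apply: esym; near: u.
by rewrite -hE; apply: near_eq_derive.
Unshelve. all: by end_near. Qed.

(* q f' = 2 lam (x - t) f, differentiated n times. *)
Let g_rec n : (forall t, 0 < q t -> is_derive t 1 (g n) (g n.+1 t)) /\
  (forall t, 0 < q t -> q t * g n.+1 t =
     2 * (lam + n%:R) * (x - t) * g n t - n%:R * (n%:R - 1 + 2 * lam) * g n.-1 t).
Proof.
(* Derivability is proved along with the recurrence, since the derivative of a non-derivable
   function is a mere default value. Order [n.-1] is kept because differentiating the recurrence
   meets it. *)
suff: ((forall t, 0 < q t -> is_derive t 1 (g n.-1) (g n.-1.+1 t)) /\
  (forall t, 0 < q t -> is_derive t 1 (g n) (g n.+1 t))) /\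
  (forall t, 0 < q t -> q t * g n.+1 t =
     2 * (lam + n%:R) * (x - t) * g n t - n%:R * (n%:R - 1 + 2 * lam) * g n.-1 t).
  by move=> [[_ ? ?]].
elim: n => [|n [[H' H] Rn]].
  have d0 t : 0 < q t -> is_derive t 1 (g 0) (2 * lam * (x - t) * g 0 t / q t).
    move=> qt; have dqt := dq t; have dp := is_derive1_powR (- lam) qt.
    have := @is_derive1_comp R (fun y => y `^ (- lam)) q t _ _ dp dqt => dc.
    apply: (is_derive_eq dc).
    rewrite /g /= /gegen_gf -/(q t) powRD; last by rewrite (gt_eqF qt) implybT.
    by rewrite powR_inv1 ?ltW//; field; rewrite gt_eqF.
  have d1 t : 0 < q t -> is_derive t 1 (g 0) (g 1%N t).
    by move=> qt; apply: gS; case: (d0 t qt).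
  split=> // t qt; have [_ E1] := d0 t qt; have [_ E2] := d1 t qt.
  rewrite -E2 E1 addr0; field.
  by rewrite gt_eqF.
pose r u := 2 * (lam + n%:R) * (x - u) * g n u - n%:R * (n%:R - 1 + 2 * lam) * g n.-1 u.
have dr t : 0 < q t -> is_derive t 1 r (- (2 * (lam + n%:R)) * g n t
    + 2 * (lam + n%:R) * (x - t) * g n.+1 t - n%:R * (n%:R - 1 + 2 * lam) * g n t).
  move=> qt; have Hn := H t qt; have Hn' := H' t qt.
  apply: is_derive_eq; rewrite /GRing.scale /=.
  by case: (n) => [|m] /=; ring.
have rq t : 0 < q t -> g n.+1 t = r t / q t.
  by move=> qt; rewrite /r -(Rn t qt); field; rewrite gt_eqF.
(* Near t the recurrence writes [g n.+1] as the quotient [r / q], hence the next derivative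
   exists. *)
have HS t : 0 < q t -> is_derive t 1 (g n.+1) (g n.+2 t).
  move=> qt; apply: gS.
  have dqt := dq t; have drt := dr t qt.
  apply: (@near_eq_derivable _ _ _ (fun u => r u * (q u)^-1)).
  - by near=> u; apply: esym; apply: rq; near: u; exact: near_q.
  - apply: derivableM; first by case: drt.
    by apply: derivableV; [rewrite gt_eqF|case: dqt].
split=> // t qt.
have dqt := dq t; have H1 := HS t qt.
have dl : is_derive t 1 (fun u => q u * g n.+1 u)
    (q t * g n.+2 t + g n.+1 t * - (2 * (x - t))).
  by apply: is_derive_eq; rewrite /GRing.scale /=.
have nr : \forall u \near t, q u * g n.+1 u = r u.
  by near=> u; apply: Rn; near: u; exact: near_q.
have dl' := is_derive_near nr (dr t qt).
have [_ E1] := dl; have [_ E2] := dl'.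
have E : q t * g n.+2 t + g n.+1 t * - (2 * (x - t)) =
  - (2 * (lam + n%:R)) * g n t + 2 * (lam + n%:R) * (x - t) * g n.+1 t -
      n%:R * (n%:R - 1 + 2 * lam) * g n t by rewrite -E1 E2.
rewrite [n.+1.-1]/=.
transitivity (q t * g n.+2 t + g n.+1 t * - (2 * (x - t)) + g n.+1 t * (2 * (x - t))); first by ring.
by rewrite E; ring.
Unshelve. all: by end_near. Qed.

Definition gegen_coef n : R := g n 0 / n`!%:R.

Lemma gegen_coef0 : gegen_coef 0 = 1.
Proof.
by rewrite /gegen_coef /g /= /gegen_gf mulr0 subr0 expr0n addr0 powR1 fact0 divr1.
Qed.

Lemma gegen_coef_rec n : n.+1%:R * gegen_coef n.+1 =
  2 * (lam + n%:R) * x * gegen_coef n -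
  (if n is m.+1 then (m%:R + 2 * lam) * gegen_coef m else 0).
Proof.
have q0 : q 0 = 1 by rewrite /q mulr0 subr0 expr0n addr0.
have f0 j : j`!%:R != 0 :> R by rewrite pnatr_eq0 -lt0n fact_gt0.
have [_ /(_ 0)] := g_rec n; rewrite q0 subr0 => /(_ ltr01); rewrite mul1r => E.
rewrite /gegen_coef E factS natrM.
case: n E => [|m] E.
  by rewrite fact0 mul0r mul0r; field.
rewrite ?factS ?natrM; field.
by rewrite f0 nat1r -natrD !pnatr_eq0.
Qed.

Hypothesis lam_gt0 : 0 < lam.

Lemma gegen_coefE k : gegen_coef k = geg1 lam k * (ngeg lam k).[x].
Proof.
suff: gegen_coef k = geg1 lam k * (ngeg lam k).[x] /\
  gegen_coef k.+1 = geg1 lam k.+1 * (ngeg lam k.+1).[x] by case.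
have g0 : geg1 lam 0 = 1 by rewrite /geg1 poch0 fact0 divr1.
elim: k => [|k [IH1 IH2]].
  have := gegen_coef_rec 0; rewrite subr0 gegen_coef0 mul1r addr0 mulr1 => E1.
  split; first by rewrite g0 ngeg0 hornerC mulr1.
  have := geg1S lam 0; rewrite g0 mul1r add0r mulr1 => ->.
  by rewrite E1 ngeg1 hornerX.
split=> //.
have k0 : k.+2%:R != 0 :> R by rewrite pnatr_eq0.
apply: (mulfI k0); rewrite gegen_coef_rec IH1 IH2 [RHS]mulrA geg1S.
have := congr1 (fun p => p.[x]) (ngeg_rec (ltW lam_gt0) k.+1).
rewrite !(hornerM, hornerC, hornerX, hornerD, hornerN) /= => E.
transitivity (geg1 lam k.+1 * ((k.+1%:R + 2 * lam) * (ngeg lam k.+2).[x])); last by ring.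
rewrite E mulrBr; congr (_ - _); first by ring.
transitivity ((k.+1%:R * geg1 lam k.+1) * (ngeg lam k).[x]); last by ring.
by rewrite geg1S mulrA.
Qed.

End generating_function.

(** * Values and moments of Gegenbauer polynomials *)

Section gegenbauer_values.
Variable R : realType.
Implicit Types (d k : nat) (x : R).

Lemma cos_acos_rec x k : -1 <= x <= 1 ->
  cos (k.+2%:R * acos x) = 2 * x * cos (k.+1%:R * acos x) - cos (k%:R * acos x).
Proof.
move=> x1; set t := acos x; have ct : cos t = x by rewrite /t acosK// in_itv.
have -> : k.+2%:R * t = k.+1%:R * t + t by rewrite -natr1 mulrDl mul1r.
have -> : k%:R * t = k.+1%:R * t - t by rewrite -(natr1 k) mulrDl mul1r addrK.
rewrite cosD cosB ct; ring.
Qed.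

Lemma ngeg0_cos x k : -1 <= x <= 1 -> (ngeg 0 k).[x] = cos (k%:R * acos x).
Proof.
move=> x1.
suff: (ngeg 0 k).[x] = cos (k%:R * acos x) /\
  (ngeg 0 k.+1).[x] = cos (k.+1%:R * acos x) by case.
elim: k => [|k [IH1 IH2]].
  by rewrite ngeg0 ngeg1 hornerC hornerX mul0r cos0 mul1r acosK// in_itv.
split=> //; rewrite cos_acos_rec// -IH1 -IH2 ngeg_cheb//.
by rewrite !(hornerM, hornerC, hornerX, hornerD, hornerN).
Qed.

(** For [lam > 0] the cosine expansion of [C_k] has non-negative coefficients, so the modulus is at
    most their sum, which is the value at 1. *)
Lemma normr_ngeg_le1 (lam : R) k x : 0 <= lam -> -1 <= x <= 1 ->
  `|(ngeg lam k).[x]| <= 1.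
Proof.
rewrite le_eqVlt => /orP[/eqP <-|lam0] x1.
  by rewrite ngeg0_cos// ler_norml cos_geN1 cos_le1.
have g0 := geg1_gt0 lam0 k.
rewrite -(ler_pM2l g0) mulr1 -{1}(gtr0_norm g0) -normrM.
pose t := acos x; have ct : cos t = x by rewrite /t acosK// in_itv.
pose c (i j : nat) := cos (i%:R * t - j%:R * t).
have c1 i j : i%:R * t - j%:R * t + t = i.+1%:R * t - j%:R * t.
  by rewrite -(natr1 i); ring.
have c2 i j : i%:R * t - j%:R * t - t = i%:R * t - j.+1%:R * t.
  by rewrite -(natr1 j); ring.
rewrite (@geg1_ngeg_cosE _ lam (ltW lam0) x c); last 3 first.
- by rewrite /c mul0r subrr cos0.
- by move=> i j; rewrite /c -!natr1; congr cos; ring.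
- move=> i j; rewrite /c -(c1 i j) -(c2 i j).
  by move: (i%:R * t - j%:R * t) => u; rewrite cosD cosB ct; ring.
have -> : geg1 lam k = \sum_(i < k.+1) tri_coef lam i * tri_coef lam (k - i) * 1.
  rewrite -(@geg1_ngeg_cosE _ lam (ltW lam0) 1 (fun _ _ => 1))//.
    by rewrite horner_ngeg1 ?mulr1// ltW.
  by move=> _ _; ring.
apply: le_trans (ler_norm_sum _ _ _) _; apply: ler_sum => i _.
have A0 j : 0 <= tri_coef lam j.
  by rewrite divr_ge0// ltW// poch_gt0.
have AA := mulr_ge0 (A0 i) (A0 (k - i)%N).
rewrite normrM (ger0_norm AA); apply: ler_wpM2l => //.
by rewrite ler_norml cos_geN1 cos_le1.
Qed.

Definition half_index d : R := (d%:R - 1) / 2.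

Lemma half_index_ge0 d : (0 < d)%N -> 0 <= half_index d.
Proof. by move=> d0; rewrite divr_ge0// subr_ge0 ler1n. Qed.

Lemma half_index_gt0 d : (1 < d)%N -> 0 < half_index d.
Proof. by move=> d1; rewrite divr_gt0// subr_gt0 ltr1n. Qed.

Lemma half_index1 : half_index 1 = 0. Proof. by rewrite /half_index subrr mul0r. Qed.

Lemma gegenE d k x : (1 < d)%N ->
  gegen d k x = geg1 (half_index d) k * (ngeg (half_index d) k).[x].
Proof.
move=> d1; rewrite /gegen ifF; last by lia.
by rewrite -gegen_coefE// half_index_gt0.
Qed.

Lemma gegen_tildeE d k x : (0 < d)%N -> -1 <= x <= 1 ->
  gegen_tilde d k x = (ngeg (half_index d) k).[x].
Proof.
rewrite leq_eqVlt => /orP[/eqP <- x1|d1 _].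
  rewrite /gegen_tilde /gegen /= half_index1 ngeg0_cos//.
  by rewrite acos1 mulr0 cos0 divr1.
rewrite /gegen_tilde !gegenE// horner_ngeg1 ?ltW ?half_index_gt0// mulr1 mulrAC.
by rewrite divff ?mul1r// gt_eqF// geg1_gt0// half_index_gt0.
Qed.

Lemma Gamma_poch (a : R) n : 0 < a -> Gamma (a + n%:R) = poch a n * Gamma a.
Proof.
move=> a0; elim: n => [|n IH]; first by rewrite addr0 poch0 mul1r.
rewrite -natr1 addrA GammaS; last by rewrite ltr_wpDr.
by rewrite IH pochS; ring.
Qed.

Lemma dkdE d k : (1 < d)%N ->
  dkd k d = (half_index d + k%:R) / half_index d * geg1 (half_index d) k :> R.
Proof.
move=> d1; have l0 := half_index_gt0 d1.
have dE : d%:R - 1 = 2 * half_index d :> R by rewrite /half_index; field.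
have l2 : 0 < 2 * half_index d by rewrite mulr_gt0.
rewrite /dkd ifF; last by lia.
rewrite dE Gamma_poch// /geg1.
have G0 := lt0r_neq0 (Gamma_gt0 l2).
have f0 : k`!%:R != 0 :> R by rewrite pnatr_eq0 -lt0n fact_gt0.
by field; rewrite G0 f0 gt_eqF.
Qed.

(** [dkd] is [tau] times the value of [gegen] at 1; hence the estimator averages [dkd * p] for the
    normalised polynomial p. *)
Lemma tau_gegen d k x : (0 < d)%N -> (0 < k)%N -> -1 <= x <= 1 ->
  tau k d * gegen d k x = dkd k d * (ngeg (half_index d) k).[x].
Proof.
rewrite leq_eqVlt => /orP[/eqP <- k0 x1|d1 k0 x1].
  by rewrite /tau /dkd /gegen /= half_index1 ngeg0_cos.
rewrite gegenE// dkdE// /tau ifF; last by lia.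
have dE : d%:R - 1 = 2 * half_index d :> R by rewrite /half_index; field.
by rewrite dE; field; rewrite gt_eqF// half_index_gt0.
Qed.

Lemma dkd_gt0 d k : (0 < d)%N -> 0 < dkd k d :> R.
Proof.
rewrite leq_eqVlt => /orP[/eqP <-|d1]; first by rewrite /dkd /=; case: ifP.
rewrite dkdE// mulr_gt0 ?geg1_gt0 ?half_index_gt0//.
by rewrite divr_gt0 ?half_index_gt0// ltr_wpDr// half_index_gt0.
Qed.

Section moments.
Variables (d : nat) (L : {poly R} -> R).
Hypothesis d0 : (0 < d)%N.
Hypothesis LD : forall p q, L (p + q) = L p + L q.
Hypothesis LZ : forall c p, L (c%:P * p) = c * L p.
Hypothesis L1 : L 1 = 1.
Hypothesis LX : L 'X = 0.
Hypothesis LXn : forall n, (n%:R + d%:R + 1) * L 'X^(n.+2) = n.+1%:R * L 'X^n.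
Let lam := half_index d.
Let p k := ngeg lam k.

Let lam0 : 0 <= lam. Proof. exact: half_index_ge0. Qed.

Let LXn' n : (n%:R + 2 + 2 * lam) * L 'X^(n.+2) = n.+1%:R * L 'X^n.
Proof. by rewrite -LXn /lam /half_index; congr (_ * _); field. Qed.

Lemma moment_ngeg k : (0 < k)%N -> L (p k) = 0.
Proof. by case: k => // k _; exact: (L_ngeg lam0 LD LZ LX LXn'). Qed.

(** The inverse of the norm is the dimension of the space of spherical harmonics of degree k; this
    is what makes [dkd * p] unbiased in [moment_density]. *)
Lemma moment_ngeg_sqr k : (0 < k)%N -> L (p k ^+ 2) = (dkd k d)^-1.
Proof.
case: k => // k _; have [d1|d1] := eqVneq d 1%N.
  have l0 : lam = 0 by rewrite /lam d1 half_index1.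
  by rewrite (L_cheb_sqr lam0 LD LZ L1 LX LXn' l0) /dkd d1.
have d2 : (1 < d)%N by lia.
have l0 : 0 < lam := half_index_gt0 d2.
rewrite expr2 (L_ngeg_orthogonal lam0 LD LZ L1 LX LXn' l0) eqxx dkdE// -/lam.
have := geg1_ngeg_norm l0 k.+1; have g0 := lt0r_neq0 (geg1_gt0 l0 k.+1).
have l1 := lt0r_neq0 l0; have l2 : lam + k.+1%:R != 0 by rewrite gt_eqF// ltr_wpDr.
move=> E; apply: (mulfI g0); rewrite E.
move: l2 g0; move: (geg1 _ _) (k.+1%:R) => u v l2 g0.
by field; rewrite g0 l1 ?l2 1?addrC ?l2.
Qed.

(** [eta] comes from the triple product formula at [l = m = n = k], with rising factorials written
    as quotients of Gamma values. For odd k, and for [d = 1], both sides vanish. *)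
Lemma moment_ngeg_cube k : (0 < k)%N ->
  dkd k d ^+ 2 * L (p k ^+ 3) = eta k d * (~~ odd k)%:R.
Proof.
move=> k0; have [d1|d1] := eqVneq d 1%N.
  have l0 : lam = 0 by rewrite /lam d1 half_index1.
  case: k k0 => // k _.
  by rewrite /p (L_cheb_cube lam0 LD LZ LX LXn' l0) /eta d1 mulr0 mul0r.
have d2 : (1 < d)%N by lia.
have l0 : 0 < lam := half_index_gt0 d2.
have [ok|ek] := boolP (odd k).
  by rewrite /p (L_ngeg_cube_odd lam0 LD LZ L1 LX LXn' l0 ok) !mulr0.
rewrite mulr1 dkdE// -/lam /eta ifF; last by lia.
rewrite -(odd_double_half k) (negPf ek) add0n; set m := k./2.
have := L_ngeg_cube_even lam0 LD LZ L1 LX LXn' l0 m.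
rewrite -/(p _).
have dE : d%:R = 2 * lam + 1 by rewrite /lam /half_index; field.
rewrite doubleK dE -muln2.
have kE : (m * 2)%:R = 2 * m%:R :> R by rewrite natrM mulrC.
have -> : (2 * lam + 1 + (m * 2)%:R - 1) / 2 = lam + m%:R by rewrite kE; field.
have -> : 2 * lam + 1 + 3 * (m * 2)%:R / 2 - 1 = 2 * lam + (m + m + m)%:R.
  by rewrite kE !natrD; field.
have -> : 2 * lam + 1 + (m * 2)%:R - 1 = 2 * lam + (m * 2)%:R by ring.
have -> : (2 * lam + 1 - 1) / 2 = lam by field.
have -> : (2 * lam + 1 + 3 * (m * 2)%:R - 1) / 2 = lam + (m + m + m)%:R.
  by rewrite kE !natrD; field.
have l2 : 0 < 2 * lam by rewrite mulr_gt0.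
rewrite !Gamma_poch//.
have G1 := lt0r_neq0 (Gamma_gt0 l0); have G2 := lt0r_neq0 (Gamma_gt0 l2).
have l1 : lam != 0 by rewrite gt_eqF.
have q1 : 0 < lam + 1 by rewrite addr_gt0.
have P1 := lt0r_neq0 (poch_gt0 (m + m + m) q1).
have P2 := lt0r_neq0 (poch_gt0 (m + m + m) l0).
have P3 := lt0r_neq0 (poch_gt0 (m * 2) l2).
have f1 : m`!%:R != 0 :> R by rewrite pnatr_eq0 -lt0n fact_gt0.
have f2 : (m * 2)`!%:R != 0 :> R by rewrite pnatr_eq0 -lt0n fact_gt0.
have l3 : lam + 3 * m%:R != 0 by rewrite gt_eqF// ltr_wpDr// mulr_ge0.
have := poch_shift lam (m + m + m).
have -> : (m + m + m)%:R = 3 * m%:R :> R by rewrite !natrD; ring.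
rewrite /geg1 /tri_coef /tri_sum kE.
move: P1 P2 P3 f1 f2 G1 G2.
move: (poch lam m) (poch (lam + 1) _) (poch lam (m + m + m)) (poch (2 * lam) (m + m + m)).
move: (poch (2 * lam) (m * 2)) (Gamma lam) (Gamma (2 * lam)) (L _).
move: (m`!%:R) ((m * 2)`!%:R) => f f' P G G' l a s' s t s0 s0' P0 f0 f0' G0 G0' Es E.
have s'E : s' = s * (lam + 3 * m%:R) / lam by rewrite -Es; field.
(* [P / f'] is [geg1], whose cube turns [L (p k ^+ 3)] into the closed form of [E]. *)
have fP : (P / f') ^+ 3 != 0 by rewrite expf_neq0// mulf_neq0// invr_eq0.
apply: (mulfI fP).
transitivity (((lam + 2 * m%:R) / lam * (P / f')) ^+ 2 * ((P / f') ^+ 3 * l)).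
  by ring.
rewrite E s'E; field.
have n1 : 2 * lam + 1 - 1 != 0 by rewrite addrK gt_eqF.
have n2 : 3 * (2 * m%:R) + (2 * lam + 1) - 1 != 0.
  have -> : 3 * (2 * m%:R) + (2 * lam + 1) - 1 = 2 * (lam + 3 * m%:R) by ring.
  by rewrite mulf_neq0// pnatr_eq0.
by rewrite G0 s0' G0' P0 f0 f0' l1 l3 n1 n2.
Qed.

Lemma moment_ngeg_double k : (0 < k)%N -> L (p k ^+ 2 * p k.*2) != 0.
Proof.
case: k => // k _; have [d1|d1] := eqVneq d 1%N.
  have l0 : lam = 0 by rewrite /lam d1 half_index1.
  by rewrite (L_cheb_double lam0 LD LZ L1 LX LXn' l0) invr_eq0 pnatr_eq0.
have d2 : (1 < d)%N by lia.
exact: (L_ngeg_double lam0 LD LZ L1 LX LXn' (half_index_gt0 d2)).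
Qed.

Lemma moment_ngeg_ortho_double k : (0 < k)%N -> L (p k * p k.*2) = 0.
Proof.
move=> k0; have [d1|d1] := eqVneq d 1%N.
  have l0 : lam = 0 by rewrite /lam d1 half_index1.
  have := congr1 L (ngeg_cheb_mul lam0 l0 k k).
  rewrite LZ LD addnn -/(p _) -/(p _) -/(p _) !moment_ngeg//; last by lia.
  move=> h; lra.
have d2 : (1 < d)%N by lia.
rewrite /p (L_ngeg_orthogonal lam0 LD LZ L1 LX LXn' (half_index_gt0 d2)).
by case: eqP => //; lia.
Qed.

Hypothesis L_ge0 : forall q, (forall x, -1 <= x <= 1 -> 0 <= q.[x]) -> 0 <= L q.

(** The second moment of the score under the density [1 + rho * p], read off from the moments of p
    up to the third. *)
Lemma moment_sigma2 k (rho : R) : (0 < k)%N ->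
  L (((dkd k d)%:P * p k - rho%:P) ^+ 2 * (1 + rho%:P * p k)) = sigma2_GM d k rho.
Proof.
move=> k0; set D := dkd k d.
have D0 : D != 0 by rewrite gt_eqF// dkd_gt0.
have -> : (D%:P * p k - rho%:P) ^+ 2 * (1 + rho%:P * p k) =
    (D ^+ 2 - 2 * D * rho ^+ 2)%:P * p k ^+ 2 + (rho ^+ 3 - 2 * D * rho)%:P * p k
    + (rho ^+ 2)%:P * 1 + (rho * D ^+ 2)%:P * p k ^+ 3 by ring.
rewrite !LD !LZ L1 moment_ngeg// moment_ngeg_sqr// -/D -[rho * D ^+ 2 * _]mulrA.
rewrite moment_ngeg_cube// /sigma2_GM -/D.
by move: (eta k d) => e; field.
Qed.

(* Cauchy-Schwarz against the Gegenbauer polynomial of degree 2k. *)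
Lemma sigma2_GM_gt0 k (rho : R) : (0 < k)%N -> -1 <= rho <= 1 ->
  0 < sigma2_GM d k rho.
Proof.
move=> k0 rho1; have Dp := dkd_gt0 k d0.
(* At [rho = 0] the component of degree 2k used below disappears; there the variance is [dkd]
   itself. *)
have [->|r0] := eqVneq rho 0; first by rewrite /sigma2_GM mul0r mul0r addr0 expr0n subr0.
rewrite ltNge; apply/negP => s0.
set D := dkd k d in Dp.
(* If the variance were not positive, [L (f ^+ 2)] would be non-positive too, while [f] has a
   non-zero component along [g]. *)
pose f := (D%:P * p k - rho%:P) * (1 + rho%:P * p k).
pose g := p k.*2.
have k20 : (0 < k.*2)%N by lia.
pose h := L (g ^+ 2).
have h0 : 0 < h by rewrite /h /g moment_ngeg_sqr// invr_gt0 dkd_gt0.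
pose c := L (f * g).
have c0 : c != 0.
  have -> : c = D * rho * L (p k ^+ 2 * g).
    rewrite /c.
    have -> : f * g = (D * rho)%:P * (p k ^+ 2 * g) +
      (D - rho ^+ 2)%:P * (p k * g) + (- rho)%:P * g by rewrite /f; ring.
    by rewrite !LD !LZ /g moment_ngeg_ortho_double// moment_ngeg// !mulr0 !addr0.
  by rewrite !mulf_neq0// ?moment_ngeg_double// gt_eqF.
(* On [-1, 1] [1 + rho * p <= 2], so [f^2] is at most twice the integrand of the variance. *)
have f2 : L (f ^+ 2) <= 0.
  have : 0 <= L (2%:P * ((D%:P * p k - rho%:P) ^+ 2 * (1 + rho%:P * p k)) +
      (-1)%:P * f ^+ 2).
    apply: L_ge0 => x x1.
    rewrite /f !(hornerM, hornerC, hornerD, hornerN, horner_exp).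
    set z := (p k).[x].
    have z1 : `|rho * z| <= 1.
      rewrite normrM mulr_ile1 ?normr_ge0//; first by rewrite ler_norml.
      exact: normr_ngeg_le1.
    move: z1; rewrite ler_norml => /andP[z1 z2].
    have -> : 2 * ((D * z - rho) ^+ 2 * (1 + rho * z)) +
      -1 * ((D * z - rho) * (1 + rho * z)) ^+ 2 =
      (D * z - rho) ^+ 2 * ((1 + rho * z) * (1 - rho * z)) by ring.
    by rewrite mulr_ge0 ?sqr_ge0// mulr_ge0//; lra.
  rewrite LD !LZ moment_sigma2// => H; lra.
have : 0 <= L ((f - (c / h)%:P * g) ^+ 2).
  by apply: L_ge0 => x _; rewrite horner_exp sqr_ge0.
have -> : (f - (c / h)%:P * g) ^+ 2 =
    f ^+ 2 + (- 2 * (c / h))%:P * (f * g) + ((c / h) ^+ 2)%:P * g ^+ 2 by ring.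
rewrite !LD !LZ -/c -/h.
have -> : L (f ^+ 2) + -2 * (c / h) * c + (c / h) ^+ 2 * h = L (f ^+ 2) - c ^+ 2 / h.
  by field; rewrite gt_eqF.
have : 0 < c ^+ 2 / h by rewrite divr_gt0// exprn_even_gt0.
lra.
Qed.

Lemma moment_density k (rho : R) : (0 < k)%N ->
  L (1 + rho%:P * p k) = 1 /\ L ((dkd k d)%:P * p k * (1 + rho%:P * p k)) = rho.
Proof.
move=> k0; set D := dkd k d.
have D0 : D != 0 by rewrite gt_eqF// dkd_gt0.
split; first by rewrite LD LZ L1 moment_ngeg// mulr0 addr0.
have -> : D%:P * p k * (1 + rho%:P * p k) = D%:P * p k + (rho * D)%:P * p k ^+ 2 by ring.
by rewrite LD !LZ moment_ngeg// moment_ngeg_sqr// mulr0 add0r mulfK.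
Qed.

End moments.

Lemma sigma2_GM_1 d (rho : R) : (0 < d)%N ->
  sigma2_GM d 1 rho = d%:R + 1 - rho ^+ 2.
Proof.
rewrite /sigma2_GM /= mulr0 addr0 leq_eqVlt => /orP[/eqP <-|d1].
  by rewrite /dkd /=; ring.
congr (_ - _); rewrite dkdE//; have l0 := half_index_gt0 d1.
have := geg1S (half_index d) 0; rewrite mul1r add0r => ->.
rewrite /geg1 poch0 fact0 divr1 mulr1.
have -> : d%:R = 2 * half_index d + 1 by rewrite /half_index; field.
by field; rewrite gt_eqF.
Qed.

Lemma sigma2_GM_2 d (rho : R) : (0 < d)%N ->
  sigma2_GM d 2 rho = d%:R * (d%:R + 3) / 2
    + 2 * (d%:R - 1) * (d%:R + 3) / (d%:R + 5) * rho - rho ^+ 2.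
Proof.
rewrite /sigma2_GM /= mulr1 leq_eqVlt => /orP[/eqP <-|d1].
  by rewrite /dkd /eta /=; field.
congr (_ + _ - _).
  rewrite dkdE//; have l0 := half_index_gt0 d1.
  have G0 : geg1 (half_index d) 0 = 1 by rewrite /geg1 poch0 fact0 divr1.
  have G1 := geg1S (half_index d) 0; have G2 := geg1S (half_index d) 1.
  have -> : geg1 (half_index d) 2 = (1 + 2 * half_index d) * (2 * half_index d) / 2.
    move: G1 G2; rewrite G0 mul1r add0r mulr1 => ->; move=> G2.
    by apply: (mulfI (_ : 2 != 0)) => //; rewrite G2; field.
  have -> : d%:R = 2 * half_index d + 1 by rewrite /half_index; field.
  by field; rewrite gt_eqF.
rewrite mulrC; congr (_ * _); rewrite /eta ifF; last by lia.
have [l l0 dE] : exists2 l : R, 0 < l & d%:R = 2 * l + 1.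
  by exists (half_index d); rewrite ?half_index_gt0// /half_index; field.
rewrite dE [2./2]/= !factS fact0.
have -> : (2 * l + 1 + 2 - 1) / 2 = l + 1 by field.
have -> : 2 * l + 1 + 3 * 2 / 2 - 1 = 2 * l + 2 + 1 by field.
have -> : 2 * l + 1 + 2 - 1 = 2 * l + 2 by ring.
have -> : (2 * l + 1 - 1) / 2 = l by field.
have -> : (2 * l + 1 + 3 * 2 - 1) / 2 = l + 1 + 1 + 1 by field.
rewrite !GammaS ?addr_gt0 ?mulr_gt0//.
have G1 := lt0r_neq0 (Gamma_gt0 l0).
have l2 : 0 < 2 * l + 2 by rewrite addr_gt0// mulr_gt0.
have G2 := lt0r_neq0 (Gamma_gt0 l2).
move: G1 G2; move: (Gamma l) (Gamma _) => u v u0 v0.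
field.
rewrite u0 v0 /= !gt_eqF//; lra.
Qed.

End gegenbauer_values.

(** * Sums of independent bounded variables *)

Section independent_pair.
Context d (T : measurableType d) (R : realType) (P : probability T R).
Variables X Y : T -> R.
Hypotheses (mX : measurable_fun setT X) (mY : measurable_fun setT Y).

Definition mfun_of (f : T -> R) (mf : measurable_fun setT f) : {mfun T >-> R} :=
  HB.pack f (isMeasurableFun.Build _ _ _ _ f mf).

Let mXY : measurable_fun setT (fun w => (X w, Y w)).
Proof. exact/measurable_fun_pairP. Qed.

Lemma preimage_measurable (f : T -> R) A :
  measurable_fun setT f -> measurable A -> measurable (f @^-1` A).
Proof. by move=> mf mA; rewrite -[X in measurable X]setTI; exact: mf. Qed.

(** In [C], both sides are finite measures which agree on rectangles, a generating class stable
    under intersection. It serves to pass from [psum n] and [xi n], jointly independent of a tail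
    event, to their sum. *)
Lemma pair_preimage_independent (E : set T) : measurable E ->
  (forall A B, measurable A -> measurable B ->
     P ((X @^-1` A `&` Y @^-1` B) `&` E) = P (X @^-1` A `&` Y @^-1` B) * P E)%E ->
  forall C, measurable C ->
    P ((fun w => (X w, Y w)) @^-1` C `&` E) =
    (P ((fun w => (X w, Y w)) @^-1` C) * P E)%E.
Proof.
move=> mE rect C mC.
have PE : P E \is a fin_num by exact: fin_num_measure.
have PE0 : 0 <= fine (P E) by exact: fine_ge0.
have [m1 m1E] : exists m : {measure set (R * R) -> \bar R},
    forall A, m A = P ((fun w => (X w, Y w)) @^-1` A `&` E).
  by unshelve eexists (pushforward (mrestr P mE) (fun w => (X w, Y w)) : {measure set (R * R) -> \bar R}).
have [m2 m2E] : exists m : {measure set (R * R) -> \bar R},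
    forall A, m A = (P E * P ((fun w => (X w, Y w)) @^-1` A))%E.
  unshelve eexists (mscale (NngNum PE0) (pushforward P (fun w => (X w, Y w))) : {measure set (R * R) -> \bar R}) => //.
  by move=> A; rewrite /mscale /pushforward -[in RHS](fineK PE).
suff : m1 C = m2 C.
  by rewrite m1E m2E muleC.
apply: (@measure_unique _ _ _ [set C | exists2 A, measurable A & exists2 B, measurable B & A `*` B = C] (fun=> setT)) => //.
- exact: measurable_prod_measurableType.
- move=> _ _ [A1 mA1 [B1 mB1 <-]] [A2 mA2 [B2 mB2 <-]].
  exists (A1 `&` A2); first exact: measurableI.
  by exists (B1 `&` B2); [exact: measurableI|rewrite setXI].
- by move=> _; exists setT => //; exists setT => //; rewrite setXTT.
- by apply/seteqP; split => // x _; exists 0%N.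
- move=> _ [A mA [B mB <-]].
  by rewrite m1E m2E muleC; exact: rect.
- move=> _; rewrite m1E.
  apply: (le_lt_trans (probability_le1 P _)); last by rewrite ltry.
  by apply: measurableI => //; rewrite -[X in measurable X]setTI; exact: mXY.
Qed.

Hypothesis indep : forall A B, measurable A -> measurable B ->
  P (X @^-1` A `&` Y @^-1` B) = (P (X @^-1` A) * P (Y @^-1` B))%E.

Lemma ge0_integral_independent (F : R * R -> \bar R) :
  measurable_fun setT F -> (forall x, 0 <= F x)%E ->
  (\int[P]_w F (X w, Y w) = \int[P]_w \int[P]_w' F (X w, Y w'))%E.
Proof.
move=> mF F0.
pose dX := distribution P (mfun_of mX); pose dY := distribution P (mfun_of mY).
have E1 : (\int[P]_w F (X w, Y w) =
    \int[pushforward P (fun w => (X w, Y w))]_z F z)%E.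
  by rewrite ge0_integral_pushforward.
have E2 : (\int[pushforward P (fun w => (X w, Y w))]_z F z = \int[dX \x dY]_z F z)%E.
  apply: eq_measure_integral => A mA _.
  apply: esym; apply: (product_measure_unique (m1 := dX) (m2 := dY)) => //.
rewrite E1 E2 fubini_tonelli1//.
have mG : measurable_fun setT (fun x => \int[dY]_y F (x, y))%E.
  exact: (measurable_fun_fubini_tonelli_F (m2 := dY) F).
have G0 x : (0 <= \int[dY]_y F (x, y))%E by exact: integral_ge0.
rewrite (ge0_integral_distribution (mfun_of mX) mG G0).
apply: eq_integral => w _ /=.
apply: (ge0_integral_distribution (mfun_of mY) (f := fun y => F (X w, y))) => //.
exact: measurableT_comp.
Qed.

Lemma Ex_independent (F : R * R -> R) : bmeas F ->
  Ex P (fun w => F (X w, Y w)) = Ex P (fun w => Ex P (fun w' => F (X w, Y w'))).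
Proof.
move=> bF; have [mF [C FC]] := bF.
have mFC : measurable_fun setT (fun z => (F z + C)%:E).
  by apply/measurable_EFinP; exact: measurable_funD.
have FC0 z : (0 <= (F z + C)%:E)%E.
  by rewrite lee_fin; have := FC z; rewrite ler_norml => /andP[]; lra.
have bw w : bmeas (fun w' => F (X w, Y w')).
  exact: (bmeas_comp bF (measurable_fun_pair (measurable_cst _) mY)).
have bXY : bmeas (fun w => F (X w, Y w)) by exact: (bmeas_comp bF).
have EE w : (\int[P]_w' (F (X w, Y w') + C)%:E = (Ex P (fun w' => F (X w, Y w')) + C)%:E)%E.
  rewrite EFin_Ex; last by apply: bmeasD => //; exact: bmeas_cst.
  by rewrite ExD//; [rewrite Ex_cst|exact: bmeas_cst].
have bE : bmeas (fun w => Ex P (fun w' => F (X w, Y w'))).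
  split; last by exists C => w; apply: normr_Ex_le.
  have : measurable_fun setT (fun w => \int[P]_w' (F (X w, Y w') + C)%:E)%E.
    apply: (measurable_fun_fubini_tonelli_F (m2 := P) (fun z => (F (X z.1, Y z.2) + C)%:E)) => //.
    have mp : measurable_fun setT (fun z : T * T => (X z.1, Y z.2)).
      by apply: measurable_fun_pair; exact: measurableT_comp.
    exact: (measurableT_comp mFC mp).
  move=> mE.
  have -> : (fun w => Ex P (fun w' => F (X w, Y w'))) =
      fun w => Ex P (fun w' => F (X w, Y w')) + C - C.
    by apply/funext => w; rewrite addrK.
  apply: measurable_funB => //; apply/measurable_EFinP.
  by apply: eq_measurable_fun mE => w _; rewrite /= EE.
have := ge0_integral_independent mFC FC0.
under [X in _ = X -> _]eq_integral => w _ do rewrite EE.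
rewrite !EFin_Ex; try by apply: bmeasD => //; exact: bmeas_cst.
rewrite !ExD ?Ex_cst//; try exact: bmeas_cst.
by move=> [] /addIr.
Qed.

End independent_pair.

Section clamp.
Context {R : realType}.

Definition clamp (M x : R) : R := Num.max (- M) (Num.min M x).

Lemma clamp_id (M x : R) : `|x| <= M -> clamp M x = x.
Proof.
by rewrite ler_norml => /andP[h1 h2]; rewrite /clamp (min_idPr h2) (max_idPr h1).
Qed.

Lemma normr_clamp_le (M x : R) : 0 <= M -> `|clamp M x| <= M.
Proof.
move=> M0; rewrite ler_norml le_max lexx/= ge_max ge_min lexx/= andbT; lra.
Qed.

Lemma bmeas_clamp (M : R) : 0 <= M -> bmeas (clamp M).
Proof.
move=> M0; split; last by exists M => x; exact: normr_clamp_le.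
by apply: measurable_maxr => //; exact: measurable_minr.
Qed.

End clamp.

Section iid_sums.
Context d (T : measurableType d) (R : realType) (P : probability T R).
Variables (xi : nat -> T -> R) (K : R).
Hypothesis mxi : forall i, measurable_fun setT (xi i).
Hypothesis xiK : forall i w, `|xi i w| <= K.
Hypothesis xi_indep : forall (s : seq nat) (A : nat -> set R), uniq s ->
  (forall i, measurable (A i)) ->
  P (\big[setI/setT]_(i <- s) (xi i @^-1` A i)) =
  (\prod_(i <- s) P (xi i @^-1` A i))%E.
Hypothesis xi_ident : forall i A, measurable A ->
  P (xi i @^-1` A) = P (xi 0 @^-1` A).

Definition psum n w : R := \sum_(i < n) xi i w.

Lemma psumS n w : psum n.+1 w = psum n w + xi n w.
Proof. by rewrite /psum big_ord_recr. Qed.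

Lemma measurable_psum n : measurable_fun setT (psum n).
Proof. by apply: measurable_sum => i. Qed.

Let K0 : 0 <= K.
Proof.
have [w _] : exists w : T, True.
  have : [set: T] !=set0.
    apply/set0P/eqP => T0; have := probability_setT P.
    by rewrite T0 measure0 => /eqP; rewrite eq_sym onee_eq0.
  by move=> [w _]; exists w.
exact: le_trans (normr_ge0 _) (xiK 0 w).
Qed.

Lemma normr_psum_le n w : `|psum n w| <= n%:R * K.
Proof.
apply: (le_trans (ler_norm_sum _ _ _)).
apply: (@le_trans _ _ (\sum_(i < n) K)); first by apply: ler_sum => i _; exact: xiK.
by rewrite sumr_const card_ord mulr_natl.
Qed.

Lemma bmeas_psum n : bmeas (psum n).
Proof.
split; first exact: measurable_psum.
by exists (n%:R * K) => w; exact: normr_psum_le.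
Qed.

Lemma bmeas_xi i : bmeas (xi i).
Proof. by split => //; exists K => w. Qed.

Lemma measurable_xi_big (s : seq nat) (B : nat -> set R) :
  (forall i, measurable (B i)) ->
  measurable (\big[setI/setT]_(i <- s) (xi i @^-1` B i)).
Proof. by move=> mB; apply: bigsetI_measurable => i _; exact: preimage_measurable. Qed.

(** The tail is arbitrary so that the induction can enlarge it: the rectangle hypothesis of
    [pair_preimage_independent] for [psum n] and [xi n] is the case of the tail [n :: s]. *)
Lemma psum_independent_tail n (s : seq nat) (B : nat -> set R) (A : set R) :
  uniq s -> all (leq n) s -> (forall i, measurable (B i)) -> measurable A ->
  P (psum n @^-1` A `&` \big[setI/setT]_(i <- s) (xi i @^-1` B i)) =
  (P (psum n @^-1` A) * P (\big[setI/setT]_(i <- s) (xi i @^-1` B i)))%E.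
Proof.
elim: n s B A => [|n IH] s B A us sn mB mA.
  have [A0|A0] := pselect (A 0).
    have -> : psum 0 @^-1` A = setT.
      by apply/seteqP; split => // w _; rewrite /preimage/= /psum big_ord0.
    by rewrite setTI [X in (X * _)%E](probability_setT P) mul1e.
  have -> : psum 0 @^-1` A = set0.
    by apply/seteqP; split => // w; rewrite /preimage/= /psum big_ord0.
  by rewrite set0I measure0 mul0e.
have nxi A' B' : measurable A' -> measurable B' ->
    P (psum n @^-1` A' `&` xi n @^-1` B') = (P (psum n @^-1` A') * P (xi n @^-1` B'))%E.
  move=> mA' mB'.
  by have := IH [:: n] (fun=> B') A'; rewrite big_seq1 /= leqnn; apply.
have ns : n \notin s.
  by apply/negP => /(allP sn); rewrite ltnn.
pose E := \big[setI/setT]_(i <- s) (xi i @^-1` B i).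
have mE : measurable E by exact: measurable_xi_big.
have -> : psum n.+1 @^-1` A =
    (fun w => (psum n w, xi n w)) @^-1` ((fun z : R * R => z.1 + z.2) @^-1` A).
  by apply/seteqP; split => w; rewrite /preimage /= psumS.
apply: pair_preimage_independent => //; first exact: measurable_psum.
  move=> A' B' mA' mB'; rewrite nxi//.
  pose B'' i := if i == n then B' else B i.
  have mB'' i : measurable (B'' i) by rewrite /B''; case: ifP.
  have B''n : B'' n = B' by rewrite /B'' eqxx.
  have EB : \big[setI/setT]_(i <- s) (xi i @^-1` B'' i) = E.
    apply: eq_big_seq => i si; rewrite /B''; case: eqP => // ein.
    by move: ns; rewrite -ein si.
  have := IH (n :: s) B'' A'; rewrite /= ns us leqnn/= big_cons EB B''n -setIA.
  move=> ->//; last by apply: sub_all sn => i; exact: ltnW.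
  have := xi_indep (s := n :: s) (A := B''); rewrite /= ns us => /(_ isT mB'').
  rewrite !big_cons EB B''n => ->; rewrite muleA; congr (_ * _)%E.
  have := xi_indep us mB''; rewrite EB => ->.
  by apply: eq_big_seq.
rewrite -[X in measurable X]setTI; apply: measurable_funD => //.
Qed.

Lemma psum_xi_independent n A B : measurable A -> measurable B ->
  P (psum n @^-1` A `&` xi n @^-1` B) = (P (psum n @^-1` A) * P (xi n @^-1` B))%E.
Proof.
move=> mA mB; have := @psum_independent_tail n [:: n] (fun=> B) A.
by rewrite big_seq1 /= leqnn; apply.
Qed.

Lemma Ex_xi_ident (f : R -> R) i : bmeas f ->
  Ex P (fun w => f (xi i w)) = Ex P (fun w => f (xi 0%N w)).
Proof.
move=> bf; have [mf [C fC]] := bf.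
have mFC : measurable_fun setT (fun z => (f z + C)%:E).
  by apply/measurable_EFinP; exact: measurable_funD.
have FC0 z : (0 <= (f z + C)%:E)%E.
  by rewrite lee_fin; have := fC z; rewrite ler_norml => /andP[]; lra.
have E j : (Ex P (fun w => f (xi j w)) + C)%:E =
    (\int[distribution P (mfun_of (mxi j))]_y (f y + C)%:E)%E.
  rewrite ge0_integral_distribution// -[in LHS](Ex_cst P C) -ExD.
  - by rewrite -EFin_Ex//; apply: bmeasD; [exact: (bmeas_comp bf)|exact: bmeas_cst].
  - exact: (bmeas_comp bf).
  - exact: bmeas_cst.
suff : (Ex P (fun w => f (xi i w)) + C)%:E = (Ex P (fun w => f (xi 0%N w)) + C)%:E.
  by move=> [] /addIr.
rewrite !E; apply: eq_measure_integral => A mA _.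
exact: xi_ident.
Qed.

Lemma Ex_psum_xi n (F : R * R -> R) : bmeas F ->
  Ex P (fun w => F (psum n w, xi n w)) =
  Ex P (fun w => Ex P (fun w' => F (psum n w, xi 0%N w'))).
Proof.
move=> bF; rewrite (Ex_independent (measurable_psum n) (mxi n) (@psum_xi_independent n) bF).
apply: eq_Ex => w; apply: (Ex_xi_ident (f := fun y => F (psum n w, y))).
exact: (bmeas_comp bF (measurable_fun_pair (measurable_cst _) _)).
Qed.

Lemma Ex_psum_xi_monomial n a b :
  Ex P (fun w => psum n w ^+ a * xi n w ^+ b) =
  Ex P (fun w => psum n w ^+ a) * Ex P (fun w => xi 0%N w ^+ b).
Proof.
have nK0 : 0 <= n%:R * K by rewrite mulr_ge0.
have c1 w : clamp (n%:R * K) (psum n w) = psum n w.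
  by apply: clamp_id; exact: normr_psum_le.
have c2 i w : clamp K (xi i w) = xi i w by exact: clamp_id.
(* Clamping makes the monomial bounded on the plane and changes nothing on the range of the sums. *)
pose F (z : R * R) := clamp (n%:R * K) z.1 ^+ a * clamp K z.2 ^+ b.
have bF : bmeas F.
  by apply: bmeasM; apply: bmeasX; apply: bmeas_comp;
    [exact: bmeas_clamp|exact: measurable_fst|exact: bmeas_clamp|exact: measurable_snd].
have := Ex_psum_xi n bF; rewrite /F /=.
under eq_Ex => w do rewrite c1 c2.
move=> ->; rewrite [RHS]mulrC -ExZ; last by apply: bmeasX; exact: bmeas_psum.
apply: eq_Ex => w; rewrite [RHS]mulrC -ExZ; last by apply: bmeasX; exact: bmeas_xi.
by apply: eq_Ex => w'; rewrite c1 c2.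
Qed.

Lemma Ex_psumS_expr n m : Ex P (fun w => psum n.+1 w ^+ m) =
  \sum_(i < m.+1) 'C(m, i)%:R * (Ex P (fun w => psum n w ^+ (m - i)) *
                                 Ex P (fun w => xi 0%N w ^+ i)).
Proof.
have bm c a b : bmeas (fun w => c * (psum n w ^+ a * xi n w ^+ b)).
  by apply: bmeasZ; apply: bmeasM; apply: bmeasX; [exact: bmeas_psum|exact: bmeas_xi].
rewrite (eq_Ex P (g := fun w => \sum_(i < m.+1)
    'C(m, i)%:R * (psum n w ^+ (m - i) * xi n w ^+ i))); last first.
  by move=> w; rewrite psumS exprDn; apply: eq_bigr => i _; rewrite mulr_natl.
rewrite Ex_sum//; apply: eq_bigr => i _.
rewrite ExZ; first by rewrite Ex_psum_xi_monomial.
by apply: bmeasM; apply: bmeasX; [exact: bmeas_psum|exact: bmeas_xi].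
Qed.

Let Ex_expr0 (Y : T -> R) : Ex P (fun w => Y w ^+ 0) = 1.
Proof. by rewrite -[RHS](Ex_cst P 1). Qed.

Variable v : R.
Hypothesis xi_mean : Ex P (xi 0%N) = 0.
Hypothesis xi_var : Ex P (fun w => xi 0%N w ^+ 2) = v.

Let xi_expr1 : Ex P (fun w => xi 0%N w ^+ 1) = 0.
Proof. exact: xi_mean. Qed.

Lemma Ex_psum n : Ex P (fun w => psum n w ^+ 1) = 0.
Proof.
elim: n => [|n IH].
  by rewrite -[RHS](Ex_cst P 0); apply: eq_Ex => w; rewrite /psum big_ord0.
by rewrite Ex_psumS_expr !big_ord_recl big_ord0 /= subn0 IH xi_expr1; ring.
Qed.

Lemma Ex_psum_sqr n : Ex P (fun w => psum n w ^+ 2) = n%:R * v.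
Proof.
elim: n => [|n IH].
  by rewrite mul0r -[RHS](Ex_cst P 0); apply: eq_Ex => w; rewrite /psum big_ord0 expr0n.
rewrite Ex_psumS_expr !big_ord_recl big_ord0 /= /bump /= -natr1.
rewrite !add1n subn0 subnn bin0 binn !Ex_expr0 IH xi_expr1 xi_var; ring.
Qed.

(** Terms containing a first moment vanish, so step n adds [6 n v^2 + m4], which the increment of
    the right side dominates. *)
Lemma Ex_psum_4_le n : Ex P (fun w => psum n w ^+ 4) <=
  (3 * v ^+ 2 + Ex P (fun w => xi 0%N w ^+ 4)) * n%:R ^+ 2.
Proof.
set m4 := Ex P (fun w => xi 0%N w ^+ 4).
have m40 : 0 <= m4 by apply: Ex_ge0 => w; rewrite exprn_even_ge0.
elim: n => [|n IH].
  rewrite expr0n mulr0 -[leRHS](Ex_cst P 0) le_eqVlt; apply/orP; left; apply/eqP.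
  by apply: eq_Ex => w; rewrite /psum big_ord0 expr0n.
rewrite Ex_psumS_expr !big_ord_recl big_ord0 /= /bump /= -natr1 -/m4.
rewrite !add1n subn0 subnn (_ : 4 - 2 = 2)%N// (_ : 4 - 3 = 1)%N//.
rewrite !Ex_expr0 Ex_psum_sqr Ex_psum xi_expr1 xi_var.
rewrite bin0 binn (_ : 'C(4, 2) = 6)%N//.
have := mulr_ge0 m40 (ler0n R n); have := sqr_ge0 v; nra.
Qed.

End iid_sums.

(** The fourth moments of [Y n / n] are summable, so the series of the fourth powers is integrable,
    hence finite almost everywhere, and its terms tend to 0. *)
Lemma fourth_moment_slln d (T : measurableType d) (R : realType)
    (P : probability T R) (Y : nat -> T -> R) (C : R) :
  (forall n, bmeas (Y n)) ->
  (forall n, Ex P (fun w => Y n w ^+ 4) <= C * n%:R ^+ 2) ->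
  {ae P, forall w, Y n w / n%:R @[n --> \oo] --> (0 : R)}.
Proof.
move=> bY YC.
pose g n w : R := (Y n.+1 w / n.+1%:R) ^+ 4.
have g0 n w : 0 <= g n w by rewrite exprn_even_ge0.
have bg n : bmeas (g n).
  by apply: bmeasX; apply: bmeasM => //; exact: bmeas_cst.
have C0 : 0 <= C.
  have := YC 1%N; rewrite expr1n mulr1; apply: le_trans.
  by apply: Ex_ge0 => w; rewrite exprn_even_ge0.
(* [1 / m^2 <= 2 (1 / m - 1 / (m + 1))] for [m >= 1], so that the sum telescopes. *)
have Eg n : Ex P (g n) <= 2 * C * (n.+1%:R^-1 - n.+2%:R^-1).
  have n1 : 0 < n.+1%:R :> R by rewrite ltr0n.
  have n2 : n.+2%:R = n.+1%:R + 1 :> R by rewrite natr1.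
  rewrite (eq_Ex P (g := fun w => n.+1%:R^-1 ^+ 4 * Y n.+1 w ^+ 4)); last first.
    by move=> w; rewrite /g expr_div_n exprVn mulrC.
  rewrite ExZ; last exact: bmeasX.
  apply: (@le_trans _ _ (n.+1%:R^-1 ^+ 4 * (C * n.+1%:R ^+ 2))).
    by apply: ler_wpM2l => //; rewrite exprn_even_ge0.
  have n11 : 1 <= n.+1%:R :> R by rewrite ler1n.
  rewrite n2; move: n1 n11; move: (n.+1%:R : R) => x x0 x1.
  have -> : x^-1 ^+ 4 * (C * x ^+ 2) = C * (x * x)^-1 by field; rewrite gt_eqF.
  have -> : 2 * C * (x^-1 - (x + 1)^-1) = C * (2 * (x * (x + 1))^-1).
    by field; rewrite !gt_eqF//; lra.
  apply: ler_wpM2l => //.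
  rewrite -subr_ge0 (_ : _ - _ = (x - 1) / (x * x * (x + 1))).
    by apply: divr_ge0; [lra|nra].
  by field; rewrite !gt_eqF//; lra.
have sumg n : \sum_(0 <= i < n) Ex P (g i) <= 2 * C * (1 - n.+1%:R^-1).
  elim: n => [|n IH]; first by rewrite big_geq// invr1 subrr mulr0.
  rewrite big_nat_recr//; apply: (le_trans (lerD IH (Eg n))).
  by rewrite -mulrDr addrA subrK.
have intf : (\int[P]_w (\sum_(0 <= n <oo) (g n w)%:E) < +oo)%E.
  rewrite integral_nneseries//; last 2 first.
  - by move=> n; apply/measurable_EFinP; case: (bg n).
  - by move=> n w _; rewrite lee_fin.
  apply: (@le_lt_trans _ _ (2 * C)%:E); last by rewrite ltry.
  apply: lime_le.
    by apply: is_cvg_nneseries => n _ _; apply: integral_ge0 => w _; rewrite lee_fin.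
  near=> n.
  under eq_bigr do rewrite EFin_Ex//.
  rewrite sumEFin lee_fin (le_trans (sumg n))//.
  by rewrite -[leRHS]mulr1 ler_wpM2l ?mulr_ge0// gerBl invr_ge0.
have sg0 w : (0 <= \sum_(0 <= n <oo) (g n w)%:E)%E.
  by apply: nneseries_ge0 => n _ _; rewrite lee_fin.
have isum : P.-integrable setT (fun w => \sum_(0 <= n <oo) (g n w)%:E)%E.
  apply/integrableP; split.
    apply: ge0_emeasurable_sum => [n w _ _|n _]; first by rewrite lee_fin.
    by apply/measurable_EFinP; case: (bg n).
  by under eq_integral do rewrite gee0_abs//.
apply: filterS (integrable_ae measurableT isum) => w /(_ I) fw.
have sfin : (\sum_(0 <= n <oo) (g n w)%:E < +oo)%E by rewrite ltey_eq fw.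
have := @nneseries_tail_cvg _ _ xpredT sfin (fun n _ => g0 n w : (0 <= (g n w)%:E)%E).
move=> tail.
have gcvg : (g n w)%:E @[n --> \oo] --> 0%E.
  apply: (squeeze_cvge _ (cvg_cst 0%E) tail).
  near=> n; rewrite lee_fin g0/=.
  have := @nneseries_lim_ge _ (fun k => (g k w)%:E) xpredT n n.+1.
  by rewrite big_nat1; apply => k _ _; rewrite lee_fin.
apply/cvgrPdist_lt => e e0.
have e4 : 0 < e ^+ 4 by rewrite exprn_gt0.
move/fine_cvgP : gcvg => [_ /cvgrPdist_lt /(_ _ e4) [N _ NE]].
exists N.+1 => // -[//|n] /= Nn.
have := NE n Nn; rewrite /= !sub0r !normrN /g normrX.
by rewrite ltr_pXn2r// nnegrE// ltW.
Unshelve. all: by end_near. Qed.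

(** * The central limit theorem *)

Section smoothing.
Variable R : realType.
Notation mu := (@lebesgue_measure R).

Lemma is_derive_continuous (f df : R -> R) : (forall x : R, is_derive x 1 f (df x)) -> continuous f.
Proof. by move=> fE x; apply: derivable_continuous_pt; case: (fE x). Qed.

Lemma is_derive_shift (f : R -> R) (df e x : R) : is_derive (x + e) 1 f df ->
  is_derive x 1 (fun y => f (y + e)) df.
Proof.
move=> fE; have D : is_derive x 1 (fun y : R => y + e) 1.
  by apply: is_derive_eq; rewrite addr0.
have := @is_derive1_comp _ f (fun y => y + e) x _ _ fE D.
by rewrite mulr1.
Qed.

Definition diffq (e : R) (f : R -> R) (x : R) : R := e^-1 * (f (x + e) - f x).

Lemma is_derive_diffq (e : R) (f df : R -> R) : (forall x : R, is_derive x 1 f (df x)) ->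
  forall x : R, is_derive x 1 (diffq e f) (diffq e df x).
Proof.
move=> fE x; have D := is_derive_shift (fE (x + e)).
rewrite /diffq; apply: is_derive_eq.
by [].
Qed.

Lemma normr_diffq_le (e : R) (f : R -> R) (M : R) : 0 < e -> (forall x, `|f x| <= M) ->
  forall x, `|diffq e f x| <= e^-1 * (M + M).
Proof.
move=> e0 fM x; rewrite /diffq normrM gtr0_norm ?invr_gt0//.
apply: ler_wpM2l; first by rewrite invr_ge0 ltW.
by apply: (le_trans (ler_normB _ _)); apply: lerD.
Qed.

(** [g x] is the mean of [h] over [[x, x + e]]. Only its derivative and the fact that it is a nearby
    value of [h] are retained; both pass through iteration. *)
Lemma moving_average (h : R -> R) (e : R) : continuous h -> 0 < e ->
  exists2 g, (forall x : R, is_derive x 1 g (diffq e h x)) &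
    forall x, exists2 y, x <= y <= x + e & g x = h y.
Proof.
move=> ch e0.
pose F a y := (\int[mu]_(t in `[a, y]) h t)%R.
have ih a b : mu.-integrable `[a, b] (EFin \o h).
  apply: continuous_compact_integrable; first exact: segment_compact.
  exact: continuous_subspaceT.
have dF (a y : R) : a < y -> is_derive y 1 (F a) (h y).
  move=> ay; have yy : y < y + 1 by rewrite ltrDl.
  have [d1 d2] := continuous_FTC1_closed yy (ih a (y + 1)) ay (ch y).
  by apply: DeriveDef; [exact: d1|rewrite -derive1E; exact: d2].
have FB (a x : R) : a <= x -> F x (x + e) = F a (x + e) - F a x.
  move=> ax; rewrite /F Rintegral_itvB//; last by rewrite bnd_simp lerDl ltW.
  by rewrite Rintegral_itv_obnd_cbnd//; apply: integrableS (ih x (x + e)) => //;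
     exact: subset_itv_oc_cc.
have dG (a x : R) : a < x -> is_derive x 1 (fun y => F a (y + e) - F a y) (h (x + e) - h x).
  move=> ax; have axe : a < x + e by rewrite (lt_trans ax)// ltrDl.
  by have := dF _ _ ax; have := is_derive_shift (dF _ _ axe) => D1 D2; apply: is_derive_eq.
exists (fun x => e^-1 * F x (x + e)) => x.
  (* A base point fixed below x turns the integral over the moving window into a difference of
     values of one primitive. *)
  have xx : x - 1 < x by rewrite ltrBlDr ltrDl.
  have := dG _ _ xx => D.
  apply: (@near_eq_is_derive _ _ _ (fun y => e^-1 * (F (x - 1) (y + e) - F (x - 1) y))).
    near=> y; congr (_ * _); rewrite -FB// ltW//.
    by near: y; exact: lt_nbhsr.
have xx : x - 1 < x by rewrite ltrBlDr ltrDl.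
have [|||c] := @MVT_segment _ (F (x - 1)) h x (x + e).
- by rewrite lerDl ltW.
- by move=> y; rewrite in_itv/= => /andP[xy _]; apply: dF; exact: lt_trans xy.
- apply: continuous_in_subspaceT => y; rewrite inE/= in_itv/= => /andP[xy _].
  apply: derivable_continuous_pt; case: (dF (x - 1) y) => //.
  exact: lt_le_trans xy.
rewrite in_itv/= => cx E; exists c => //.
by rewrite (FB (x - 1))// ?ltW// E addrAC subrr add0r mulrCA mulVf ?mulr1// gt_eqF.
Unshelve. all: by end_near. Qed.

(** The mean value theorem between 0 and x; the factor [1 / (m + 1)] of an exact integration is
    given up. *)
Lemma integrate_bound (f df : R -> R) (K : R) (m : nat) : f 0 = 0 ->
  (forall x : R, is_derive x 1 f (df x)) -> (forall x, `|df x| <= K * `|x| ^+ m) ->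
  forall x, `|f x| <= K * `|x| ^+ m.+1.
Proof.
move=> f0 fE dfK x.
have cf := is_derive_continuous fE.
have K0 : 0 <= K by have := dfK 1; rewrite normr1 expr1n mulr1; apply: le_trans.
have cb c : `|c| <= `|x| -> `|df c| <= K * `|x| ^+ m.
  move=> cx; apply: (le_trans (dfK c)); apply: ler_wpM2l => //.
  exact: lerXn2r.
suff [c cx E] : exists2 c, `|c| <= `|x| & f x = df c * x.
  by rewrite E normrM exprSr mulrA ler_wpM2r// cb.
have [x0|x0] := leP 0 x.
  have [|c] := MVT_segment x0 (fun y _ => fE y); first exact: continuous_subspaceT.
  rewrite in_itv/= f0 !subr0 => /andP[c0 cx] E; exists c => //.
  by rewrite !ger0_norm.
have [|c] := MVT_segment (ltW x0) (fun y _ => fE y); first exact: continuous_subspaceT.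
rewrite in_itv/= f0 !sub0r mulrN => /andP[c0 cx] /oppr_inj E; exists c => //.
by rewrite !ler0_norm ?lerN2// ltW.
Qed.

Lemma taylor3 (f f1 f2 f3 : R -> R) (K : R) :
  (forall x : R, is_derive x 1 f (f1 x)) -> (forall x : R, is_derive x 1 f1 (f2 x)) ->
  (forall x : R, is_derive x 1 f2 (f3 x)) -> (forall x, `|f3 x| <= K) ->
  forall x u, `|f (x + u) - f x - f1 x * u - f2 x / 2 * u ^+ 2| <= K * `|u| ^+ 3.
Proof.
move=> D1 D2 D3 K3 x.
have sh (g dg : R -> R) : (forall y : R, is_derive y 1 g (dg y)) ->
    forall u : R, is_derive u 1 (fun t => g (x + t)) (dg (x + u)).
  move=> gE u; have := is_derive_shift (gE (u + x)).
  by under eq_fun do rewrite addrC; rewrite addrC.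
have b2 u : `|f2 (x + u) - f2 x| <= K * `|u| ^+ 1.
  apply: (integrate_bound (f := fun u => f2 (x + u) - f2 x) (df := fun u => f3 (x + u))).
  - by rewrite addr0 subrr.
  - move=> y; have := sh _ _ D3 y => D; apply: is_derive_eq.
    by rewrite subr0.
  - by move=> y; rewrite expr0 mulr1.
have b1 u : `|f1 (x + u) - f1 x - f2 x * u| <= K * `|u| ^+ 2.
  apply: (integrate_bound (f := fun u => f1 (x + u) - f1 x - f2 x * u)
    (df := fun u => f2 (x + u) - f2 x)) => //.
  - by rewrite addr0 subrr mulr0 subrr.
  - move=> y; have := sh _ _ D2 y => D; apply: is_derive_eq.
    by rewrite /GRing.scale/=; ring.
move=> u.
apply: (integrate_bound (f := fun u => f (x + u) - f x - f1 x * u - f2 x / 2 * u ^+ 2)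
    (df := fun u => f1 (x + u) - f1 x - f2 x * u)) => //.
- by rewrite addr0 subrr mulr0 expr0n mulr0 !subrr.
- move=> y; have := sh _ _ D1 y => D; apply: is_derive_eq.
  by rewrite /GRing.scale/=; field.
Qed.

(** Three moving averages displace a point to the right by at most [3 * e]. Since y may leave
    [[-A, A]], the segment is covered by neighbourhoods taken in the whole line. *)
Lemma uniform_continuity_right (h : R -> R) (A delta : R) : continuous h -> 0 < delta ->
  exists2 e, 0 < e & forall x y, `|x| <= A -> x <= y <= x + 3 * e ->
    `|h x - h y| <= delta.
Proof.
move=> ch d0.
have d20 : 0 < delta / 2 by rewrite divr_gt0.
have := @segment_compact R (- A) A.
rewrite compact_near_coveringP => /(_ R (0^'+) (fun e x => forall y, x <= y <= x + 3 * e ->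
    `|h x - h y| <= delta)) /(_ _).
case.
  move=> x _; have /cvgrPdist_lt /(_ _ d20) := ch x.
  move=> /nbhs_ballP[r /= r0 rh].
  (* [r / 6 + 3 * (r / 6) < r] keeps y in the ball of radius r. *)
  have r6 : 0 < r / 6 by rewrite divr_gt0.
  exists (ball x (r / 6), [set e | e < r / 6]).
    by split; [exact: nbhsx_ballx|exact: nbhs_right_lt].
  move=> [x' e] [/= xx' er] y /andP[y1 y2].
  have b1 : ball x r x'.
    by move: xx'; rewrite /ball/= => h1; apply: (lt_trans h1); lra.
  have b2 : ball x r y.
    move: xx'; rewrite /ball/= !ltr_norml => /andP[h1 h2]; apply/andP; split; lra.
  have := rh _ b1; have := rh _ b2; rewrite /= !ltr_norml ler_norml.
  by move=> /andP[p1 p2] /andP[p3 p4]; apply/andP; split; lra.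
move=> e /= e0 ae.
exists (e / 2); first by rewrite divr_gt0.
move=> x y xA; apply: (ae (e / 2)).
- by rewrite /ball_/= sub0r normrN gtr0_norm; lra.
- by rewrite divr_gt0.
- by rewrite /= in_itv/= -ler_norml.
Qed.

(* f is the threefold moving average of h over windows of a small length e. *)
Lemma smooth_approximation (h : R -> R) (M A delta : R) :
  continuous h -> (forall x, `|h x| <= M) -> 0 < A -> 0 < delta ->
  exists (f f1 f2 : R -> R) (K : R),
    [/\ continuous f, forall x, `|f x| <= M,
     forall x u, `|f (x + u) - f x - f1 x * u - f2 x * u ^+ 2| <= K * `|u| ^+ 3 &
     forall x, `|h x - f x| <= delta + 2 * M / A ^+ 2 * x ^+ 2].
Proof.
move=> ch hM A0 delta0.
have M0 : 0 <= M by rewrite (le_trans _ (hM 0)).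
have [e e0 he] : exists2 e, 0 < e & forall x y, `|x| <= A -> x <= y <= x + 3 * e ->
    `|h x - h y| <= delta.
  exact: uniform_continuity_right.
have [g1 dg1 g1h] := moving_average ch e0.
have cg1 := is_derive_continuous dg1.
have [g2 dg2 g2g] := moving_average cg1 e0.
have cg2 := is_derive_continuous dg2.
have [g3 dg3 g3g] := moving_average cg2 e0.
have g3h x : exists2 y, x <= y <= x + 3 * e & g3 x = h y.
  have [y3 /andP[y3a y3b] ->] := g3g x.
  have [y2 /andP[y2a y2b] ->] := g2g y3.
  have [y1 /andP[y1a y1b] ->] := g1h y2.
  exists y1 => //; apply/andP; split; lra.
(* The third derivative is a threefold difference quotient of [h], each level costing a factor
   [2 / e]; the second derivative is halved as in Taylor's formula. *)
exists g3, (diffq e g2), (fun x => diffq e (diffq e g1) x / 2),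
  (e^-1 * (e^-1 * (e^-1 * (M + M) + e^-1 * (M + M)) + e^-1 * (e^-1 * (M + M) + e^-1 * (M + M)))).
have D2 := is_derive_diffq e dg2.
have D1 := is_derive_diffq e (is_derive_diffq e dg1).
split.
- exact: is_derive_continuous dg3.
- by move=> x; have [y _ ->] := g3h x.
- apply: (taylor3 dg3 D2 D1).
  by do 3! apply: normr_diffq_le => //.
- move=> x; have [y xy ->] := g3h x.
  have [xA|xA] := leP `|x| A.
    apply: (le_trans (he _ _ xA xy)); rewrite lerDl.
    by rewrite mulr_ge0 ?sqr_ge0// divr_ge0 ?sqr_ge0// mulr_ge0.
  (* Outside [[-A, A]] the trivial bound [2 M] is at most [2 M x^2 / A^2], so second moments will
     control the tails in place of a tightness argument. *)
  apply: (@le_trans _ _ (M + M)); first by apply: (le_trans (ler_normB _ _)); apply: lerD.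
  have A2 : A ^+ 2 <= x ^+ 2.
    by rewrite -(real_normK (num_real x)); apply: lerXn2r; rewrite ?nnegrE ?normr_ge0 ?ltW.
  have : M * 1 <= M * (x ^+ 2 / A ^+ 2).
    by rewrite ler_wpM2l// ler_pdivlMr ?exprn_gt0// mul1r.
  have -> : 2 * M / A ^+ 2 * x ^+ 2 = 2 * (M * (x ^+ 2 / A ^+ 2)) by ring.
  lra.
Qed.

End smoothing.

Lemma integral_add_cst d (T : measurableType d) (R : realType) (P : probability T R)
  (f : T -> R) (C : R) : bmeas f -> (\int[P]_w (f w + C)%:E = (Ex P f + C)%:E)%E.
Proof.
move=> bf; rewrite EFin_Ex; last by apply: bmeasD => //; exact: bmeas_cst.
by rewrite ExD//; [rewrite Ex_cst|exact: bmeas_cst].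
Qed.

Section parametrised_expectation.
Context {R : realType} d1 (T1 : measurableType d1) d2 (T2 : measurableType d2).
Variables (P2 : probability T2 R) (F : T1 * T2 -> R).
Hypothesis bF : bmeas F.

Lemma bmeas_pair1 u : bmeas (fun w => F (u, w)).
Proof. exact: (bmeas_comp bF (measurable_fun_pair (measurable_cst _) (@measurable_id _ _ _))). Qed.

Lemma bmeas_pair2 w : bmeas (fun u => F (u, w)).
Proof. exact: (bmeas_comp bF (measurable_fun_pair (@measurable_id _ _ _) (measurable_cst _))). Qed.

Lemma bmeas_nonneg_shift : exists C, measurable_fun setT (fun z => (F z + C)%:E) /\
  (forall z, 0 <= (F z + C)%:E)%E.
Proof.
have [mF [C FC]] := bF; exists C; split.
  by apply/measurable_EFinP; exact: measurable_funD.
by move=> z; rewrite lee_fin; have := FC z; rewrite ler_norml => /andP[]; lra.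
Qed.

Lemma bmeas_Ex_pair : bmeas (fun u => Ex P2 (fun w => F (u, w))).
Proof.
have [mF [D FD]] := bF; have [C [mFC FC0]] := bmeas_nonneg_shift.
split; last by exists D => u; apply: normr_Ex_le => //; exact: bmeas_pair1.
rewrite (_ : (fun u => _) = fun u => Ex P2 (fun w => F (u, w)) + C - C); last first.
  by apply/funext => u; rewrite addrK.
apply: measurable_funB => //; apply/measurable_EFinP.
have := measurable_fun_fubini_tonelli_F (m2 := P2) _ mFC FC0.
apply: eq_measurable_fun => u _ /=.
by rewrite -integral_add_cst//; exact: bmeas_pair1.
Qed.

End parametrised_expectation.

Lemma Ex_swap {R : realType} d1 (T1 : measurableType d1) d2 (T2 : measurableType d2)
    (P1 : probability T1 R) (P2 : probability T2 R) (F : T1 * T2 -> R) : bmeas F ->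
  Ex P1 (fun u => Ex P2 (fun w => F (u, w))) = Ex P2 (fun w => Ex P1 (fun u => F (u, w))).
Proof.
move=> bF; have [C [mFC FC0]] := bmeas_nonneg_shift bF.
have bF' : bmeas (fun z : T2 * T1 => F (z.2, z.1)).
  by apply: (bmeas_comp bF); apply: measurable_fun_pair;
    [exact: measurable_snd|exact: measurable_fst].
have := fubini_tonelli (m1 := P1) (m2 := P2) _ mFC FC0.
under eq_integral => u _ do rewrite (integral_add_cst P2 C (bmeas_pair1 bF u)).
under [X in _ = X -> _]eq_integral => w _ do
  rewrite (integral_add_cst P1 C (bmeas_pair2 bF w)).
rewrite (integral_add_cst P1 C (bmeas_Ex_pair P2 bF)).
rewrite (integral_add_cst P2 C (bmeas_Ex_pair P1 bF')).
by move=> [] /addIr.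
Qed.

(** * Averaging operators *)

Section averaging.
Context {R : realType} d (T : measurableType d) (P : probability T R) (Y : T -> R).
Hypothesis mY : measurable_fun setT Y.
Implicit Types f g : R -> R.

Definition avg f (x : R) : R := Ex P (fun w => f (x + Y w)).

Let bshift f : bmeas f -> bmeas (fun z : R * T => f (z.1 + Y z.2)).
Proof.
move=> bf; apply: (bmeas_comp bf); apply: measurable_funD; first exact: measurable_fst.
by apply: measurableT_comp mY _; exact: measurable_snd.
Qed.

Lemma bmeas_shift f x : bmeas f -> bmeas (fun w => f (x + Y w)).
Proof. by move=> bf; apply: (bmeas_comp bf); exact: measurable_funD. Qed.

Lemma bmeas_avg f : bmeas f -> bmeas (avg f).
Proof. by move=> bf; exact: (bmeas_Ex_pair P (bshift bf)). Qed.

Lemma avgB f g x : bmeas f -> bmeas g -> avg (fun y => f y - g y) x = avg f x - avg g x.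
Proof. by move=> bf bg; rewrite /avg ExB//; exact: bmeas_shift. Qed.

Lemma normr_avg_le f e : bmeas f -> (forall x, `|f x| <= e) -> forall x, `|avg f x| <= e.
Proof. by move=> bf fe x; apply: normr_Ex_le => //; exact: bmeas_shift. Qed.

Lemma bmeas_iter_avg n f : bmeas f -> bmeas (iter n avg f).
Proof. by move=> bf; elim: n => // n IH; exact: bmeas_avg. Qed.

Lemma iter_avgB n f g : bmeas f -> bmeas g ->
  forall x, iter n avg (fun y => f y - g y) x = iter n avg f x - iter n avg g x.
Proof.
move=> bf bg; elim: n => // n IH x.
by rewrite !iterS -avgB; try exact: bmeas_iter_avg; apply: eq_Ex => w; rewrite IH.
Qed.

Lemma normr_iter_avg_le n f e : bmeas f -> (forall x, `|f x| <= e) ->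
  forall x, `|iter n avg f x| <= e.
Proof.
move=> bf fe; elim: n => // n IH x.
by apply: normr_avg_le => //; exact: bmeas_iter_avg.
Qed.

Variables (s m3 : R).
Hypothesis iY : P.-integrable setT (EFin \o Y).
Hypothesis iY2 : P.-integrable setT (EFin \o (fun w => Y w ^+ 2)).
Hypothesis iY3 : P.-integrable setT (EFin \o (fun w => `|Y w| ^+ 3)).
Hypothesis Y_mean : Ex P Y = 0.
Hypothesis Y_var : Ex P (fun w => Y w ^+ 2) = s.
Hypothesis Y_third : Ex P (fun w => `|Y w| ^+ 3) <= m3.

(** The zero mean kills the linear term, so up to third order [avg f] depends on [Y] only through
    its variance; this is how a summand is matched with a Gaussian variable. *)
Lemma avg_taylor f x a b K : bmeas f ->
  (forall u, `|f (x + u) - f x - a * u - b * u ^+ 2| <= K * `|u| ^+ 3) ->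
  `|avg f x - f x - b * s| <= K * m3.
Proof.
move=> bf fK.
have K0 : 0 <= K.
  by have := fK 1; rewrite normr1 !expr1n !mulr1; apply: le_trans.
have if_ := bmeas_integrable P (bmeas_shift x bf).
have ic : P.-integrable setT (EFin \o (fun _ : T => f x)).
  by apply: bmeas_integrable; exact: bmeas_cst.
have iZ (c : R) (g : T -> R) : P.-integrable setT (EFin \o g) ->
    P.-integrable setT (EFin \o (fun w => c * g w)).
  by move=> ig; have := integrableZl measurableT c ig; apply: eq_integrable => // w _; rewrite /= EFinM.
have iB (g h : T -> R) : P.-integrable setT (EFin \o g) -> P.-integrable setT (EFin \o h) ->
    P.-integrable setT (EFin \o (fun w => g w - h w)).
  by move=> ig ih; have := integrableB measurableT ig ih; apply: eq_integrable => // w _; rewrite /= EFinB.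
pose r w := f (x + Y w) - f x - a * Y w - b * Y w ^+ 2.
have i1 := iB _ _ if_ ic; have i2 := iB _ _ i1 (iZ a _ iY).
have ir : P.-integrable setT (EFin \o r) := iB _ _ i2 (iZ b _ iY2).
have Er : Ex P r = avg f x - f x - b * s.
  rewrite /Ex /r RintegralB//; last exact: (iZ b _ iY2).
  rewrite RintegralB//; last exact: (iZ a _ iY).
  rewrite RintegralB// [X in _ - X - _ - _](Ex_cst P) !RintegralZl//.
  by have := Y_mean; rewrite /Ex => ->; have := Y_var; rewrite /Ex => ->; rewrite mulr0 subr0.
rewrite -Er; apply: (@le_trans _ _ (Ex P (fun w => K * `|Y w| ^+ 3))); last first.
  by rewrite /Ex RintegralZl//; apply: ler_wpM2l.
have iK := iZ K _ iY3.
rewrite ler_norml; apply/andP; split; last first.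
  by apply: le_Rintegral => // w _; have := fK (Y w); rewrite ler_norml => /andP[].
rewrite lerNl -mulN1r /Ex -RintegralZl//; apply: le_Rintegral => //; first exact: iZ.
by move=> w _; have := fK (Y w); rewrite ler_norml mulN1r lerNl => /andP[].
Qed.

End averaging.

Section two_averages.
Context {R : realType} d1 (T1 : measurableType d1) d2 (T2 : measurableType d2).
Variables (P1 : probability T1 R) (P2 : probability T2 R) (Y1 : T1 -> R) (Y2 : T2 -> R).
Hypotheses (mY1 : measurable_fun setT Y1) (mY2 : measurable_fun setT Y2).
Notation U := (avg P1 Y1).
Notation V := (avg P2 Y2).

Lemma avg_comm f : bmeas f -> U (V f) = V (U f).
Proof.
move=> bf; apply/funext => x; rewrite /avg.
have bF : bmeas (fun z : T1 * T2 => f (x + Y1 z.1 + Y2 z.2)).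
  apply: (bmeas_comp bf); apply: measurable_funD; last first.
    by apply: measurableT_comp mY2 _; exact: measurable_snd.
  by apply: measurable_funD => //; apply: measurableT_comp mY1 _; exact: measurable_fst.
have := Ex_swap P1 P2 bF; rewrite /= => ->.
by apply: eq_Ex => w; apply: eq_Ex => u; rewrite addrAC.
Qed.

(* Trotter's telescoping: U^n - V^n is the sum of the U^j V^(n-1-j) (U - V), all commuting contractions. *)
Lemma iter_avg_diff f e : bmeas f -> (forall x, `|U f x - V f x| <= e) ->
  forall n x, `|iter n U f x - iter n V f x| <= n%:R * e.
Proof.
move=> bf fe n; elim: n f bf fe => [|n IH] f bf fe x.
  by rewrite subrr normr0 mul0r.
have bU := bmeas_avg P1 mY1 bf; have bV := bmeas_avg P2 mY2 bf.
rewrite !iterSr.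
have -> : iter n U (U f) x - iter n V (V f) x =
    iter n U (fun y => U f y - V f y) x + (iter n U (V f) x - iter n V (V f) x).
  by rewrite iter_avgB// addrA subrK.
rewrite -natr1 mulrDl mul1r addrC; apply: (le_trans (ler_normD _ _)); apply: lerD.
  apply: IH => // y; rewrite avg_comm// -avgB//.
  by apply: normr_avg_le => //; exact: bmeasB.
by apply: normr_iter_avg_le => //; exact: bmeasB.
Qed.

End two_averages.

Section normal_averages.
Context {R : realType}.
Notation N s := (normal_prob (0 : R) s).

Lemma avg_normal_conv (s t r : R) (f : R -> R) : 0 < s -> 0 < t -> 0 < r ->
  r ^+ 2 = s ^+ 2 + t ^+ 2 -> bmeas f ->
  avg (N s) id (avg (N t) id f) = avg (N r) id f.
Proof.
move=> s0 t0 r0 rE bf; apply/funext => x.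
have bfx : bmeas (fun z => f (x + z)).
  by apply: (bmeas_comp bf); exact: measurable_funD.
have [C [mFC FC0]] := bmeas_nonneg_shift (F := fun z : R * R => f (x + z.2)) 
  (bmeas_comp bfx measurable_snd).
pose h z := (f (x + z) + C)%:E.
have mh : measurable_fun setT h.
  by apply/measurable_EFinP; apply: measurable_funD => //; case: bfx.
have h0 z : (0 <= h z)%E by exact: (FC0 (0, z)).
have E1 : (\int[N r]_z h z = (avg (N r) id f x + C)%:E)%E := integral_add_cst (N r) C bfx.
have E2 y : (\int[N t]_z h (y + z)%R = (avg (N t) id f (x + y) + C)%:E)%E.
  have bfxy : bmeas (fun z => f (x + y + z)).
    by apply: (bmeas_comp bf); exact: measurable_funD.
  apply: (eq_trans _ (integral_add_cst (N t) C bfxy)).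
  by apply: eq_integral => z _; rewrite /h addrA.
have bavg : bmeas (fun y => avg (N t) id f (x + y)).
  by apply: (bmeas_comp (bmeas_avg _ _ bf)) => //; exact: measurable_funD.
have E3 := integral_add_cst (N s) C bavg.
have E4 : (\int[N s]_y \int[N t]_z h (y + z)%R =
    \int[N s]_y (avg (N t) id f (x + y) + C)%:E)%E.
  by apply: eq_integral => y _; exact: E2.
have := normal_convolution s0 t0 r0 rE mh h0.
move=> /(eq_trans (esym E4)) /(eq_trans (esym E3)) E5.
have E6 := eq_trans E5 E1.
have E7 := EFin_inj E6.
exact: (addIr C E7).
Qed.

Lemma iter_avg_normal (s : R) (f : R -> R) m : 0 < s -> bmeas f ->
  iter m.+1 (avg (N s) id) f = avg (N (Num.sqrt m.+1%:R * s)) id f.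
Proof.
move=> s0 bf; elim: m => [|m IH]; first by rewrite sqrtr1 mul1r.
have p0 j : 0 < Num.sqrt j.+1%:R * s by rewrite mulr_gt0// sqrtr_gt0.
rewrite iterS IH; apply: (avg_normal_conv s0 (p0 m) (p0 m.+1) _ bf).
have q j : (Num.sqrt j.+1%:R * s) ^+ 2 = j.+1%:R * s ^+ 2.
  by rewrite exprMn sqr_sqrtr ?ler0n.
by rewrite (q m) (q m.+1) -[m.+2%:R]nat1r mulrDl mul1r.
Qed.

End normal_averages.

Lemma Ex_comp_diff_le d (T : measurableType d) (R : realType) (P : probability T R)
    (Y : T -> R) (h f : R -> R) (a b : R) :
  measurable_fun setT Y -> bmeas h -> bmeas f ->
  P.-integrable setT (EFin \o (fun w => Y w ^+ 2)) ->
  (forall x, `|h x - f x| <= a + b * x ^+ 2) ->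
  `|Ex P (fun w => h (Y w)) - Ex P (fun w => f (Y w))| <= a + b * Ex P (fun w => Y w ^+ 2).
Proof.
move=> mY bh bf iY hf.
have bhY := bmeas_comp bh mY; have bfY := bmeas_comp bf mY.
have ib : P.-integrable setT (EFin \o (fun w => b * Y w ^+ 2)).
  by have := integrableZl measurableT b iY; apply: eq_integrable => // w _; rewrite /= EFinM.
have ic : P.-integrable setT (EFin \o (fun _ : T => a)).
  by apply: bmeas_integrable; exact: bmeas_cst.
have iab : P.-integrable setT (EFin \o (fun w => a + b * Y w ^+ 2)).
  by have := integrableD measurableT ic ib; apply: eq_integrable => // w _; rewrite /= EFinD.
have <- : Ex P (fun w => a + b * Y w ^+ 2) = a + b * Ex P (fun w => Y w ^+ 2).
  by rewrite /Ex RintegralD// RintegralZl// [X in X + _](Ex_cst P).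
rewrite -ExB//.
have id_ := bmeas_integrable P (bmeasB bhY bfY).
rewrite ler_norml; apply/andP; split; last first.
  by apply: le_Rintegral => // w _; have := hf (Y w); rewrite ler_norml => /andP[].
rewrite lerNl -mulN1r -ExZ; last exact: bmeasB.
apply: le_Rintegral => //; first by apply: bmeas_integrable; apply: bmeasZ; exact: bmeasB.
by move=> w _; have := hf (Y w); rewrite ler_norml mulN1r lerNl => /andP[].
Qed.

(** * Rate on smooth functions and passage to continuous ones *)

Section central_limit.
Context d (T : measurableType d) (R : realType) (P : probability T R).
Variables (xi : nat -> T -> R) (K v : R).
Hypothesis mxi : forall i, measurable_fun setT (xi i).
Hypothesis xiK : forall i w, `|xi i w| <= K.
Hypothesis xi_indep : forall (s : seq nat) (A : nat -> set R), uniq s ->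
  (forall i, measurable (A i)) ->
  P (\big[setI/setT]_(i <- s) (xi i @^-1` A i)) =
  (\prod_(i <- s) P (xi i @^-1` A i))%E.
Hypothesis xi_ident : forall i A, measurable A ->
  P (xi i @^-1` A) = P (xi 0 @^-1` A).
Hypothesis xi_mean : Ex P (xi 0%N) = 0.
Hypothesis xi_var : Ex P (fun w => xi 0%N w ^+ 2) = v.
Hypothesis v_gt0 : 0 < v.
Notation N s := (normal_prob (0 : R) s).

Let bxi := bmeas_xi mxi xiK.
Let bpsum := bmeas_psum mxi xiK.

(** Independence and equality of laws enter here: each new summand may be averaged separately,
    against the law of [xi 0]. *)
Lemma iter_avg_psum (c : R) (f : R -> R) m x : bmeas f ->
  iter m (avg P (fun w => c * xi 0%N w)) f x = Ex P (fun w => f (x + c * psum xi m w)).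
Proof.
elim: m f => [|m IH] f bf.
  rewrite /= -[LHS](Ex_cst P); apply: eq_Ex => w.
  by rewrite /psum big_ord0 mulr0 addr0.
rewrite iterSr IH; last by apply: bmeas_avg => //; exact: measurable_funM.
have bF : bmeas (fun z : R * R => f (x + c * z.1 + c * z.2)).
  apply: (bmeas_comp bf); apply: measurable_funD.
    by apply: measurable_funD => //; apply: measurable_funM.
  by apply: measurable_funM.
rewrite -(Ex_psum_xi mxi xi_indep xi_ident m bF).
by apply: eq_Ex => w; rewrite psumS mulrDr addrA.
Qed.

Lemma smooth_clt_bound (f f1 f2 : R -> R) (K' : R) : bmeas f ->
  (forall x u, `|f (x + u) - f x - f1 x * u - f2 x * u ^+ 2| <= K' * `|u| ^+ 3) ->
  forall n, (0 < n)%N ->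
  `|Ex P (fun w => f ((Num.sqrt n%:R)^-1 * psum xi n w)) - Ex (N (Num.sqrt v)) f| <=
  (Num.sqrt n%:R)^-1 * (K' * (K ^+ 3 + 4 * Num.sqrt v ^+ 3)).
Proof.
move=> bf fK n n0; set c := (Num.sqrt n%:R)^-1.
have c0 : 0 < c by rewrite invr_gt0 sqrtr_gt0 ltr0n.
have nc : n%:R * c ^+ 2 = 1.
  by rewrite exprVn sqr_sqrtr// divff// pnatr_eq0 -lt0n.
have sv0 : 0 < Num.sqrt v by rewrite sqrtr_gt0.
pose s := c * Num.sqrt v.
have s0 : 0 < s by exact: mulr_gt0.
have sE : Num.sqrt n%:R * s = Num.sqrt v.
  by rewrite mulrA divff ?mul1r// sqrtr_eq0 -ltNge ltr0n.
pose Y w := c * xi 0%N w.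
have bY : bmeas Y by apply: bmeasZ; exact: bxi.
have mY : measurable_fun setT Y by case: bY.
have bY3 : bmeas (fun w => `|Y w| ^+ 3).
  by apply: bmeasX; split; [exact: measurableT_comp|exists (c * K) => w;
    rewrite normr_id /Y normrM gtr0_norm// ler_wpM2l// ltW].
have EU x : `|avg P Y f x - f x - f2 x * (c ^+ 2 * v)| <= K' * (c * K) ^+ 3.
  apply: (avg_taylor mY _ _ _ _ _ _ bf (fK x)).
  - exact: bmeas_integrable.
  - by apply: bmeas_integrable; exact: bmeasX.
  - exact: bmeas_integrable.
  - by rewrite ExZ ?xi_mean ?mulr0//; exact: bxi.
  - rewrite -xi_var -ExZ; last by apply: bmeasX; exact: bxi.
    by apply: eq_Ex => w; rewrite exprMn.
  - rewrite -[leRHS](Ex_cst P); apply: le_Ex => //; first exact: bmeas_cst.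
    move=> w; rewrite /Y normrM gtr0_norm//.
    apply: lerXn2r; rewrite ?nnegrE ?mulr_ge0 ?(ltW c0)//.
      by rewrite (le_trans _ (xiK 0 w)).
    by rewrite ler_wpM2l// ltW.
have EV x : `|avg (N s) id f x - f x - f2 x * (c ^+ 2 * v)| <= K' * (4 * s ^+ 3).
  apply: (avg_taylor _ _ _ _ _ _ _ bf (fK x)) => //.
  - exact: (normal_integrable s0 (n := 1)).
  - exact: (normal_integrable s0 (n := 2)).
  - have i3 := normal_integrable s0 (n := 3) isT.
    apply: (le_integrable measurableT _ _ i3).
      by apply/measurable_EFinP; apply: measurable_funX; exact: normr_measurable.
    by move=> u _; rewrite /= lee_fin !normrX normr_id.
  - exact: normal_mean.
  - by rewrite /Ex /Rintegral normal_second_moment//= /s exprMn sqr_sqrtr// ltW.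
  - have := normal_third_moment s0; rewrite /Ex /Rintegral.
    have i30 : (0 <= \int[N s]_x (`|x| ^+ 3)%:E)%E.
      by apply: integral_ge0 => u _; rewrite lee_fin exprn_ge0.
    move: i30; case: (\int[N s]_x _)%E => [r| |]//=; by rewrite lee_fin.
(* One exchange of operators costs an error of order [n^(-3/2)]; n exchanges leave [n^(-1/2)]. *)
pose B := K' * (c * K) ^+ 3 + K' * (4 * s ^+ 3).
have UV x : `|avg P Y f x - avg (N s) id f x| <= B.
  have := EU x; have := EV x; rewrite /B !ler_norml.
  move: (K' * _) (K' * (c * K) ^+ 3) => b1 b2.
  by move=> /andP[p1 p2] /andP[p3 p4]; apply/andP; split; lra.
have := @iter_avg_diff R _ T _ _ P (N s) Y id mY (@measurable_id _ _ _) f B bf UV n 0.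
rewrite iter_avg_psum// -[n in iter n (avg (N s) _)](prednK n0) iter_avg_normal//.
rewrite (prednK n0) sE.
under eq_Ex => w do rewrite add0r.
have -> : avg (N (Num.sqrt v)) id f 0 = Ex (N (Num.sqrt v)) f.
  by apply: eq_Ex => w; rewrite add0r.
move=> /le_trans; apply; rewrite le_eqVlt; apply/orP; left; apply/eqP.
transitivity (n%:R * c ^+ 2 * (c * (K' * (K ^+ 3 + 4 * Num.sqrt v ^+ 3)))).
  by rewrite /B /s; ring.
by rewrite nc mul1r.
Qed.

Theorem bounded_clt (h : R -> R) (M : R) : continuous h -> (forall x, `|h x| <= M) ->
  Ex P (fun w => h ((Num.sqrt n%:R)^-1 * psum xi n w)) @[n --> \oo] -->
  Ex (N (Num.sqrt v)) h.
Proof.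
move=> ch hM; apply/cvgrPdist_lt => e e0.
have M0 : 0 <= M by rewrite (le_trans _ (hM 0)).
have sv0 : 0 < Num.sqrt v by rewrite sqrtr_gt0.
(* Each of the two replacements of [h] by [f] will cost at most [2 * dl], together [e / 2]; the
   smooth bound has the other half. *)
pose dl := e / 8; have dl0 : 0 < dl by rewrite divr_gt0.
(* Chosen so that [2 M v / A^2 <= dl]; the summand 1 keeps [A] positive when [M = 0]. *)
pose A := Num.sqrt (2 * M * v / dl + 1).
have A1 : 0 < 2 * M * v / dl + 1.
  apply: ltr_wpDl => //; apply: divr_ge0; last exact: ltW.
  by apply: mulr_ge0; [exact: mulr_ge0|exact: ltW].
have A0 : 0 < A by rewrite sqrtr_gt0.
have AE : 2 * M / A ^+ 2 * v <= dl.
  rewrite /A sqr_sqrtr; last exact: ltW.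
  rewrite mulrAC ler_pdivrMr// mulrDr mulr1 [dl * _]mulrC divfK ?gt_eqF//.
  by rewrite lerDl ltW.
have [f [f1 [f2 [K' [cf fM fK hf]]]]] := smooth_approximation ch hM A0 dl0.
have bcont (g : R -> R) : continuous g -> (forall x, `|g x| <= M) -> bmeas g.
  by move=> cg gM; split; [exact: continuous_measurable_fun|exists M].
have bh := bcont _ ch hM; have bf := bcont _ cf fM.
pose B := K' * (K ^+ 3 + 4 * Num.sqrt v ^+ 3).
near=> n.
have n0 : (0 < n)%N by near: n; exists 1%N.
have sn0 : 0 < Num.sqrt n%:R :> R by rewrite sqrtr_gt0 ltr0n.
have nB : (Num.sqrt n%:R)^-1 * B < e / 2.
  rewrite mulrC ltr_pdivrMr// mulrC -ltr_pdivrMr ?divr_gt0//.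
  apply: (le_lt_trans (ler_norm _)).
  rewrite -sqrtr_sqr ltr_sqrt ?ltr0n//.
  by near: n; exact: nbhs_infty_gtr.
set c := (Num.sqrt n%:R)^-1.
have bS : bmeas (fun w => c * psum xi n w) by apply: bmeasZ; exact: bpsum.
have D1 := Ex_comp_diff_le (proj1 bS) bh bf (bmeas_integrable P (bmeasX 2 bS)) hf.
have D2 : `|Ex (N (Num.sqrt v)) h - Ex (N (Num.sqrt v)) f| <=
    dl + 2 * M / A ^+ 2 * Ex (N (Num.sqrt v)) (fun x => x ^+ 2).
  exact: (@Ex_comp_diff_le _ _ R (N (Num.sqrt v)) id h f _ _ (@measurable_id _ _ _) bh bf
    (normal_integrable sv0 (n := 2) isT) hf).
have D3 := smooth_clt_bound bf fK n0.
have V1 : Ex P (fun w => (c * psum xi n w) ^+ 2) = v.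
  rewrite (eq_Ex P (g := fun w => c ^+ 2 * psum xi n w ^+ 2)); last first.
    by move=> w; rewrite exprMn.
  rewrite ExZ; last by apply: bmeasX; exact: bpsum.
  rewrite (Ex_psum_sqr mxi xiK xi_indep xi_ident xi_mean xi_var).
  by rewrite /c exprVn sqr_sqrtr// mulKf// pnatr_eq0 -lt0n.
have V2 : Ex (N (Num.sqrt v)) (fun x => x ^+ 2) = v.
  rewrite /Ex /Rintegral normal_second_moment// sqr_sqrtr//= ltW//.
rewrite V1 in D1; rewrite V2 in D2; rewrite -/B in D3.
rewrite -/c in D3 nB.
have : e = 8 * dl by rewrite /dl; field.
move: D1 D2 D3 AE nB; move: (2 * M / A ^+ 2 * v) (c * B) => b1 b2.
move: (Ex P _) (Ex P _) (Ex (N (Num.sqrt v)) h) (Ex (N (Num.sqrt v)) f); clear; move=> a1 a2 a3 a4.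
rewrite !ler_norml ltr_norml => /andP[p1 p2] /andP[p3 p4] /andP[p5 p6] p7 p8 p9.
by apply/andP; split; lra.
Unshelve. all: by end_near. Qed.

End central_limit.

(** * The estimator *)

Section sphere_geometry.
Variable R : realType.

Lemma dotvC n (u v : 'rV[R]_n) : dotv u v = dotv v u.
Proof. by apply: eq_bigr => j _; rewrite mulrC. Qed.

Lemma dotv_continuous n (u : 'rV[R]_n) : continuous (fun x : 'rV[R]_n => dotv u x).
Proof.
rewrite /dotv; apply: continuous_big => [|j _ x]; first exact: add_continuous.
apply: (@continuousM _ _ (fun=> u ord0 j) (fun x : 'rV[R]_n => x ord0 j)).
  exact: cst_continuous.
exact: coord_continuous.
Qed.

Lemma borel_dotv n (u : 'rV[R]_n) (B : set R) : measurable B ->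
  borel_rV ((fun x => dotv u x) @^-1` B).
Proof.
move=> mB; pose V := g_sigma_algebraType [set U : set 'rV[R]_n | open U].
have : measurable_fun [set: V] (fun x : V => dotv u x).
  apply: (measurability _ (RGenOpens.measurableE R)) => _ [_ [a [b ->] <-]].
  rewrite setTI; apply: sub_sigma_algebra.
  apply: open_comp; last exact: interval_open.
  by move=> x _; exact: dotv_continuous.
by move=> /(_ measurableT _ mB); rewrite setTI.
Qed.

Lemma normr_dotv_le1 n (u x : 'rV[R]_n) : dotv u u = 1 -> dotv x x = 1 -> -1 <= dotv x u <= 1.
Proof.
move=> u1 x1.
have D2 (a : R) : 0 <= \sum_(j < n) (x ord0 j + a * u ord0 j) ^+ 2.
  by apply: sumr_ge0 => j _; exact: sqr_ge0.
have E a : \sum_(j < n) (x ord0 j + a * u ord0 j) ^+ 2 = dotv x x + 2 * a * dotv x u + a ^+ 2 * dotv u u.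
  rewrite /dotv !mulr_sumr -!big_split/=; apply: eq_bigr => j _; ring.
have := D2 1; have := D2 (-1); rewrite !E u1 x1 sqrrN expr1n; lra.
Qed.

Lemma dotv_normalize n (x : 'rV[R]_n) : 0 < enorm x ->
  dotv ((enorm x)^-1 *: x) ((enorm x)^-1 *: x) = 1.
Proof.
move=> x0; have xx : 0 <= dotv x x.
  by apply: sumr_ge0 => j _; rewrite -expr2 sqr_ge0.
have -> : dotv ((enorm x)^-1 *: x) ((enorm x)^-1 *: x) = (enorm x)^-1 ^+ 2 * dotv x x.
  rewrite /dotv mulr_sumr; apply: eq_bigr => j _; rewrite !mxE; ring.
by rewrite -[X in _ * X](sqr_sqrtr xx) -/(enorm x) -exprMn mulVf ?expr1n// gt_eqF.
Qed.

Lemma eq_sphere_int d (f g : 'rV[R]_d.+1 -> \bar R) :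
  (forall x, dotv x x = 1 -> f x = g x) -> sphere_int f = sphere_int g.
Proof.
move=> fg; congr (_ * lebesgue_int_rV _)%E; apply/funext => x.
by case: ifPn => // /andP[x0 _]; apply: fg; exact: dotv_normalize.
Qed.

Lemma omega_gt0 d : 0 < omega d :> R.
Proof.
by apply: divr_gt0; [apply: mulr_gt0 => //; apply: powR_gt0; exact: pi_gt0|
  apply: Gamma_gt0; rewrite divr_gt0// ltr0n].
Qed.

End sphere_geometry.

(** * Law of the projections on the axis *)

Section projection_law.
Context {R : realType} {dT : measure_display} {T : measurableType dT}.
Variables (P : probability T R) (d k : nat) (mu : 'rV[R]_(d.+1)) (rho : R).
Variable X : nat -> T -> 'rV[R]_(d.+1).
Hypotheses (d0 : (0 < d)%N) (k0 : (0 < k)%N) (mu1 : sphere d mu).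
Hypotheses (rho1 : -1 <= rho <= 1) (iidX : iid_Ck P k mu rho X).

Definition axial i w := dotv mu (X i w).

Let p := ngeg (half_index R d) k.

Lemma measurable_axial i : measurable_fun setT (axial i).
Proof.
have [mX _ _] := iidX => _ B mB; rewrite setTI.
by have := mX i _ (borel_dotv mu mB).
Qed.

Lemma axial_independent (s : seq nat) (B : nat -> set R) : uniq s ->
  (forall i, measurable (B i)) ->
  P (\big[setI/setT]_(i <- s) (axial i @^-1` B i)) =
  (\prod_(i <- s) P (axial i @^-1` B i))%E.
Proof.
move=> us mB; have [_ + _] := iidX.
move=> /(_ s (fun i => (fun x => dotv mu x) @^-1` B i) us); apply => i.
exact: borel_dotv.
Qed.

Lemma axial_identical i B : measurable B -> P (axial i @^-1` B) = P (axial 0%N @^-1` B).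
Proof.
move=> mB; have [_ _ law] := iidX.
have E j := law j _ (borel_dotv mu mB).
by rewrite [LHS](E i) [RHS](E 0%N).
Qed.

Let density_ge0 x : -1 <= x <= 1 -> 0 <= 1 + rho * p.[x].
Proof.
move=> x1; have := normr_ngeg_le1 k (half_index_ge0 R d0) x1; rewrite -/p => px.
have : `|rho * p.[x]| <= 1 by rewrite normrM mulr_ile1// ler_norml.
by rewrite ler_norml => /andP[]; lra.
Qed.

(** [L] averages polynomials of [<mu, U>] with U uniform on the sphere. The law of [X i] puts it on
    the sphere only almost surely, hence the clamp and the last clause. *)
Lemma axial_law : exists L : {poly R} -> R,
  [/\ [/\ forall q r, L (q + r) = L q + L r, forall c q, L (c%:P * q) = c * L q,
      L 1 = 1, L 'X = 0 &
      forall n, (n%:R + d%:R + 1) * L 'X^(n.+2) = n.+1%:R * L 'X^n],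
    forall q, (forall x, -1 <= x <= 1 -> 0 <= q.[x]) -> 0 <= L q,
    forall i (q : {poly R}), Ex P (fun w => q.[clamp 1 (axial i w)]) = L ((1 + rho%:P * p) * q) &
    forall i, P (axial i @^-1` ~` `[-1, 1]) = 0%E].
Proof.
have [d' [U [kappa [b [Z [[bb bZ] b0 Z1 sint [bZ0 bZn]]]]]]] := zonal_law d0 mu1.
have Z11 w : -1 <= Z w <= 1 by rewrite -ler_norml.
have mZ : measurable_fun setT Z by case: bZ.
have mb : measurable_fun setT b by case: bb.
pose c : R := (omega d)^-1.
have c0 : 0 < c by rewrite invr_gt0 omega_gt0.
have bp q : bmeas (fun w => q.[Z w]) by exact: bmeas_horner.
have bbp q : bmeas (fun w => b w * q.[Z w]) by exact: bmeasM.
pose r : {poly R} := 1 + rho%:P * p.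
have rE x : r.[x] = 1 + rho * p.[x] by rewrite /r !hornerE.
pose W w := c * (b w * r.[Z w]).
have bW : bmeas W by exact: bmeasZ.
have W0 w : 0 <= W w.
  by apply: mulr_ge0; [exact: ltW|apply: mulr_ge0 => //; rewrite rE density_ge0].
have law i B : measurable B ->
    P (axial i @^-1` B) = (\int[kappa]_w (W w * \1_B (Z w))%:E)%E.
  move=> mB; have [_ _ lawX] := iidX.
  have := lawX i _ (borel_dotv mu mB) => ->.
  (* The density is non-negative on [-1, 1], while the zonal formula asks for a non-negative
     function on the whole line. *)
  pose H (z : R) : \bar R := (if -1 <= z <= 1 then \1_B z * (c * r.[z]) else 0)%:E.
  have mH : measurable_fun setT H.
    apply/measurable_EFinP; apply: measurable_fun_ifT => //.
    - by apply: measurable_and; exact: measurable_fun_ler.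
    - apply: measurable_funM; first exact: measurable_indic.
      apply: measurable_funM => //.
      by apply: continuous_measurable_fun; exact: continuous_horner.
  have H0 z : (0 <= H z)%E.
    rewrite lee_fin; case: ifPn => // z1; apply: mulr_ge0 => //.
    by apply: mulr_ge0; [exact: ltW|rewrite rE density_ge0].
  transitivity (sphere_int (fun x : 'rV[R]_d.+1 => H (dotv x mu))).
    apply: eq_sphere_int => x x1.
    have xm := normr_dotv_le1 mu1 x1.
    rewrite /H xm /Ck_density gegen_tildeE// rE; congr (_ * _)%:E.
    by rewrite !indicE /preimage/= dotvC; congr (_%:R); apply/idP/idP; rewrite !inE.
  rewrite sint//; apply: eq_integral => w _.
  by rewrite /H Z11 -EFinM /W; congr (_%:E); ring.
have chg i (f : R -> \bar R) : measurable_fun setT f -> (forall y, 0 <= f y)%E ->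
    (\int[P]_w f (axial i w) = \int[kappa]_w ((W w)%:E * f (Z w)))%E.
  move=> mf f0.
  rewrite -(ge0_integral_distribution (mfun_of (measurable_axial i)) mf f0).
  apply: integral_change_of_density => //; first by case: bW.
  by move=> A mA; exact: law.
have EW : Ex kappa W = 1.
  have := chg 0%N (fun=> 1%E) (measurable_cst _) (fun=> lee01).
  rewrite integral_cst// mul1e [X in X = _](probability_setT P).
  by under eq_integral do rewrite mule1; rewrite EFin_Ex// => -[].
have chgE i (g : R -> R) : bmeas g -> Ex P (fun w => g (axial i w)) = Ex kappa (fun w => W w * g (Z w)).
  move=> bg; have [mg [C gC]] := bg.
  have bgZ := bmeas_comp bg mZ; have bgY := bmeas_comp bg (measurable_axial i).
  have mf : measurable_fun setT (fun y => (g y + C)%:E).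
    by apply/measurable_EFinP; exact: measurable_funD.
  have f0 y : (0 <= (g y + C)%:E)%E.
    by rewrite lee_fin; have := gC y; rewrite ler_norml => /andP[]; lra.
  have := chg i _ mf f0.
  under [X in _ = X -> _]eq_integral do rewrite -EFinM mulrDr.
  have bWg : bmeas (fun w => W w * g (Z w)) by exact: bmeasM.
  have bWC : bmeas (fun w => W w * C) by apply: bmeasM => //; exact: bmeas_cst.
  have b1 : bmeas (fun w => g (axial i w) + C) by apply: bmeasD => //; exact: bmeas_cst.
  rewrite (EFin_Ex P b1) (EFin_Ex kappa (bmeasD bWg bWC)).
  rewrite (ExD P bgY (bmeas_cst _ C)) (ExD kappa bWg bWC).
  rewrite Ex_cst [in X in _ = X -> _](eq_Ex kappa (f := fun w => W w * C) (g := fun w => C * W w)).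
    by rewrite ExZ// EW mulr1 => -[] /addIr.
  by move=> w; rewrite mulrC.
pose m0 := Ex kappa b.
have EWr : c * Ex kappa (fun w => b w * r.[Z w]) = 1 by rewrite -ExZ.
have m00 : 0 <= m0 by exact: Ex_ge0.
have m0p : 0 < m0.
  rewrite lt_neqAle m00 andbT eq_sym; apply/eqP => m0E.
  (* Since [1 + rho * p <= 2], a zero mass [m0] would leave P without mass. *)
  have : Ex kappa (fun w => b w * r.[Z w]) <= Ex kappa (fun w => 2 * b w).
    apply: le_Ex => //; first exact: bmeasZ.
    move=> w; rewrite mulrC ler_wpM2r// rE.
    have := normr_ngeg_le1 k (half_index_ge0 R d0) (Z11 w); rewrite -/p => px.
    have : `|rho * p.[Z w]| <= 1 by rewrite normrM mulr_ile1// ler_norml.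
    by rewrite ler_norml => /andP[]; lra.
  rewrite ExZ// -/m0 m0E mulr0 => h.
  have : c * Ex kappa (fun w => b w * r.[Z w]) <= 0 by rewrite pmulr_rle0.
  by rewrite EWr ler10.
pose L (q : {poly R}) := Ex kappa (fun w => b w * q.[Z w]) / m0.
have LD q1 q2 : L (q1 + q2) = L q1 + L q2.
  rewrite /L -mulrDl -ExD//; congr (_ / _); apply: eq_Ex => w.
  by rewrite hornerD mulrDr.
have LZ a q : L (a%:P * q) = a * L q.
  rewrite /L mulrA -ExZ//; congr (_ / _); apply: eq_Ex => w.
  by rewrite hornerM hornerC mulrCA.
have L1 : L 1 = 1.
  rewrite /L (eq_Ex kappa (g := b)) ?divff ?gt_eqF// => w.
  by rewrite hornerC mulr1.
have LX : L 'X = 0.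
  rewrite /L (eq_Ex kappa (g := fun w => b w * Z w)) ?bZ0 ?mul0r// => w.
  by rewrite hornerX.
have LXn n : (n%:R + d%:R + 1) * L 'X^(n.+2) = n.+1%:R * L 'X^n.
  have E m : Ex kappa (fun w => b w * ('X^m : {poly R}).[Z w]) = Ex kappa (fun w => b w * Z w ^+ m).
    by apply: eq_Ex => w; rewrite hornerXn.
  by rewrite /L !E mulrA bZn mulrA.
have L0 q : (forall x, -1 <= x <= 1 -> 0 <= q.[x]) -> 0 <= L q.
  move=> q0; apply: divr_ge0 => //; apply: Ex_ge0 => w.
  by apply: mulr_ge0 => //; exact: q0.
have [Lr _] := moment_density d0 LD LZ L1 LX LXn rho k0.
have mE : Ex kappa (fun w => b w * r.[Z w]) = m0.
  by rewrite -[LHS](divfK (lt0r_neq0 m0p)) -[RHS]mul1r; congr (_ * _); exact: Lr.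
(* The constant [omega d] is identified through the total mass of P, because [L] gives the density
   [1 + rho * p] mass 1. *)
have cm : c * m0 = 1 by rewrite -EWr mE.
exists L; split => //.
- move=> i q; rewrite (chgE i (fun y => q.[clamp 1 y])); last first.
    by apply: bmeas_horner; exact: bmeas_clamp.
  transitivity (c * m0 * L (r * q)); last by rewrite cm mul1r.
  rewrite /L -mulrA [m0 * _]mulrC divfK ?gt_eqF// -ExZ//.
  apply: eq_Ex => w; rewrite clamp_id// hornerM /W; ring.
- move=> i; rewrite law; last by apply: measurableC; exact: measurable_itv.
  apply: integral0_eq => w _; rewrite indicE memNset ?mulr0//=.
  by rewrite in_itv/= Z11.
Qed.

End projection_law.

(* For d = 1, acos is a junk constant outside [-1, 1], where [get] is applied to
   the empty set. *)
Lemma measurable_gegen (R : realType) (d k : nat) : (0 < d)%N ->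
  measurable_fun setT (gegen d k : R -> R).
Proof.
have mp (q : {poly R}) : measurable_fun setT (horner q).
  by apply: continuous_measurable_fun; exact: continuous_horner.
rewrite leq_eqVlt => /orP[/eqP <-|d1]; last first.
  rewrite (_ : gegen d k = fun x => geg1 (half_index R d) k * (ngeg (half_index R d) k).[x]).
    exact: measurable_funM.
  by apply/funext => x; rewrite gegenE.
rewrite (_ : gegen 1 k = fun x : R => if -1 <= x <= 1 then (ngeg 0 k).[x]
    else cos (k%:R * get (set0 : set R))).
  apply: measurable_fun_ifT => //.
  by apply: measurable_and; exact: measurable_fun_ler.
apply/funext => x; rewrite /gegen /=; case: ifPn => x1; first by rewrite ngeg0_cos.
congr (cos (_ * _)); rewrite acos.unlock; congr get.
by apply/seteqP; split => // y [_ yx]; move: x1; rewrite -yx cos_geN1 cos_le1.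
Qed.

Lemma ae_forall_nat d (T : measurableType d) (R : realType) (P : probability T R)
  (Q : nat -> T -> Prop) : (forall i, {ae P, forall w, Q i w}) ->
  {ae P, forall w, forall i, Q i w}.
Proof.
move=> aeQ; have nQ : P.-negligible (\bigcup_i ~` (Q i)).
  by apply: negligible_bigcup => i; exact: aeQ.
by apply: negligibleS nQ => w /= /existsNP[i ?]; exists i.
Qed.

Section gm_estimator.
Context {R : realType} {dT : measure_display} {T : measurableType dT}.
Variables (P : probability T R) (d k : nat) (mu : 'rV[R]_(d.+1)) (rho : R).
Variable X : nat -> T -> 'rV[R]_(d.+1).
Hypotheses (d0 : (0 < d)%N) (k0 : (0 < k)%N) (mu1 : sphere d mu).
Hypotheses (rho1 : -1 <= rho <= 1) (iidX : iid_Ck P k mu rho X).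

Let p : {poly R} := (dkd k d)%:P * ngeg (half_index R d) k.
Notation Y := (axial mu X).

(* Clamping makes the score bounded everywhere and changes it only on a null set. *)
Definition score i w := (p - rho%:P).[clamp 1 (Y i w)].

Let bg : bmeas (fun y => (p - rho%:P).[clamp 1 y]).
Proof. by apply: bmeas_horner; exact: bmeas_clamp. Qed.

Lemma measurable_score i : measurable_fun setT (score i).
Proof. by apply: measurableT_comp (proj1 bg) _; exact: (measurable_axial iidX). Qed.

Lemma score_independent (s : seq nat) (A : nat -> set R) : uniq s ->
  (forall i, measurable (A i)) ->
  P (\big[setI/setT]_(i <- s) (score i @^-1` A i)) =
  (\prod_(i <- s) P (score i @^-1` A i))%E.
Proof.
move=> us mA.
apply: (axial_independent iidX (B := fun i => (fun y => (p - rho%:P).[clamp 1 y]) @^-1` A i) us).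
by move=> i; exact: (preimage_measurable (proj1 bg)).
Qed.

Lemma score_identical i A : measurable A -> P (score i @^-1` A) = P (score 0%N @^-1` A).
Proof.
move=> mA.
by have := axial_identical iidX i (preimage_measurable (proj1 bg) mA).
Qed.

Lemma score_moments : [/\ Ex P (score 0%N) = 0,
  Ex P (fun w => score 0%N w ^+ 2) = sigma2_GM d k rho,
  0 < sigma2_GM d k rho & {ae P, forall w, forall i, -1 <= Y i w <= 1}].
Proof.
have [L [[LD LZ L1 LX LXn] L0 EL Y1]] := axial_law d0 k0 mu1 rho1 iidX.
split.
- rewrite /score EL.
  have [Lr Lpr] := moment_density d0 LD LZ L1 LX LXn rho k0.
  have -> : (1 + rho%:P * ngeg (half_index R d) k) * (p - rho%:P) =
     p * (1 + rho%:P * ngeg (half_index R d) k)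
     + (- rho)%:P * (1 + rho%:P * ngeg (half_index R d) k).
    by rewrite polyCN; ring.
  by rewrite LD LZ Lr Lpr mulr1 subrr.
- rewrite -(moment_sigma2 d0 LD LZ L1 LX LXn rho k0) mulrC -(EL 0%N).
  by apply: eq_Ex => w; rewrite horner_exp.
- exact: (sigma2_GM_gt0 d0 LD LZ L1 LX LXn L0).
- apply: ae_forall_nat => i; exists (Y i @^-1` ~` `[-1, 1]); split.
  + apply: preimage_measurable; first exact: (measurable_axial iidX).
    by apply: measurableC; exact: measurable_itv.
  + exact: Y1.
  + by move=> w /= h; rewrite in_itv.
Qed.

Lemma ae_rho_hat_score : {ae P, forall w, forall n, (0 < n)%N ->
  rho_hat_GM k mu X n w = n%:R^-1 * psum score n w + rho}.
Proof.
have [_ _ _] := score_moments; apply: filterS => w Y1 n n0.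
have n0' : n%:R != 0 :> R by rewrite pnatr_eq0 -lt0n.
have E (i : 'I_n) : score i w = tau k d * gegen d k (dotv mu (X i w)) - rho.
  rewrite /score clamp_id; last by rewrite ler_norml Y1.
  by rewrite tau_gegen ?Y1// /p !hornerE.
rewrite /rho_hat_GM /psum (eq_bigr _ (fun i _ => E i)) sumrB sumr_const card_ord.
by rewrite -mulr_sumr -mulr_natl; field.
Qed.

Lemma measurable_rho_hat n : measurable_fun setT (rho_hat_GM k mu X n).
Proof.
apply: measurable_funM => //; apply: measurable_sum => i.
exact: (measurableT_comp (@measurable_gegen R d k d0) (measurable_axial iidX i)).
Qed.

Let scoreK : exists K, forall i w, `|score i w| <= K.
Proof. by have [_ [K gK]] := bg; exists K => i w; exact: gK. Qed.

Lemma expectation_rho_hat n : (0 < n)%N -> ('E_P[rho_hat_GM k mu X n] = rho%:E)%E.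
Proof.
move=> n0; have [m0 v0 _ _] := score_moments; have [K sK] := scoreK.
have bps := bmeas_psum measurable_score sK n.
have bZ : bmeas (fun w => n%:R^-1 * psum score n w) by exact: bmeasZ.
have bD : bmeas (fun w => n%:R^-1 * psum score n w + rho).
  by apply: bmeasD => //; exact: bmeas_cst.
(* The estimator agrees with the mean of the clamped scores almost everywhere, and the latter is
   bounded. *)
rewrite unlock (ae_eq_integral (fun w => (n%:R^-1 * psum score n w + rho)%:E))//.
- rewrite EFin_Ex// ExD//; last exact: bmeas_cst.
  rewrite ExZ// Ex_cst.
  have -> : Ex P (psum score n) = 0.
    exact: (Ex_psum measurable_score sK score_independent score_identical m0).
  by rewrite mulr0 add0r.
- by apply/measurable_EFinP; exact: measurable_rho_hat.
- by apply/measurable_EFinP; case: bD.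
- by apply: filterS ae_rho_hat_score => w h _ /=; rewrite h.
Qed.

Lemma rho_hat_strongly_consistent :
  {ae P, forall w, rho_hat_GM k mu X n w @[n --> \oo] --> rho}.
Proof.
have [m0 v0 _ _] := score_moments; have [K sK] := scoreK.
have := fourth_moment_slln (bmeas_psum measurable_score sK)
  (Ex_psum_4_le measurable_score sK score_independent score_identical m0 v0).
apply: filterS2 ae_rho_hat_score => w Ew Sw.
have : psum score n w / n%:R + rho @[n --> \oo] --> 0 + rho.
  by apply: cvgD => //; exact: cvg_cst.
rewrite add0r; apply: cvg_trans; apply: near_eq_cvg.
by exists 1%N => // n /= n0; rewrite Ew// mulrC.
Qed.

Lemma rho_hat_asymptotically_normal : cvg_dist_normal P
  (fun n w => Num.sqrt n%:R * (rho_hat_GM k mu X n w - rho)) (sigma2_GM d k rho).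
Proof.
move=> h ch [M hM].
have [m0 v0 vp _] := score_moments; have [K sK] := scoreK.
have mh : measurable_fun setT h by exact: continuous_measurable_fun.
have bh : bmeas h by split => //; exists M.
have clt := bounded_clt measurable_score sK score_independent score_identical m0 v0 vp ch hM.
rewrite (EFin_Ex (normal_prob 0 (Num.sqrt (sigma2_GM d k rho))) bh).
apply: cvg_EFin.
  near=> n; rewrite unlock; apply: integrable_fin_num => //.
  apply: bmeas_integrable; apply: (bmeas_comp bh).
  by apply: measurable_funM => //; apply: measurable_funB => //; exact: measurable_rho_hat.
apply: cvg_trans clt; apply: near_eq_cvg; exists 1%N => // n /= n0.
have bS : bmeas (fun w => h ((Num.sqrt n%:R)^-1 * psum score n w)).
  by apply: (bmeas_comp bh); apply: measurable_funM => //; case: (bmeas_psum measurable_score sK n).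
rewrite /comp unlock (ae_eq_integral (fun w => (h ((Num.sqrt n%:R)^-1 * psum score n w))%:E))//.
- apply/measurable_EFinP; apply: measurableT_comp => //.
  by apply: measurable_funM => //; apply: measurable_funB => //; exact: measurable_rho_hat.
- by apply/measurable_EFinP; case: bS.
- apply: filterS ae_rho_hat_score => w E _ /=; rewrite E// addrK mulrA.
  have sn : Num.sqrt n%:R != 0 :> R by rewrite gt_eqF// sqrtr_gt0 ltr0n.
  congr (h (_ * _))%:E; rewrite -[X in X^-1](sqr_sqrtr (ler0n R n)); field.
Unshelve. all: by end_near. Qed.

End gm_estimator.

Theorem theorem4 (R : realType) (dT : measure_display) (T : measurableType dT)
    (P : probability T R) (d k : nat) (mu : 'rV[R]_(d.+1)) (rho : R)
    (X : nat -> T -> 'rV[R]_(d.+1)) :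
  (1 <= d)%N -> (1 <= k)%N -> sphere d mu -> -1 <= rho <= 1 ->
  iid_Ck P k mu rho X ->
  [/\ (forall n : nat, (0 < n)%N -> ('E_P[rho_hat_GM k mu X n] = rho%:E)%E),
      {ae P, forall w, rho_hat_GM k mu X n w @[n --> \oo] --> rho},
      cvg_dist_normal P
        (fun n w => Num.sqrt n%:R * (rho_hat_GM k mu X n w - rho))
        (sigma2_GM d k rho),
      sigma2_GM d 1 rho = d%:R + 1 - rho ^+ 2 &
      sigma2_GM d 2 rho = d%:R * (d%:R + 3) / 2
                          + 2 * (d%:R - 1) * (d%:R + 3) / (d%:R + 5) * rho
                          - rho ^+ 2].
Proof.
move=> d0 k0 mu1 rho1 iidX; split.
- by move=> n n0; exact: expectation_rho_hat.
- exact: rho_hat_strongly_consistent.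
- exact: rho_hat_asymptotically_normal.
- exact: sigma2_GM_1.
- exact: sigma2_GM_2.
Qed.
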